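(* Let $\mathcal{C}$ be a connected cooperad in chain complexes over a commutative ring $\Bbbk$, let $f\colon A\to B$, $g\colon B\to A$, $h\colon A\to A$ be a contraction of chain complexes, and let $t$ be an $\Omega(\mathcal{C})$-algebra structure on $A$. Put $\mathbf{f}_n=f^{\otimes n}$, $\mathbf{g}_n=g^{\otimes n}$ and let $\mathbf{h}$ be a symmetric pseudo-derivation on $A$ (not necessarily symmetric if $\mathcal{C}$ is a non-symmetric cooperad) with $\mathbf{h}_1=h$, $\partial(\mathbf{h})=\mathbf{g}\mathbf{f}-\mathbf{1}$, $\mathbf{f}\mathbf{h}=\mathbf{0}$, $\mathbf{h}\mathbf{g}=\mathbf{0}$, $\mathbf{h}\mathbf{h}=\mathbf{0}$. Let $F,G$ be the morphisms of $\mathcal{C}$-coalgebras induced by $f,g$, let $H=\mathcal{C}[\mathbf{h}]$, and let $$F'=\sum_{k\ge0}F(tH)^k,\quad G'=\sum_{k\ge0}(Ht)^kG,\quad H'=\sum_{k\ge0}H(tH)^k,\quad t'=\sum_{k\ge0}Ft(Ht)^kG$$ be the transferred $\Omega(\mathcal{C})$-algebra structure $t'$ on $B$ and the $\Omega(\mathcal{C})$-structures $F',G',H'$ on $f,g,h$. Write $(t')^\nu,f^\nu,g^\nu,h^\nu$ for the components of $t',F',G',H'$ at $\nu$. Then for every $\nu\in\mathcal{C}(n)$ with $n\ge2$, \begin{align*} (t')^\nu&=f\,t^\nu g^{\otimes n}+\sum_{q=1}^p f\,t^{\nu^q}(g^{\nu_1^q}\otimes\cdots\otimes g^{\nu_{r_q}^q})\sigma_q,\\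 g^\nu&=h\,t^\nu g^{\otimes n}+\sum_{q=1}^p h\,t^{\nu^q}(g^{\nu_1^q}\otimes\cdots\otimes g^{\nu_{r_q}^q})\sigma_q,\\ f^\nu&=(-1)^{|\nu|}f\,t^\nu\mathbf{h}_n+\sum_{i=1}^u(-1)^{|\nu_i''|}(f^{\nu_i'}\circ_{e_i}t^{\nu_i''})\tau_i\mathbf{h}_n,\\ h^\nu&=(-1)^{|\nu|}h\,t^\nu\mathbf{h}_n+\sum_{i=1}^u(-1)^{|\nu_i''|}(h^{\nu_i'}\circ_{e_i}t^{\nu_i''})\tau_i\mathbf{h}_n. \end{align*} In particular, $t'$ and $G'$ do not depend on the choice of pseudo-derivation $\mathbf{h}$ extending $h$. However, $F'$ and $H'$ do depend on this choice.
   Context: Chain complexes are unbounded complexes over $\Bbbk$ with differential of degree $-1$; the Koszul sign rule is used. A contraction of chain complexes consists of maps $f\colon A\to B$, $g\colon B\to A$ of degree $0$ and $h\colon A\to A$ of degree $1$ with $\partial(f)=0$, $\partial(g)=0$, $\partial(h)=gf-1_A$, $fg=1_B$, $fh=0$, $hh=0$, $hg=0$. A thick map $\mathbf{f}\colon A\to B$ is a sequence of maps $\mathbf{f}_n\colon A^{\otimes n}\to B^{\otimes n}$, $n\ge0$, all of the same degree; it is symmetric if each $\mathbf{f}_n$ is $\Sigma_n$-equivariant. Composition, sums and $\partial(\mathbf{f})_n=d_{B^{\otimes n}}\mathbf{f}_n-(-1)^{|\mathbf{f}|}\mathbf{f}_nd_{A^{\otimes n}}$ are levelwise; $\mathbf{1}_n=1$,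 $\mathbf{0}_n=0$. A thick map $\mathbf{h}\colon A\to A$ of degree $1$ is a pseudo-derivation if for all $p,q\ge0$ $$(\mathbf{h}_p\otimes 1-1\otimes\mathbf{h}_q)\mathbf{h}_{p+q}=\mathbf{h}_p\otimes\mathbf{h}_q,\qquad \mathbf{h}_{p+q}(\mathbf{h}_p\otimes 1-1\otimes\mathbf{h}_q)=-\mathbf{h}_p\otimes\mathbf{h}_q .$$ A cooperad $\mathcal{C}$ is connected if $\mathcal{C}(0)=0$ and $\mathcal{C}(1)=\Bbbk$. The cofree $\mathcal{C}$-coalgebra is $\mathcal{C}[A]=\bigoplus_n\mathcal{C}(n)\otimes_{\Sigma_n}A^{\otimes n}$, with $n$-th summand of weight $n$ (for non-symmetric $\mathcal{C}$ replace $\otimes_{\Sigma_n}$ by $\otimes$). For a symmetric thick map, $\mathcal{C}[\mathbf{h}]=\bigoplus_n1\otimes_{\Sigma_n}\mathbf{h}_n$. An $\Omega(\mathcal{C})$-algebra structure on a chain complex $A$ ($\Omega$ the cobar construction) is identified with a weight decreasing coderivation $t\colon\mathcal{C}[A]\to\mathcal{C}[A]$ of degree $-1$ with $\partial(t)+t^2=0$. Set $\mathbb{B}(A,t)=(\mathcal{C}[A],d_{\mathcal{C}[A]}+t)$. An $\Omega(\mathcal{C})$-structure on a chain map $f$ is a morphism of $\mathcal{C}$-coalgebras between the bar constructions with linear part $f$; $H'$ is the structure on the homotopy $h$ (with linear part $h$). The series are finite on each element since $t$ decreases weight. Components: for a map $\Phi\colon\mathcal{C}[X]\to\mathcal{C}[Y]$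 and $\nu\in\mathcal{C}(n)$, $\Phi^\nu\colon X^{\otimes n}\to Y$ is the composite of $x\mapsto\nu\otimes x\in\mathcal{C}[X]$, $\Phi$, and the projection $\epsilon\colon\mathcal{C}[Y]\to Y$ induced by the counit. Thus $t^\nu$ has degree $|\nu|-1$, $t^1=0$, and $f^1=f$, $g^1=g$, $h^1=h$ for $1\in\mathcal{C}(1)$. Notation for the coproduct $\Delta\colon\mathcal{C}\to\mathcal{C}\circ\mathcal{C}$: for $\nu\in\mathcal{C}(n)$, $n\ge2$, write $$\Delta(\nu)=\nu\circ1^{\otimes n}+1\circ\nu+\sum_{q=1}^p\nu^q\circ(\nu_1^q\otimes\cdots\otimes\nu_{r_q}^q)\sigma_q,$$ with $\nu^q\in\mathcal{C}(r_q)$, $\nu_i^q\in\mathcal{C}(a_i^q)$, $\sigma_q\in\Sigma_n$, $\sum_ia_i^q=n$, $2\le r_q\le n-1$, $1\le a_i^q\le n-1$, and $a_i^q>1$ for at least one $i$. The quadratic part consists of the terms of this last sum ($1\le q\le p$) with $a_i^q>1$ for exactly one $i$, written $$\Delta_{(1)}(\nu)=\sum_{i=1}^u(\nu_i'\circ_{e_i}\nu_i'')\tau_i,\qquad \nu_i'\circ_{e_i}\nu_i''=\nu_i'\circ(1^{\otimes e_i-1}\otimes\nu_i''\otimes1^{\otimes a_i'-e_i}),$$ with $\nu_i'\in\mathcal{C}(a_i')$, $\nu_i''\in\mathcal{C}(a_i'')$, $\tau_i\in\Sigma_n$. Correspondingly $f^{\nu_i'}\circ_{e_i}t^{\nu_i''}=f^{\nu_i'}(1^{\otimes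 e_i-1}\otimes t^{\nu_i''}\otimes1^{\otimes a_i'-e_i})$, and similarly for $h$. The permutations $\sigma_q,\tau_i$ act on $n$-fold tensor powers by permuting factors. *)

(* Defs.v *)
From HB Require Import structures.
From mathcomp Require Import all_boot all_order all_fingroup all_algebra.
From mathcomp Require Import boolp classical_sets functions cardinality fsbigop.
From Stdlib Require List.

Set Implicit Arguments.
Unset Strict Implicit.
Unset Printing Implicit Defensive.
Import GRing.Theory.
Local Open Scope ring_scope.

(* The K-module generated by the symbols in X which is universal for the maps
   X -> M satisfying [adm] (multilinear maps, balanced maps, ...).  It consists
   of formal combinations of symbols, two of them being identified when every
   admissible map to every module takes the same value on both. *)
Section Presented.
Variables (K : comPzRingType) (X : Type).

Definition comb (M : lmodType K) (phi : X -> M) (s : seq (K * X)) : M :=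
  \sum_(p <- s) p.1 *: phi p.2.

Variable adm : forall M : lmodType K, (X -> M) -> Prop.

Definition same (s t : seq (K * X)) : Prop :=
  forall (M : lmodType K) (phi : X -> M), adm phi -> comb phi s = comb phi t.

Record pres := Pres { cls : seq (K * X) -> Prop; clsP : exists s, cls = same s }.

HB.instance Definition _ := gen_eqMixin pres.
HB.instance Definition _ := gen_choiceMixin pres.

Definition pclass (s : seq (K * X)) : pres :=
  Pres (ex_intro (fun t => same s = same t) s erefl).
Definition prep (u : pres) : seq (K * X) := projT1 (cid (clsP u)).

Lemma pclassP s t : pclass s = pclass t <-> same s t.
Proof.
split=> [[e] | e].
  by have : same t t by []; rewrite -e.
have E : same s = same t.
  by apply: funext => u; apply: propext; split=> H M phi a;
    rewrite ?(e M phi a) -?(H M phi a) ?(e M phi a).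
rewrite /pclass; move: (ex_intro _ _ _) (ex_intro _ _ _).
by rewrite E => p q; congr Pres; apply: Prop_irrelevance.
Qed.

Lemma prepK u : pclass (prep u) = u.
Proof.
rewrite /prep; case: cid => s /= E; case: u E => c p /= E; subst c.
by rewrite /pclass; congr Pres; apply: Prop_irrelevance.
Qed.

Lemma comb_rep (M : lmodType K) (phi : X -> M) s : adm phi -> comb phi (prep (pclass s)) = comb phi s.
Proof. by move=> a; have /pclassP := prepK (pclass s); apply. Qed.

Lemma comb_cat (M : lmodType K) (phi : X -> M) s t : comb phi (s ++ t) = comb phi s + comb phi t.
Proof. by rewrite /comb big_cat. Qed.

Definition scomb (a : K) (s : seq (K * X)) := [seq (a * p.1, p.2) | p <- s].

Lemma comb_scale (M : lmodType K) (phi : X -> M) a s : comb phi (scomb a s) = a *: comb phi s.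
Proof.
by rewrite /comb big_map scaler_sumr; apply: eq_bigr => p _; rewrite scalerA.
Qed.

Definition padd u v := pclass (prep u ++ prep v).
Definition pscale a u := pclass (scomb a (prep u)).

Lemma pres_ext u v :
  (forall (M : lmodType K) (phi : X -> M), @adm M phi -> comb phi (prep u) = comb phi (prep v)) -> u = v.
Proof. by move=> e; rewrite -(prepK u) -(prepK v); apply/pclassP. Qed.

Lemma comb_add (M : lmodType K) (phi : X -> M) u v : adm phi ->
  comb phi (prep (padd u v)) = comb phi (prep u) + comb phi (prep v).
Proof. by move=> a; rewrite comb_rep // comb_cat. Qed.

Lemma comb_pscale (M : lmodType K) (phi : X -> M) a u : adm phi ->
  comb phi (prep (pscale a u)) = a *: comb phi (prep u).
Proof. by move=> h; rewrite comb_rep // comb_scale. Qed.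

Lemma comb_0 (M : lmodType K) (phi : X -> M) : adm phi -> comb phi (prep (pclass [::])) = 0.
Proof. by move=> h; rewrite comb_rep // /comb big_nil. Qed.

Fact paddA : associative padd.
Proof. by move=> u v w; apply: pres_ext => M phi h; rewrite !comb_add // addrA. Qed.
Fact paddC : commutative padd.
Proof. by move=> u v; apply: pres_ext => M phi h; rewrite !comb_add // addrC. Qed.
Fact padd0 : left_id (pclass [::]) padd.
Proof. by move=> u; apply: pres_ext => M phi h; rewrite comb_add // comb_0 // add0r. Qed.
Fact paddN : left_inverse (pclass [::]) (pscale (-1)) padd.
Proof.
move=> u; apply: pres_ext => M phi h.
by rewrite comb_add // comb_pscale // comb_0 // scaleN1r addNr.
Qed.
HB.instance Definition _ := GRing.isZmodule.Build pres paddA paddC padd0 paddN.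

Fact pscaleA a b u : pscale a (pscale b u) = pscale (a * b) u.
Proof. by apply: pres_ext => M phi h; rewrite !comb_pscale // scalerA. Qed.
Fact pscale1 : left_id 1 pscale.
Proof. by move=> u; apply: pres_ext => M phi h; rewrite comb_pscale // scale1r. Qed.
Fact pscaleDr : right_distributive pscale +%R.
Proof.
move=> a u v; apply: pres_ext => M phi h.
by rewrite !(comb_pscale, comb_add) // scalerDr.
Qed.
Fact pscaleDl u : {morph pscale^~ u : a b / a + b}.
Proof.
move=> a b; apply: pres_ext => M phi h.
by rewrite !(comb_pscale, comb_add) // scalerDl.
Qed.
HB.instance Definition _ :=
  GRing.Zmodule_isLmodule.Build K pres pscaleA pscale1 pscaleDr pscaleDl.

Definition gen (x : X) : pres := pclass [:: (1, x)].

(* The linear extension of an admissible map; it is meant to be used on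
   admissible maps only. *)
Definition lift (M : lmodType K) (phi : X -> M) (u : pres) : M := comb phi (prep u).

Lemma lift_gen (M : lmodType K) (phi : X -> M) x : adm phi -> lift phi (gen x) = phi x.
Proof.
by move=> h; rewrite /lift comb_rep // /comb big_seq1 scale1r.
Qed.

Lemma lift_linear (M : lmodType K) (phi : X -> M) : adm phi -> linear (lift phi).
Proof.
by move=> h a u v; rewrite /lift comb_add // comb_pscale.
Qed.

Lemma lift0 (M : lmodType K) (phi : X -> M) : adm phi -> lift phi 0 = 0.
Proof.
by move=> h; have := lift_linear h (-1) 0 0; rewrite !scaleN1r !addNr.
Qed.

Lemma liftZ (M : lmodType K) (phi : X -> M) a u :
  adm phi -> lift phi (a *: u) = a *: lift phi u.
Proof. by move=> h; rewrite -[a *: u]addr0 lift_linear // lift0 // addr0. Qed.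

Lemma lift_ext u v :
  (forall (M : lmodType K) (phi : X -> M), @adm M phi -> lift phi u = lift phi v) -> u = v.
Proof. exact: pres_ext. Qed.

End Presented.

Section Graded.
Variable K : comPzRingType.

(* A module with a distinguished notion of homogeneous element of degree i,
   and the projection on the sum of the components of odd degree (it is
   determined by the grading, cf. [graded] below, and carries the Koszul
   signs).  Graded modules are identified with their total module. *)
Record gmod := GMod {
  gcar :> lmodType K;
  goddp : gcar -> gcar;
  homog : int -> gcar -> Prop
}.

Record graded (A : gmod) : Prop := {
  hom0 : forall i, homog i (0 : A);
  hom_lin : forall i a (x y : A), homog i x -> homog i y -> homog i (a *: x + y);
  hom_sum : forall x : A, exists (s : seq int) (xs : int -> A),
    (forall i, homog i (xs i)) /\ x = \sum_(i <- s) xs i;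
  hom_direct : forall (s : seq int) (xs : int -> A), uniq s ->
    (forall i, homog i (xs i)) -> \sum_(i <- s) xs i = 0 ->
    forall i, i \in s -> xs i = 0;
  goddp_lin : linear (@goddp A);
  goddp_hom : forall i (x : A), homog i x -> goddp x = if odd `|i|%N then x else 0
}.

Record chain := Chain {
  cgm :> gmod;
  diff : {linear cgm -> cgm};
  chain_graded : graded cgm;
  diff_hom : forall i (x : cgm), homog i x -> homog (i - 1) (diff x);
  diff_diff : forall x : cgm, diff (diff x) = 0
}.

Definition part (A : gmod) (b : bool) (x : A) : A :=
  if b then goddp x else x - goddp x.
(* [ksign b x] is (-1)^(b |x|) x *)
Definition ksign (A : gmod) (b : bool) (x : A) : A :=
  if b then x - goddp x *+ 2 else x.

Inductive span (M : lmodType K) (S : M -> Prop) : M -> Prop :=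
| span0 : span S 0
| span_lin a x y : S x -> span S y -> span S (a *: x + y).

End Graded.

(* The tensor module T(A), direct sum of the A^{\otimes n}: words in A, subject
   to multilinearity.  The summand A^{\otimes n} is the image of [wt n]. *)
Section Tensor.
Variable K : comPzRingType.

Definition multilinear (A : lmodType K) (M : lmodType K) (phi : seq A -> M) : Prop :=
  forall (l r : seq A) (a : K) (x y : A),
    phi (l ++ (a *: x + y) :: r) = a *: phi (l ++ x :: r) + phi (l ++ y :: r).

Definition Tmod (A : gmod K) : lmodType K := pres (@multilinear A).

Definition word (A : gmod K) (w : seq A) : Tmod A := gen (@multilinear A) w.

Lemma word_multilinear (A : gmod K) : multilinear (@word A).
Proof.
move=> l r a x y; apply: lift_ext => M phi h.
by rewrite lift_linear // !lift_gen // h.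
Qed.

Definition Todd (A : gmod K) : Tmod A -> Tmod A :=
  lift (fun w : seq A => \sum_(bs : (size w).-tuple bool | odd (count id bs))
    word [seq part p.1 p.2 | p <- zip bs w]).

Definition Thom (A : gmod K) (i : int) : Tmod A -> Prop :=
  span (fun x => exists w : seq (int * A),
    [/\ List.Forall (fun p => homog p.1 p.2) w,
        \sum_(p <- w) p.1 = i & x = word [seq p.2 | p <- w]]).

Definition T (A : gmod K) : gmod K := GMod (@Todd A) (@Thom A).

Definition wt (A : gmod K) (n : nat) : T A -> T A :=
  lift (fun w : seq A => if size w == n then word w else 0).

Definition letter (A : gmod K) : T A -> A :=
  lift (fun w : seq A => if w is [:: v] then v else 0).

Definition tmul (A : gmod K) (x y : T A) : T A :=
  lift (fun u : seq A => lift (fun v : seq A => word (u ++ v)) y) x.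

(* f^{\otimes n} on A^{\otimes n}, for f of degree 0 *)
Definition tmap (A B : gmod K) (f : A -> B) : T A -> T B :=
  lift (fun w : seq A => word [seq f v | v <- w]).

(* the sum of the 1 \otimes ... \otimes f \otimes ... \otimes 1, for f of odd degree *)
Definition tder (A : gmod K) (f : A -> A) : T A -> T A :=
  lift (fun w : seq A => \sum_(i < size w)
    word ([seq ksign true v | v <- take i w] ++ f (nth 0 w i) :: drop i.+1 w)).

(* Permutations are read as lists of labels: L = [:: L_0; ...; L_(n-1)], a
   rearrangement of 0, ..., n-1, sends x_0...x_(n-1) to +/- x_(L_0)...x_(L_(n-1)).
   [koszul b L] is the exponent of the sign when x_j has parity b j. *)
Fixpoint koszul (b : nat -> bool) (L : seq nat) : nat :=
  if L is j :: L' then (b j * count (fun m => (m < j) && b m) L' + koszul b L')%N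
  else 0%N.

Definition permw (A : gmod K) (L : seq nat) : T A -> T A :=
  lift (fun w : seq A =>
    if perm_eq L (iota 0 (size w)) then
      \sum_(bs : (size w).-tuple bool)
        (-1) ^+ koszul (nth false bs) L *:
          word [seq part (nth false bs j) (nth 0 w j) | j <- L]
    else 0).

(* With mathcomp's product in 'S_n this makes s |-> permw (labels s) a left
   action of 'S_n on A^{\otimes n}. *)
Definition labels (n : nat) (s : 'S_n) : seq nat := [seq val (s i) | i <- enum 'I_n].

(* phi_1 \otimes ... \otimes phi_r, where phi_i : A^{\otimes a_i} -> T(B) has
   parity p_i, for the list of the (a_i, phi_i, p_i); it is zero on the words
   whose length is not the sum of the a_i. *)
Fixpoint tensw (A B : gmod K) (ms : seq (nat * (T A -> T B) * bool)) (w : seq A) : T B :=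
  if ms is (a, phi, _) :: ms' then
    tmul (phi (word [seq ksign (odd (count id (unzip2 ms'))) v | v <- take a w]))
         (tensw ms' (drop a w))
  else word [::].

Definition tensm (A B : gmod K) (ms : seq (nat * (T A -> T B) * bool)) : T A -> T B :=
  lift (fun w : seq A =>
    if size w == sumn [seq m.1.1 | m <- ms] then tensw ms w else 0).

End Tensor.

(* Sequences of chain complexes C(n) with a right action of the symmetric
   groups if sym = true; for sym = false (non-symmetric case) there is no
   action, which is encoded by [act] being trivial. *)
Section Schur.
Variables (K : comPzRingType) (sym : bool).

Record sseq := SSeq {
  scar :> nat -> chain K;
  act : forall n, scar n -> 'S_n -> scar n;
  act_lin : forall n (s : 'S_n), linear (fun c : scar n => act c s);
  act_hom : forall n i (c : scar n) (s : 'S_n), homog i c -> homog i (act c s);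
  act_diff : forall n (c : scar n) (s : 'S_n), act (diff (scar n) c) s = diff (scar n) (act c s);
  act_1 : forall n (c : scar n), act c 1%g = c;
  act_M : forall n (c : scar n) (s t : 'S_n), act c (s * t)%g = act (act c s) t;
  act_ns : ~~ sym -> forall n (c : scar n) (s : 'S_n), act c s = c
}.

Variable C : sseq.

Section SchurFunctor.
Variable A : gmod K.

(* C[A] is the direct sum of the C(n) \otimes_{\Sigma_n} A^{\otimes n}
   (C(n) \otimes A^{\otimes n} in the non-symmetric case). *)
Record balanced (M : lmodType K) (phi : {n : nat & (C n * T A)%type} -> M) : Prop := {
  bal_linl : forall n a (c c' : C n) (x : T A),
    phi (existT _ n (a *: c + c', x)) =
      a *: phi (existT _ n (c, x)) + phi (existT _ n (c', x));
  bal_linr : forall n a (c : C n) (x y : T A),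
    phi (existT _ n (c, a *: x + y)) =
      a *: phi (existT _ n (c, x)) + phi (existT _ n (c, y));
  bal_wt : forall n (c : C n) (x : T A),
    phi (existT _ n (c, x)) = phi (existT _ n (c, wt n x));
  bal_act : sym -> forall n (c : C n) (s : 'S_n) (x : T A),
    phi (existT _ n (act c s, x)) = phi (existT _ n (c, permw (labels s) x))
}.

Definition Smod : lmodType K := pres balanced.

Definition sten (n : nat) (c : C n) (x : T A) : Smod := gen balanced (existT _ n (c, x)).

Lemma sten_balanced :
  balanced (fun g : {n : nat & (C n * T A)%type} => sten (tagged g).1 (tagged g).2).
Proof.
split=> *; apply: lift_ext => M phi h; rewrite ?lift_linear // !lift_gen //=.
- exact: bal_linl.
- exact: bal_linr.
- exact: bal_wt.
- exact: bal_act.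
Qed.

Definition slift (M : lmodType K) (phi : forall n, C n -> T A -> M) : Smod -> M :=
  lift (fun g => phi (tag g) (tagged g).1 (tagged g).2).

Definition Sodd : Smod -> Smod :=
  slift (fun n c x => sten (part true c) (part false x) + sten (part false c) (part true x)).

Definition Shom (i : int) : Smod -> Prop :=
  span (fun y => exists n (c : C n) (x : T A) (p q : int),
    [/\ homog p c, homog q x, p + q = i & y = sten c x]).

Definition schur : gmod K := GMod Sodd Shom.

Definition swt (m : nat) : schur -> schur :=
  slift (fun n c x => if n == m then sten c x else 0).

(* the differential of C[A] induced by the one of C and d on A *)
Definition sdiff (d : A -> A) : schur -> schur :=
  slift (fun n c x => sten (diff (C n) c) x + sten (ksign true c) (tder d x)).

End SchurFunctor.

(* the sum of the 1 \otimes phi_n, where b is the parity of phi *)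
Definition smap (A B : gmod K) (b : bool) (phi : T A -> T B) : schur A -> schur B :=
  slift (fun n c x => sten (ksign b c) (phi x)).

(* The composite (C \circ C)(n).  The symbol
     (c, [:: (c_1, L_1); ...; (c_r, L_r)]),  c in C(r), c_i in C(a_i),
   where L_i is a list of a_i labels and L_1, ..., L_r is a rearrangement of
   0, ..., n-1, stands for (c \circ (c_1 \otimes ... \otimes c_r)) sigma, with
   sigma the permutation given by the list of labels L_1 ++ ... ++ L_r. *)
Definition block := ({a : nat & C a} * seq nat)%type.
Definition cosym := ({r : nat & C r} * seq block)%type.

Definition cosym_valid (n : nat) (g : cosym) : bool :=
  let L := flatten [seq b.2 | b <- g.2] in
  [&& size g.2 == tag g.1, all (fun b : block => size b.2 == tag b.1) g.2 &
      if sym then perm_eq L (iota 0 n) else L == iota 0 n].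

Definition block0 : block := (@existT nat (fun a => C a) 0%N (0 : C 0%N), [::]).

Record composable (n : nat) (M : lmodType K) (phi : cosym -> M) : Prop := {
  co_valid : forall g, ~~ cosym_valid n g -> phi g = 0;
  co_linl : forall r a (c c' : C r) bl,
    phi (existT _ r (a *: c + c'), bl) =
      a *: phi (existT _ r c, bl) + phi (existT _ r c', bl);
  co_linr : forall g l r m a (c c' : C m) (L : seq nat),
    phi (g, l ++ (existT _ m (a *: c + c'), L) :: r) =
      a *: phi (g, l ++ (existT _ m c, L) :: r) + phi (g, l ++ (existT _ m c', L) :: r);
  co_actr : sym -> forall g l r m (c : C m) (s : 'S_m) (L : seq nat), size L = m ->
    phi (g, l ++ (existT _ m (act c s), L) :: r) =
      phi (g, l ++ (existT _ m c, [seq nth 0%N L j | j <- labels s]) :: r);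
  co_actl : sym -> forall r (c : C r) (s : 'S_r) (bl : seq block) (bs : seq bool),
    size bl = r ->
    (forall j, goddp (tagged (nth block0 bl j).1) =
               if nth false bs j then tagged (nth block0 bl j).1 else 0) ->
    phi (existT _ r (act c s), bl) =
      (-1) ^+ koszul (nth false bs) (labels s) *:
        phi (existT _ r c, [seq nth block0 bl j | j <- labels s])
}.

Definition CC (n : nat) : lmodType K := pres (composable n).

Lemma gen_composable n : composable n (gen (composable n)).
Proof.
split=> *; apply: lift_ext => M phi h; rewrite ?lift_linear // ?lift_gen //=.
- by rewrite (co_valid h) // lift0.
- by rewrite (co_linl h).
- by rewrite (co_linr h).
- by rewrite (co_actr h).
- by rewrite liftZ // lift_gen //; apply: (co_actl h).
Qed.

(* (c \circ (c_1 \otimes ... \otimes c_r)) s *)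
Definition cten (n r : nat) (c : C r) (l : seq {a : nat & C a}) (s : 'S_n) : CC n :=
  gen (composable n)
    (existT (fun r => C r : Type) r c, zip l (reshape [seq tag a | a <- l] (labels s))).

Definition cchomog (n : nat) (i : int) : CC n -> Prop :=
  span (fun u => exists r (c : C r) (p : int) (bl : seq (int * block)),
    [/\ homog p c, List.Forall (fun b => homog b.1 (tagged b.2.1)) bl,
        p + \sum_(b <- bl) b.1 = i &
        u = gen (composable n) (existT (fun r => C r : Type) r c, unzip2 bl)]).

Definition bmap (f : forall a, C a -> C a) (b : block) : block :=
  (existT (fun a => C a : Type) (tag b.1) (f _ (tagged b.1)), b.2).

Definition ccdiff (n : nat) : CC n -> CC n :=
  lift (fun g : cosym =>
    gen (composable n)
      (existT (fun r => C r : Type) (tag g.1) (diff (C (tag g.1)) (tagged g.1)), g.2) +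
    \sum_(i < size g.2)
      gen (composable n)
        (existT (fun r => C r : Type) (tag g.1) (ksign true (tagged g.1)),
         [seq bmap (fun a => ksign true) b | b <- take i g.2] ++
         bmap (fun a => diff (C a)) (nth block0 g.2 i) :: drop i.+1 g.2)).

(* the right action of the symmetric group *)
Definition ccact (n : nat) (u : CC n) (s : 'S_n) : CC n :=
  lift (fun g : cosym => if cosym_valid n g then
    gen (composable n) (g.1, [seq (b.1, [seq nth 0%N (labels s) j | j <- b.2]) | b <- g.2])
    else 0) u.

(* The map (C \circ C)(n) \otimes A^{\otimes n} -> C[C[A]],
   (c \circ (c_1 \otimes ... \otimes c_r)) s \otimes x |->
     c \otimes ((c_1 \otimes -) \otimes ... \otimes (c_r \otimes -)) (s x),
   where c_i \otimes - : A^{\otimes a_i} -> C[A] has the parity of c_i; the sum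
   decomposes the c_i into their even and odd parts. *)
Definition ccev (A : gmod K) (n : nat) (u : CC n) (x : T A) : schur (schur A) :=
  lift (fun g : cosym => if cosym_valid n g then
    \sum_(bs : (size g.2).-tuple bool)
      sten (tagged g.1)
        (tensm [seq (tag p.2.1,
                     (fun y : T A => word [:: (sten (part p.1 (tagged p.2.1)) y : schur A)]),
                     p.1)
               | p <- zip bs g.2]
          (permw (flatten [seq b.2 | b <- g.2]) x))
    else 0) u.

End Schur.

Section Cooperad.
Variables (K : comPzRingType) (sym : bool).

(* the coproduct C[A] -> C[C[A]] and the counit C[A] -> A of the cofree coalgebra *)
Definition sdelta (C : sseq K sym) (delta : forall n, C n -> CC C n) (A : gmod K) :
    schur C A -> schur C (schur C A) :=
  slift (fun n c x => ccev (delta n c) x).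

Definition scounit (C : sseq K sym) (counit : C 1%N -> K) (A : gmod K) : schur C A -> A :=
  slift (fun n : nat =>
    match n return C n -> T A -> A with
    | 1%N => fun c x => counit c *: letter x
    | _ => fun _ _ => 0
    end).

(* As (C \circ C)[A] = C[C[A]], the counit and coassociativity axioms are
   identities between maps from C[A] to C[A] and to C[C[C[A]]], for all A.  The
   axioms in arity n are recovered on the word e_0...e_(n-1) for A free with
   basis e_0, ..., e_(n-1) in degree 0. *)
Record cooperad := Cooperad {
  coseq :> sseq K sym;
  delta : forall n, {linear coseq n -> CC coseq n};
  counit : {linear coseq 1%N -> K^o};
  delta_homog : forall n i (c : coseq n), homog i c -> cchomog i (delta n c);
  delta_diff : forall n (c : coseq n), delta n (diff (coseq n) c) = ccdiff (delta n c);
  delta_act : sym -> forall n (c : coseq n) (s : 'S_n),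
    delta n (act c s) = ccact (delta n c) s;
  counit_homog : forall i (c : coseq 1%N), homog i c -> i != 0 -> counit c = 0;
  counit_diff : forall c : coseq 1%N, counit (diff (coseq 1%N) c) = 0;
  counit_delta : forall (A : gmod K), graded A -> forall y : schur coseq A,
    scounit counit (sdelta delta y) = y;
  delta_counit : forall (A : gmod K), graded A -> forall y : schur coseq A,
    smap false (tmap (@scounit coseq counit A)) (sdelta delta y) = y;
  delta_coassoc : forall (A : gmod K), graded A -> forall y : schur coseq A,
    smap false (tmap (@sdelta coseq delta A)) (sdelta delta y) = sdelta delta (sdelta delta y)
}.

End Cooperad.

Section Transfer.
Variable K : comPzRingType.

Record contraction (A B : chain K) (f : {linear A -> B}) (g : {linear B -> A})
    (h : {linear A -> A}) : Prop := {
  ctr_f_hom : forall i (x : A), homog i x -> homog i (f x);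
  ctr_g_hom : forall i (y : B), homog i y -> homog i (g y);
  ctr_h_hom : forall i (x : A), homog i x -> homog (i + 1) (h x);
  ctr_f_diff : forall x, diff B (f x) = f (diff A x);
  ctr_g_diff : forall y, diff A (g y) = g (diff B y);
  ctr_h_diff : forall x, diff A (h x) + h (diff A x) = g (f x) - x;
  ctr_fg : forall y, f (g y) = y;
  ctr_fh : forall x, f (h x) = 0;
  ctr_hh : forall x, h (h x) = 0;
  ctr_hg : forall y, h (g y) = 0
}.

(* A thick map A -> B, i.e. a sequence of maps A^{\otimes n} -> B^{\otimes n},
   is a linear map T(A) -> T(B) that preserves the summands. *)
Definition thick (A B : gmod K) (phi : T A -> T B) : Prop :=
  forall n x, phi (wt n x) = wt n (phi x).

Definition thick_symmetric (A B : gmod K) (phi : T A -> T B) : Prop :=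
  forall n (s : 'S_n) x, phi (permw (labels s) x) = permw (labels s) (phi x).

(* phi_p \otimes psi_q, for the parities b of phi and b' of psi *)
Definition ttens (A B : gmod K) (p q : nat) (phi : T A -> T B) (b : bool)
    (psi : T A -> T B) (b' : bool) : T A -> T B :=
  tensm [:: (p, phi, b); (q, psi, b')].

Definition pseudo_derivation (A : gmod K) (hh : T A -> T A) : Prop :=
  forall p q x,
    (ttens p q hh true id false (hh x) - ttens p q id false hh true (hh x) =
       ttens p q hh true hh true x) /\
    (hh (ttens p q hh true id false x - ttens p q id false hh true x) =
       - ttens p q hh true hh true x).

Record thick_homotopy (sym : bool) (A B : chain K) (f : {linear A -> B})
    (g : {linear B -> A}) (h : {linear A -> A}) (hh : {linear T A -> T A}) : Prop := {
  th_thick : thick hh;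
  th_sym : sym -> thick_symmetric hh;
  th_hom : forall i (x : T A), homog i x -> homog (i + 1) (hh x);
  th_pder : pseudo_derivation hh;
  th_1 : forall x : A, hh (word [:: x]) = word [:: h x];
  th_diff : forall x,
    tder (diff A) (hh x) + hh (tder (diff A) x) = tmap g (tmap f x) - x;
  th_fh : forall x, tmap f (hh x) = 0;
  th_hg : forall y, hh (tmap g y) = 0;
  th_hh : forall x, hh (hh x) = 0
}.

Variables (sym : bool) (C : cooperad K sym).

(* C(0) = 0, and C(1) = K through the counit, with 1 in K corresponding to one *)
Definition connected (one : C 1%N) : Prop :=
  [/\ forall c : C 0%N, c = 0, counit C one = 1 &
      forall c : C 1%N, c = (counit C c : K) *: one].

Record omega_algebra (A : chain K) (t : {linear schur C A -> schur C A}) : Prop := {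
  om_hom : forall i (y : schur C A), homog i y -> homog (i - 1) (t y);
  om_weight : forall (m n : nat) y, (n <= m)%N -> swt m (t (swt n y)) = 0;
  om_coder : forall y,
    sdelta (delta C) (t y) = smap true (tder t) (sdelta (delta C) y);
  om_mc : forall y,
    sdiff (diff A) (t y) + t (sdiff (diff A) y) + t (t y) = 0
}.

(* the component at nu of a map C[X] -> C[Y] *)
Definition component (X Y : gmod K) (Phi : schur C X -> schur C Y) (n : nat) (nu : C n) (x : T X) : Y :=
  scounit (counit C) (Phi (sten nu x)).

Section Series.
Variables (A B : chain K) (f : {linear A -> B}) (g : {linear B -> A}).
Variables (t : {linear schur C A -> schur C A}) (hh : {linear T A -> T A}).

Let F : schur C A -> schur C B := smap false (tmap f).
Let G : schur C B -> schur C A := smap false (tmap g).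
Let H : schur C A -> schur C A := smap true hh.

(* the sums below have finitely many nonzero terms *)
Definition trF (y : schur C A) : schur C B :=
  \sum_(m \in [set: nat]) F (iter m (t \o H) y).
Definition trG (y : schur C B) : schur C A :=
  \sum_(m \in [set: nat]) iter m (H \o t) (G y).
Definition trH (y : schur C A) : schur C A :=
  \sum_(m \in [set: nat]) H (iter m (t \o H) y).
Definition trt (y : schur C B) : schur C B :=
  \sum_(m \in [set: nat]) F (t (iter m (H \o t) (G y))).

End Series.

Definition isodd (i : int) : bool := odd `|i|%N.
Definition sgnz (i : int) : K := (-1) ^+ isodd i.

(* (c \circ (c_1 \otimes ... \otimes c_r)) s with homogeneous factors, given
   with their degrees *)
Record term (n : nat) := Term {
  tar : nat; ttop : C tar; tdeg : int;
  tins : seq ({a : nat & C a} * int);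
  tsigma : 'S_n
}.

Definition term_val n (q : term n) : CC C n :=
  cten (ttop q) (unzip1 (tins q)) (tsigma q).
Definition arities n (q : term n) : seq nat := [seq tag p.1 | p <- tins q].

Definition homogeneous_term n (i : int) (q : term n) : Prop :=
  [/\ homog (tdeg q) (ttop q),
      List.Forall (fun p : {a : nat & C a} * int => homog p.2 (tagged p.1)) (tins q) &
      tdeg q + \sum_(p <- tins q) p.2 = i].

(* (nu' \circ_e nu'') s *)
Record qterm (n : nat) := QTerm {
  qar' : nat; qtop : C qar'; qdeg' : int;
  qar'' : nat; qins : C qar''; qdeg'' : int;
  qpos : nat;
  qsigma : 'S_n
}.

Definition qterm_val (one : C 1%N) n (q : qterm n) : CC C n :=
  let o := @existT nat (fun a => C a) 1%N one in
  cten (qtop q)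
    (nseq (qpos q).-1 o ++ @existT nat (fun a => C a) (qar'' q) (qins q) :: nseq (qar' q - qpos q) o)
    (qsigma q).

(* the terms ts form the sum over q in the expression of Delta(nu), |nu| = i *)
Definition coproduct_terms (one : C 1%N) n (i : int) (nu : C n) (ts : seq (term n)) : Prop :=
  List.Forall (fun q => homogeneous_term i q /\
    [/\ (2 <= tar q <= n.-1)%N, size (tins q) = tar q, sumn (arities q) = n,
        all (fun a => (1 <= a <= n.-1)%N) (arities q) && has (fun a => (1 < a)%N) (arities q) &
        sym || (tsigma q == 1%g)]) ts /\
  delta C n nu =
    cten nu (nseq n (@existT nat (fun a => C a) 1%N one)) 1%g +
    cten one [:: @existT nat (fun a => C a) n nu] 1%g +
    \sum_(q <- ts) term_val q.

(* the qs rewrite the quadratic part of the sum of the ts *)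
Definition quadratic_terms (one : C 1%N) n (i : int) (ts : seq (term n)) (qs : seq (qterm n)) : Prop :=
  List.Forall (fun q => 
    [/\ homog (qdeg' q) (qtop q), homog (qdeg'' q) (qins q) & qdeg' q + qdeg'' q = i] /\
    [/\ (2 <= qar' q)%N, (2 <= qar'' q)%N, (qar' q + qar'' q)%N = n.+1,
        (1 <= qpos q <= qar' q)%N & sym || (qsigma q == 1%g)]) qs /\
  \sum_(q <- ts | count (fun a => (1 < a)%N) (arities q) == 1%N) term_val q =
  \sum_(q <- qs) qterm_val one q.

(* phi^{nu_1} \otimes ... \otimes phi^{nu_r}, with |phi^{nu_i}| = |nu_i| *)
Definition comp_ins (X Y : gmod K) (Phi : schur C X -> schur C Y)
    (l : seq ({a : nat & C a} * int)) : T X -> T Y :=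
  tensm [seq (tag p.1, (fun x : T X => word [:: component Phi (tagged p.1) x]), isodd p.2) | p <- l].

(* 1^{\otimes e-1} \otimes t^{nu''} \otimes 1^{\otimes a'-e}, with |t^{nu''}| = |nu''| - 1 *)
Definition comp_circ (X : gmod K) (t : schur C X -> schur C X) n (q : qterm n) : T X -> T X :=
  tensm [:: ((qpos q).-1, id, false);
            (qar'' q, (fun x : T X => word [:: component t (qins q) x]), isodd (qdeg'' q - 1));
            ((qar' q - qpos q)%N, id, false)].

End Transfer.

(* Main.v *)
(* Let eps be the projection C[A] -> A and tau = eps t, and write C[a; b] for the
   map that applies b to one tensor factor and a to the other ones.  As t is a
   coderivation, t = C[eps; tau] Delta.

   G' is the unique solution of G' = G + H t G'.  Put kappa = eps G', so that
   kappa = g eps + h u with u = tau G'.  The pseudo-derivation identities imply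
     h_n (sum of the kappa * ... * u * ... * kappa) = kappa^n - (g eps)^n
   (tensor products and powers), and with coassociativity this shows that
   C[kappa] Delta solves the same equation; hence G' = C[kappa] Delta.  So kappa
   satisfies kappa = g eps + h tau C[kappa] Delta, which determines it by
   induction on the weight from h alone; this gives the formulas for g^nu and
   for t' = F t G', and the independence.

   The formulas for f^nu and h^nu follow from F' = F + F' t H, H' = H + H' t H
   and t = C[eps; tau] Delta: eps kills the inner factors of arity > 1, so only
   the quadratic part of Delta survives.

   For the dependence, suppose that A splits into summands stable under d and h,
   with weights w_j which vanish exactly for the image of g.  On tensors of total
   weight w > 0, take for h_n the derivation extending the sum of the w_j h p_j,
   divided by w, where p_j is the projection to the j-th summand (and take 0 if
   w = 0).  This is a symmetric pseudo-derivation.  With two acyclic summands, two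
   choices of the weights give different F' and H' already for a product with two
   inputs over the cooperad with Delta nu = nu o 1 + 1 o nu. *)

From HB Require Import structures.
From mathcomp Require Import all_boot all_order all_fingroup all_algebra.
From mathcomp Require Import boolp classical_sets fsbigop.
From mathcomp Require Import zify ring.
Require Import Defs.

Set Implicit Arguments.
Unset Strict Implicit.
Unset Printing Implicit Defensive.
Import GRing.Theory.
Local Open Scope ring_scope.

(** * Parity and presentations *)

(** All modules are presented by generators, so identities are checked on words and on decomposable
    elements, with letters of pure parity; Koszul signs then become sums modulo 2 over pairs of
    letters.

    The identity for h_n rests on h(a \otimes gy) = h(a) \otimes gy and its mirror image. These are
    not axioms: they come from the boundary of the second pseudo-derivation identity, using dh + hd
    = gf - 1.

    Comparing G' with K = C[kappa] Delta meets a circularity: the identity for h_n evaluates H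
    C[kappa; tau G'] Delta, whereas tK = C[kappa; tau K] Delta. The two are matched by induction on
    the arity. Connectedness makes every inner factor smaller, except in terms with a single outer
    input; those only reach weight 1, where the counit decides.

    The weighted map is a pseudo-derivation because 1/(ab) = (1/a + 1/b)/(a + b), where a and b are
    the weights of the two tensor factors.

    The product of the example takes values in the multiples of b + u1: f detects b and h detects
    u1, so that a single product separates both F' and H'. *)

Section LinearProp.
Variables (K : pzRingType) (U V W : lmodType K).
Implicit Types (f g : U -> V).

(** Linearity is handled as a predicate on bare functions: most maps below are lifts, whose
    linearity is a consequence of an admissibility proved separately. *)
Lemma lin0 f : linear f -> f 0 = 0.
Proof. by move=> h; have := h (-1) 0 0; rewrite !scaleN1r !addNr. Qed.
Lemma linD f : linear f -> {morph f : x y / x + y}.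
Proof. by move=> h x y; have := h 1 x y; rewrite !scale1r. Qed.
Lemma linZ f : linear f -> forall a, {morph f : x / a *: x}.
Proof. by move=> h a x; have := h a x 0; rewrite !addr0 lin0 // addr0. Qed.
Lemma linN f : linear f -> {morph f : x / - x}.
Proof. by move=> h x; rewrite -scaleN1r linZ // scaleN1r. Qed.
Lemma linB f : linear f -> {morph f : x y / x - y}.
Proof. by move=> h x y; rewrite linD // linN. Qed.
Lemma lin_sum f : linear f -> forall I (r : seq I) (P : pred I) (F : I -> U),
  f (\sum_(i <- r | P i) F i) = \sum_(i <- r | P i) f (F i).
Proof. by move=> h I r P F; apply: (big_morph f (linD h) (lin0 h)). Qed.

Lemma lin_comp (p : V -> W) f : linear p -> linear f -> linear (fun x => p (f x)).
Proof. by move=> hp hf a x y; rewrite hf hp. Qed.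
Lemma lin_add f g : linear f -> linear g -> linear (fun x => f x + g x).
Proof. by move=> hf hg a x y; rewrite hf hg scalerDr addrACA. Qed.
Lemma lin_opp f : linear f -> linear (fun x => - f x).
Proof. by move=> hf a x y; rewrite hf opprD scalerN. Qed.
Lemma lin_sub f g : linear f -> linear g -> linear (fun x => f x - g x).
Proof. by move=> hf hg; apply: lin_add => //; apply: lin_opp. Qed.
Lemma lin_zero : linear (fun _ : U => 0 : V).
Proof. by move=> a x y; rewrite scaler0 addr0. Qed.
Lemma lin_id : linear (fun x : U => x).
Proof. by []. Qed.
Lemma lin_bigsum I (r : seq I) (P : pred I) (F : I -> U -> V) :
  (forall i, linear (F i)) -> linear (fun x => \sum_(i <- r | P i) F i x).
Proof.
move=> h a x y; rewrite scaler_sumr -big_split; apply: eq_bigr => i _; exact: h.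
Qed.
End LinearProp.

Lemma lin_scale (K : comPzRingType) (U V : lmodType K) (f : U -> V) (a : K) :
  linear f -> linear (fun x => a *: f x).
Proof. by move=> hf b x y; rewrite hf scalerDr !scalerA mulrC. Qed.

Section PresGen.
Variables (K : comPzRingType) (X : Type).
Variable adm : forall M : lmodType K, (X -> M) -> Prop.
Let pr := pres adm.

(** Elements are equal as soon as all lifts of admissible maps agree on them, and a lift is computed
    on the chosen representative by this very sum. *)
Lemma pres_gen_sum (u : pr) : u = \sum_(p <- prep u) p.1 *: gen adm p.2.
Proof.
apply: lift_ext => M phi h.
rewrite lin_sum; last exact: lift_linear.
rewrite {1}/lift /comb; apply: eq_bigr => p _.
by rewrite liftZ // lift_gen.
Qed.

Lemma pres_lin_ext (M : lmodType K) (f g : pr -> M) : linear f -> linear g ->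
  (forall x, f (gen adm x) = g (gen adm x)) -> f =1 g.
Proof.
move=> hf hg e u; rewrite (pres_gen_sum u) !lin_sum //; apply: eq_bigr => p _.
by rewrite !linZ // e.
Qed.

End PresGen.

Lemma isoddD i k : isodd (i + k) = isodd i (+) isodd k.
Proof. by rewrite /isodd; lia. Qed.

Section Parity.
Variable K : comPzRingType.
Implicit Types A B : gmod K.

(* The fragment of [graded] which is inherited by tensor modules and by C[A]
   without any discussion of directness. *)
Record parited A : Prop := {
  par_lin : linear (@goddp K A);
  par_hom : forall i (x : A), homog i x -> goddp x = if odd `|i|%N then x else 0;
  par_span : forall x : A, span (fun y => exists i, homog i y) x
}.

Lemma graded_parited A : graded A -> parited A.
Proof.
case=> h0 hl hs hd gl gh; split=> // x.
have [s [xs [hxs ->]]] := hs x.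
elim: s => [|i s IH]; first by rewrite big_nil; apply: span0.
rewrite big_cons -[xs i]scale1r; apply: span_lin => //; by exists i.
Qed.

Lemma span_ext (M N : lmodType K) (S : M -> Prop) (f g : M -> N) :
  linear f -> linear g -> (forall x, S x -> f x = g x) ->
  forall x, span S x -> f x = g x.
Proof.
move=> hf hg e x; elim=> [|a y z Sy _ IH]; first by rewrite !lin0.
by rewrite hf hg e // IH.
Qed.

Lemma span_gen (M : lmodType K) (S : M -> Prop) x : S x -> span S x.
Proof. by move=> h; rewrite -[x]addr0 -[x]scale1r; apply: span_lin => //; apply: span0. Qed.

Lemma span_add (M : lmodType K) (S : M -> Prop) x y : span S x -> span S y -> span S (x + y).
Proof.
elim=> [|a u v Su _ IH] h; first by rewrite add0r.
by rewrite -addrA; apply: span_lin => //; apply: IH.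
Qed.

Lemma span_scale (M : lmodType K) (S : M -> Prop) a x : span S x -> span S (a *: x).
Proof.
elim=> [|b u v Su _ IH]; first by rewrite scaler0; apply: span0.
by rewrite scalerDr scalerA; apply: span_lin.
Qed.

Lemma span_image (M N : lmodType K) (S : M -> Prop) (S' : N -> Prop) (f : M -> N) :
  linear f -> (forall x, S x -> span S' (f x)) -> forall x, span S x -> span S' (f x).
Proof.
move=> hf h x; elim=> [|a u v Su _ IH]; first by rewrite lin0 //; apply: span0.
by rewrite hf; apply: span_add => //; apply: span_scale; apply: h.
Qed.

Lemma hom_ext A (N : lmodType K) (f g : A -> N) : parited A -> linear f -> linear g ->
  (forall i x, homog i x -> f x = g x) -> f =1 g.
Proof.
move=> pA hf hg e x; apply: (span_ext hf hg _ (par_span pA x)) => y [i hy].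
exact: e hy.
Qed.

Section OneParited.
Variables (A : gmod K) (pA : parited A).

Lemma goddp_idem (x : A) : goddp (goddp x) = goddp x.
Proof.
have lg := par_lin pA.
move: x; apply: (hom_ext pA) => [||i y hy]; [exact: lin_comp|exact: lg|].
by rewrite (par_hom pA hy); case: ifP => o; rewrite ?(par_hom pA hy) ?o // lin0.
Qed.

Lemma part_lin b : linear (@part K A b).
Proof.
have lg := par_lin pA.
by case: b => //=; apply: lin_sub.
Qed.

Lemma ksign_lin b : linear (@ksign K A b).
Proof.
have lg := par_lin pA.
case: b => //; rewrite /ksign => a x y.
rewrite lg scalerBr mulrnDl opprD scalerMnr addrACA //.
Qed.

(** Signs see the degree only through its parity. Unlike homogeneous decompositions, the splitting
    of an element into two pure parts is canonical and given by the projector; 0 has both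
    parities. *)
Definition pure b (x : A) : Prop := goddp x = if b then x else 0.

Lemma pure_part b (x : A) : pure b (part b x).
Proof.
rewrite /pure; case: b => /=; first exact: goddp_idem.
by rewrite (linB (par_lin pA)) goddp_idem subrr.
Qed.

Lemma part_pure b c (x : A) : pure b x -> part c x = if b == c then x else 0.
Proof. by rewrite /pure /part => ->; case: b c => [] [] //=; rewrite ?subrr ?subr0. Qed.

Lemma partD (x : A) : x = part true x + part false x.
Proof. by rewrite /= addrC subrK. Qed.

Lemma ksign_pure b c (x : A) : pure b x -> ksign c x = (-1) ^+ (c && b) *: x.
Proof.
rewrite /pure /ksign; case: c => /=; last by rewrite scale1r.
move=> ->; case: b; rewrite ?mul0rn ?subr0 ?expr0 ?scale1r //.
by rewrite expr1 scaleN1r mulr2n opprD addrA subrr sub0r.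
Qed.

Lemma pure0 b : pure b 0.
Proof. by rewrite /pure (lin0 (par_lin pA)); case: b. Qed.

Lemma pureZ b a x : pure b x -> pure b (a *: x).
Proof. by rewrite /pure (linZ (par_lin pA)) => ->; case: b => //; rewrite scaler0. Qed.

Lemma pureD b x y : pure b x -> pure b y -> pure b (x + y).
Proof. by rewrite /pure (linD (par_lin pA)) => -> ->; case: b => //; rewrite addr0. Qed.

Lemma hom_pure i (x : A) : homog i x -> pure (isodd i) x.
Proof. exact: par_hom. Qed.

Lemma pure_ext (N : lmodType K) (f g : A -> N) : linear f -> linear g ->
  (forall b x, pure b x -> f x = g x) -> f =1 g.
Proof.
move=> hf hg e x; rewrite (partD x) (linD hf) (linD hg).
by rewrite (e _ _ (pure_part true x)) (e _ _ (pure_part false x)).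
Qed.

Lemma ksignK b (x : A) : ksign b (ksign b x) = x.
Proof.
move: x; apply: pure_ext => [||c x px]; [|exact: lin_id|].
  by apply: lin_comp; apply: ksign_lin.
rewrite (ksign_pure _ px) (linZ (ksign_lin b)) (ksign_pure _ px) scalerA -signr_addb addbb.
by rewrite scale1r.
Qed.
End OneParited.

(** Degree b modulo 2, as an equation valid for all x rather than an implication on pure elements,
    so that it can be used for rewriting. *)
Definition parmap A B b (phi : A -> B) := forall x, goddp (phi x) = phi (part (~~ b) x).

Lemma parmap_pure A B b c (phi : A -> B) x : parited A -> linear phi ->
  parmap b phi -> pure c x -> pure (b (+) c) (phi x).
Proof.
move=> pA hl hp px; rewrite /pure hp (part_pure _ px).
by case: b c px {hp} => [] [] //=; rewrite lin0.
Qed.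

Lemma parmap_intro A B b (phi : A -> B) : parited A -> parited B -> linear phi ->
  (forall c x, pure c x -> pure (b (+) c) (phi x)) -> parmap b phi.
Proof.
move=> pA pB hl e; apply: pure_ext => // [||c x px].
- by apply: lin_comp => //; apply: par_lin.
- by apply: lin_comp => //; apply: part_lin.
rewrite (e _ _ px) (part_pure _ px).
by case: b {e} c px => [] [] //=; rewrite lin0.
Qed.

Lemma parmap_homog A B (k : int) (phi : A -> B) : parited A -> parited B -> linear phi ->
  (forall i x, homog i x -> homog (i + k) (phi x)) -> parmap (isodd k) phi.
Proof.
move=> pA pB hl e; apply: hom_ext => // [||i x hx].
- by apply: lin_comp => //; apply: par_lin.
- by apply: lin_comp => //; apply: part_lin.
have := hom_pure pB (e _ _ hx); have px := hom_pure pA hx.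
rewrite (part_pure _ px) /pure => ->.
rewrite isoddD.
by case: (isodd i); case: (isodd k) => //=; rewrite lin0.
Qed.

Lemma parmap_ksign A B b c (phi : A -> B) x : parited A -> parited B -> linear phi ->
  parmap b phi -> ksign c (phi x) = (-1) ^+ (b && c) *: phi (ksign c x).
Proof.
move=> pA pB hl hp; move: x; apply: pure_ext => // [||d x px].
- by apply: lin_comp => //; apply: ksign_lin.
- by apply: lin_scale; apply: lin_comp => //; apply: ksign_lin.
have pp := parmap_pure pA hl hp px.
rewrite (ksign_pure _ pp) (ksign_pure _ px) (linZ hl) scalerA -signr_addb.
by case: b c d {px pp hp} => [] [] [].
Qed.

End Parity.

Arguments ksign : simpl never.
Arguments part : simpl never.

(** * Koszul exponents as sums modulo 2 over pairs *)

Section Signs.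
Local Open Scope nat_scope.

Local Notation "\xor_ ( i <- r ) F" := (\big[addb/false]_(i <- r) F%B)
  (at level 41, F at level 41, i, r at level 50).

(** Sum of F over the pairs of entries, the earlier one as first argument. Koszul exponents have
    this form, and so do the signs from maps passing the letters of preceding blocks. *)
Fixpoint pairx (F : nat -> nat -> bool) (J : seq nat) : bool :=
  if J is j :: J' then \xor_(i <- J') F j i (+) pairx F J' else false.

Local Ltac xor_cases := do ![case: (bigop _ _ _) => // | case: (pairx _ _) => //].

Lemma pairx_add F G J : pairx (fun i j => F i j (+) G i j) J = pairx F J (+) pairx G J.
Proof.
elim: J => //= j J ->; rewrite big_split /=.
by rewrite addbACA.
Qed.

Lemma pairx_eq (R : rel nat) F G J : pairwise R J -> (forall i j, R i j -> F i j = G i j) ->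
  pairx F J = pairx G J.
Proof.
move=> + e; elim: J => //= j J IH /andP[/allP a p]; rewrite IH //; congr addb.
by apply: eq_big_seq => i /a /e.
Qed.

Lemma pairx_ext F G J : F =2 G -> pairx F J = pairx G J.
Proof. by move=> e; elim: J => //= j J ->; congr addb; apply: eq_bigr. Qed.

Lemma pairx_cat F J J' : pairx F (J ++ J') =
  pairx F J (+) pairx F J' (+) \xor_(i <- J) \xor_(j <- J') F i j.
Proof.
elim: J => [|j J IH] /=; first by rewrite big_nil addbF.
rewrite IH big_cat big_cons /=.
by xor_cases.
Qed.

(** For symmetric F a pair contributes the same in either order. This is how a sign is transported
    between a rearranged list and the sorted one. *)
Lemma pairx_perm F J J' : uniq J -> {in J &, forall i j, i != j -> F i j = F j i} ->
  perm_eq J J' -> pairx F J = pairx F J'.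
Proof.
elim: J J' => [|j J IH] J' /=; first by rewrite perm_sym => _ _ /perm_nilP ->.
case/andP=> jJ uJ sF pJ.
have jJ' : j \in J' by rewrite -(perm_mem pJ) mem_head.
have uJ' : uniq J' by rewrite -(perm_uniq pJ) /= jJ.
case/splitPr: jJ' pJ uJ' => l r pJ uJ'.
have pJ2 : perm_eq J (l ++ r) by rewrite -(perm_cons j) (permPl pJ) -cat1s perm_catCA.
have sF' : {in J &, forall i j, i != j -> F i j = F j i}.
  by move=> i k iJ kJ; apply: sF; rewrite inE ?iJ ?kJ orbT.
rewrite (IH _ uJ sF' pJ2) (perm_big _ pJ2) !pairx_cat big_cat /=.
have -> : \xor_(i <- l) \xor_(k <- j :: r) F i k =
   \xor_(i <- l) F j i (+) \xor_(i <- l) \xor_(k <- r) F i k.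
  rewrite -big_split; apply: eq_big_seq => i il; rewrite big_cons sF //.
  - by rewrite inE (perm_mem pJ2) mem_cat il orbT.
  - by rewrite mem_head.
  apply: contraNneq jJ => <-; by rewrite (perm_mem pJ2) mem_cat il.
by xor_cases.
Qed.

Lemma pairx_map F (u : nat -> nat) J : pairx F (map u J) = pairx (fun i j => F (u i) (u j)) J.
Proof. by elim: J => //= j J ->; rewrite big_map. Qed.

(** Pairs of letters are either inside one block or spread over two. *)
Lemma pairx_flatten F (Ls : nat -> seq nat) J : pairx F (flatten (map Ls J)) =
  \xor_(j <- J) pairx F (Ls j) (+)
  pairx (fun i j => \xor_(x <- Ls i) \xor_(y <- Ls j) F x y) J.
Proof.
elim: J => /= [|j J IH]; first by rewrite big_nil.
rewrite pairx_cat IH big_cons.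
have -> : \xor_(x <- Ls j) \xor_(y <- flatten (map Ls J)) F x y =
  \xor_(i <- J) \xor_(x <- Ls j) \xor_(y <- Ls i) F x y.
  rewrite [RHS]exchange_big /=; apply: eq_bigr => x _.
  by rewrite big_flatten big_map.
by xor_cases.
Qed.

Lemma odd_count (T : Type) (a : pred T) (s : seq T) : odd (count a s) = \xor_(x <- s) a x.
Proof. by elim: s => [|x s IH] /=; rewrite ?big_nil // big_cons oddD IH oddb. Qed.

(** An inversion between two odd letters, i being the one that stands first. *)
Definition inv (b : nat -> bool) i j := (j < i) && (b i && b j).

Lemma odd_koszul b L : odd (koszul b L) = pairx (inv b) L.
Proof.
elim: L => //= j L IH; rewrite oddD oddM IH oddb odd_count; congr addb.
rewrite /inv; case: (b j) => /=; first by apply: eq_bigr => m _.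
by rewrite big1 // => i _; rewrite andbF.
Qed.

Lemma koszul_ext b c L : {in L, b =1 c} -> koszul b L = koszul c L.
Proof.
elim: L => //= j L IH e; rewrite e ?mem_head // IH; last first.
  by move=> i iL; apply: e; rewrite inE iL orbT.
congr (_ * _ + _)%N; apply: eq_in_count => i iL /=.
by rewrite e // inE iL orbT.
Qed.

Lemma big_xor_perm (F : nat -> bool) (J J' : seq nat) :
  perm_eq J J' -> \xor_(i <- J) F i = \xor_(i <- J') F i.
Proof. exact: perm_big. Qed.

Lemma xor_andl (c : bool) (F : nat -> bool) (J : seq nat) :
  \xor_(i <- J) (c && F i) = c && \xor_(i <- J) F i.
Proof. by rewrite big_distrr. Qed.

Lemma ltn_neqN (i j : nat) : i != j -> (i < j) = ~~ (j < i).
Proof. by lia. Qed.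

Lemma flatten_disj (Ls : nat -> seq nat) J i j x y : uniq (flatten (map Ls J)) ->
  i \in J -> j \in J -> i != j -> x \in Ls i -> y \in Ls j -> x != y.
Proof.
elim: J => //= k J IH; rewrite cat_uniq => /and3P[_ /hasPn d u].
have nin l z : l \in J -> z \in Ls l -> z \notin Ls k.
  by move=> lJ zl; apply: d; apply/flattenP; exists (Ls l) => //; apply: map_f.
rewrite !inE => /predU1P[->|iJ] /predU1P[->|jJ]; first by rewrite eqxx.
- by move=> _ xi yj; apply: contraNneq (nin _ _ jJ yj) => <-.
- by move=> _ xi yj; apply: contraNneq (nin _ _ iJ xi) => ->.
- exact: IH.
Qed.

(** The Koszul sign is a cocycle: a pair is inverted by a composite exactly when one of the two
    rearrangements inverts it and the other does not. *)
Lemma koszul_comp b L L' : uniq L -> perm_eq L' (iota 0 (size L)) ->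
  odd (koszul b [seq nth 0%N L j | j <- L']) =
  odd (koszul b L) (+) odd (koszul (fun j => b (nth 0%N L j)) L').
Proof.
move=> uL pL; rewrite !odd_koszul pairx_map.
set bb := fun j => b _; set n := size L in pL *.
have uL' : uniq L' by rewrite (perm_uniq pL) iota_uniq.
have ltL' i : i \in L' -> i < n by rewrite (perm_mem pL) mem_iota add0n.
(* [F] says that L inverts the positions a and c, whichever of them comes first. Being symmetric, it
   may be summed along L' instead of along the sorted positions. *)
pose F a c := bb a && bb c && ((c < a) (+) (nth 0%N L c < nth 0%N L a)).
have -> : pairx (inv b) L = pairx F L'.
  rewrite -[in LHS](mkseq_nth 0%N L) pairx_map -/n.
  rewrite (pairx_perm uL' _ pL); last first.
    move=> i j /ltL' li /ltL' lj nij; rewrite /F andbC [RHS]andbC [bb j && _]andbC; congr andb.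
    have nL : nth 0%N L i != nth 0%N L j by rewrite nth_uniq.
    by rewrite (ltn_neqN nij) (ltn_neqN nL) addbN addNb negbK.
  apply: (@pairx_eq ltn); first by rewrite -sorted_pairwise ?iota_ltn_sorted //; apply: ltn_trans.
  by move=> i j /= lij; rewrite /F /inv [j < i]ltnNge (ltnW lij) /= andbC.
rewrite -pairx_add; apply: pairx_ext => i j.
by rewrite /F /inv /bb; case: (b _); case: (b _); rewrite /= ?andbF ?andbT //; case: (j < i); rewrite ?addbF ?addFb ?addTb ?addbT ?negbK.
Qed.

Lemma perm_iota_nth L L' : perm_eq L' (iota 0 (size L)) ->
  perm_eq [seq nth 0%N L j | j <- L'] L.
Proof. by move=> p; rewrite -{2}(mkseq_nth 0%N L); apply: perm_map. Qed.

Section Blocks.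
Variables (b : nat -> bool) (Ls : nat -> seq nat).

Definition blockpar i := \xor_(x <- Ls i) b x.

(* Rearranging the blocks [Ls 0, ..., Ls (r - 1)], sent to letters of parity [p j + blockpar j]. *)
Lemma koszul_blocks (p : nat -> bool) r J : perm_eq J (iota 0 r) ->
  uniq (flatten (map Ls (iota 0 r))) ->
  odd (koszul b (flatten (map Ls (iota 0 r)))) (+)
  pairx (fun i j => blockpar i && p j) (iota 0 r) (+)
  odd (koszul (fun j => p j (+) blockpar j) J) =
  odd (koszul p J) (+) odd (koszul b (flatten (map Ls J))) (+)
  pairx (fun i j => blockpar i && p j) J.
Proof.
move=> pJ uL; rewrite !odd_koszul !pairx_flatten (big_xor_perm _ pJ).
set S := \xor_(_ <- _) _.
pose cross i j := \xor_(x <- Ls i) \xor_(y <- Ls j) inv b x y; rewrite -/cross.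
(* [P] is symmetric: exchanging two blocks changes [cross] by the product of their parities, which
   balances the other terms. So its sum over J can be computed on the sorted list, where the
   inversion part vanishes. *)
pose P i j := (j < i) && (p i && p j (+) (p i (+) blockpar i) && (p j (+) blockpar j)) (+)
   (cross i j (+) blockpar i && p j).
have crossC i j : i \in J -> j \in J -> i != j ->
    cross i j = cross j i (+) blockpar i && blockpar j.
  move=> iJ jJ nij.
  move: iJ jJ; rewrite !(perm_mem pJ) => iJ jJ.
  rewrite /cross [X in X (+) _]exchange_big /= /blockpar.
  have -> : (\xor_(x <- Ls i) b x) && (\xor_(y <- Ls j) b y) =
            \xor_(x <- Ls i) \xor_(y <- Ls j) (b x && b y).
    by rewrite big_distrl; apply: eq_bigr => x _; rewrite xor_andl.
  rewrite -big_split; apply: eq_big_seq => x xi.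
  rewrite -big_split; apply: eq_big_seq => y yj /=.
  have nxy := flatten_disj uL iJ jJ nij xi yj.
  rewrite /inv (ltn_neqN nxy) [b y && b x]andbC; case: (b x && b y); case: (y < x) => //.
have E : pairx P J = pairx (fun i j => cross i j (+) blockpar i && p j) (iota 0 r).
  rewrite (pairx_perm _ _ pJ); last first.
  - move=> i j iJ jJ nij; rewrite /P [cross i j]crossC //.
    case: (ltngtP i j) nij => //= _ _;
    by case: (p i); case: (p j); case: (blockpar i); case: (blockpar j); case: (cross j i).
  - by rewrite (perm_uniq pJ) iota_uniq.
  apply: (@pairx_eq ltn); first by rewrite -sorted_pairwise ?iota_ltn_sorted //; apply: ltn_trans.
  by move=> i j /= lij; rewrite /P [j < i]ltnNge (ltnW lij).
move: E; rewrite /P !pairx_add.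
have -> : pairx (fun i j => (j < i) && (p i && p j (+) (p i (+) blockpar i) && (p j (+) blockpar j))) J
  = pairx (inv p) J (+) pairx (inv (fun j => p j (+) blockpar j)) J.
  rewrite -pairx_add; apply: pairx_ext => i j.
  by rewrite /inv; case: (j < i).
by case: S; xor_cases.
Qed.
End Blocks.

End Signs.

(** * Tensor modules *)

Section Multilinear.
Variables (K : comPzRingType) (A M : lmodType K) (phi : seq A -> M).
Hypothesis ml : multilinear phi.

Lemma ml_lin l r : linear (fun x => phi (l ++ x :: r)).
Proof. by move=> a x y; apply: ml. Qed.

Lemma ml0 w : 0 \in w -> phi w = 0.
Proof. by case/splitPr => l r; rewrite (lin0 (ml_lin l r)). Qed.

(** Letters are expanded one at a time; the induction moves them into a prefix [u] whose letters
    already lie in S. *)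
Lemma ml_letters_ext (N : lmodType K) (psi : seq A -> M) (S : A -> Prop) :
  multilinear psi -> (forall a, span S a) ->
  (forall w, (forall x, x \in w -> S x) -> phi w = psi w) -> phi =1 psi.
Proof.
move=> ml' sS e w; rewrite -[w]cat0s.
have : forall x, x \in ([::] : seq A) -> S x by [].
elim: w [::] => [|x w IH] u hu; first by rewrite cats0; apply: e.
apply: (span_ext (ml_lin u w) (fun a x y => ml' u w a x y) _ (sS x)) => y Sy.
rewrite -cat_rcons; apply: IH => z; rewrite mem_rcons inE => /predU1P[-> //|]; exact: hu.
Qed.
End Multilinear.

Section Words.
Variable K : comPzRingType.
Implicit Types A B : gmod K.

Lemma T_ext A (M : lmodType K) (f g : T A -> M) : linear f -> linear g ->
  (forall w, f (word w) = g (word w)) -> f =1 g.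
Proof. by move=> hf hg e; apply: pres_lin_ext. Qed.

Lemma lin_word A (M : lmodType K) (f : T A -> M) : linear f ->
  multilinear (fun w : seq A => f (word w)).
Proof. by move=> hf l r a x y; rewrite word_multilinear hf. Qed.

Lemma T_letters_ext A (M : lmodType K) (f g : T A -> M) (S : A -> Prop) :
  linear f -> linear g -> (forall a, span S a) ->
  (forall w : seq A, (forall x, x \in w -> S x) -> f (word w) = g (word w)) -> f =1 g.
Proof.
move=> hf hg sS e; apply: T_ext => //.
exact: (ml_letters_ext (lin_word hf) M (lin_word hg) sS e).
Qed.

Lemma lift_word A (M : lmodType K) (phi : seq A -> M) w :
  multilinear phi -> lift phi (word w : T A) = phi w.
Proof. exact: lift_gen. Qed.

Lemma lift_lin A (M : lmodType K) (phi : seq A -> M) :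
  multilinear phi -> linear (lift phi : T A -> M).
Proof. exact: lift_linear. Qed.

(** No bound on j is imposed: beyond the end of the word the letter is 0, which has both
    parities. *)
Definition pures A (b : nat -> bool) (w : seq A) := forall j, pure (b j) (nth 0 w j).

Lemma T_pure_ext A (M : lmodType K) (f g : T A -> M) : parited A -> linear f -> linear g ->
  (forall b w, pures b w -> f (word w) = g (word w)) -> f =1 g.
Proof.
move=> pA hf hg e.
apply: (@T_letters_ext _ _ _ _ (fun x => exists b, pure b x)) => // [a|w hw].
  rewrite (partD a); apply: span_add; apply: span_gen; eexists; exact: pure_part.
(* Each letter comes with some parity; it is declared odd when it is odd, and is even otherwise. *)
apply: (e (fun j => `[< pure true (nth 0 w j) >])) => j.
case: asboolP => // n; case: (ltnP j (size w)) => lj; last by rewrite nth_default //; apply: pure0.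
by case: (hw _ (mem_nth 0 lj)) => [[]].
Qed.

Section Expansion.
Variables (I : finType) (i0 : I).
Implicit Types (bs : seq I) (b : nat -> I).

(** Sums over all ways to replace each letter by one of its components. [Todd], [permw] and [ccev]
    split by parity; the index type is general because the weighted homotopy splits by summands. *)
Definition tsum (M : lmodType K) n (P : pred (seq I)) (F : seq I -> M) : M :=
  \sum_(bs : n.-tuple I | P bs) F bs.

(** Meant for words whose letters each lie in one component: every colouring but the right one then
    puts a 0 among the letters. *)
Lemma tsum_pure (M : lmodType K) n (P : pred (seq I)) (F : seq I -> M) bs0 :
  size bs0 = n -> (forall bs, size bs = n -> bs != bs0 -> F bs = 0) ->
  tsum n P F = if P bs0 then F bs0 else 0.
Proof.
move=> /eqP s e; rewrite /tsum; case: ifP => p.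
  rewrite (bigD1 (Tuple s)) //= big1 ?addr0 // => bs /andP[_ n0]; apply: e => //.
  exact: size_tuple.
rewrite big1 // => bs pbs; apply: e; first exact: size_tuple.
by apply: contraFneq p => <-.
Qed.

Lemma eq_tsum (M : lmodType K) n (P : pred (seq I)) (F G : seq I -> M) :
  (forall bs, size bs = n -> F bs = G bs) -> tsum n P F = tsum n P G.
Proof. by move=> e; apply: eq_bigr => bs _; apply: e; apply: size_tuple. Qed.

Lemma tsum_lin (M N : lmodType K) n (P : pred (seq I)) (F : M -> seq I -> N) :
  (forall bs, size bs = n -> linear (F^~ bs)) -> linear (fun x => tsum n P (F x)).
Proof.
move=> h a x y; rewrite /tsum scaler_sumr -big_split; apply: eq_bigr => bs _.
by apply: h; apply: size_tuple.
Qed.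

Lemma bs_neq bs b n : size bs = n -> bs != map b (iota 0 n) ->
  exists2 j, (j < n)%N & nth i0 bs j != b j.
Proof.
move=> s n0; apply: contrapT => h; move/eqP: n0; apply.
apply: (@eq_from_nth _ i0); first by rewrite size_map size_iota.
rewrite s => i li; rewrite (nth_map 0%N) ?size_iota // nth_iota // add0n.
by apply: contrapT => /eqP ?; apply: h; exists i.
Qed.

Variables (A : gmod K) (q : I -> A -> A).

Definition partw bs (w : seq A) : seq A := [seq q p.1 p.2 | p <- zip bs w].

Lemma partw_cat bs (l r : seq A) x : size bs = (size l + (size r).+1)%N ->
  partw bs (l ++ x :: r) = partw (take (size l) bs) l ++
    q (nth i0 bs (size l)) x :: partw (drop (size l).+1 bs) r.
Proof.
move=> s; rewrite -{1}(cat_take_drop (size l) bs) (drop_nth i0) ?s; last by lia.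
by rewrite /partw zip_cat ?map_cat // size_takel // s; lia.
Qed.

Definition colored b (w : seq A) :=
  forall j i, q i (nth 0 w j) = if b j == i then nth 0 w j else 0.

Lemma partw_colored bs w b : colored b w -> size bs = size w ->
  partw bs w = [seq if nth i0 bs j == b j then nth 0 w j else 0 | j <- iota 0 (size w)].
Proof.
move=> hw s; apply: (@eq_from_nth _ 0); first by rewrite !size_map size_zip size_iota s minnn.
rewrite size_map size_zip s minnn => i li.
rewrite (nth_map (i0, 0)) ?size_zip ?s ?minnn // nth_zip //= hw.
by rewrite (nth_map 0%N) ?size_iota // nth_iota // add0n eq_sym.
Qed.

Lemma partw_neq bs w b : colored b w -> size bs = size w ->
  bs != map b (iota 0 (size w)) -> 0 \in partw bs w.
Proof.
move=> hw s /(bs_neq s) [j lj nj].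
rewrite (partw_colored hw s); apply/mapP; exists j; first by rewrite mem_iota.
by rewrite (negbTE nj).
Qed.

Lemma partw_id w b : colored b w -> partw (map b (iota 0 (size w))) w = w.
Proof.
move=> hw; rewrite (partw_colored hw) ?size_map ?size_iota // -[RHS](mkseq_nth 0).
apply/eq_in_map => j; rewrite mem_iota add0n => /= lj.
by rewrite (nth_map 0%N) ?size_iota // nth_iota // eqxx.
Qed.
End Expansion.

Lemma pures_colored A b (w : seq A) : pures b w -> colored (@part K A) b w.
Proof. by move=> h j i; rewrite (part_pure _ (h j)). Qed.

Section Todd.
Variables (A : gmod K) (pA : parited A).

Lemma Todd_ml : multilinear (fun w : seq A => tsum (size w) (fun bs => odd (count id bs))
    (fun bs => (word (partw (@part K A) bs w) : T A))).
Proof.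
move=> l r a x y; rewrite !size_cat /=.
move: a x y; apply: tsum_lin => bs s a x y.
rewrite !(partw_cat false) //; have := part_lin pA (nth false bs (size l)) a x y => ->.
exact: word_multilinear.
Qed.

Definition wpar (b : nat -> bool) n := \big[addb/false]_(j <- iota 0 n) b j.

Lemma pure_word b (w : seq A) : pures b w -> pure (wpar b (size w)) (word w : T A).
Proof.
move=> hw; rewrite /pure {1}/goddp /= /Todd lift_word; last exact: Todd_ml.
rewrite -[LHS]/(tsum (size w) (fun bs => odd (count id bs)) (fun bs => word (partw (@part K A) bs w) : T A)).
rewrite (@tsum_pure _ _ _ _ _ (map b (iota 0 (size w)))) ?size_map ?size_iota //.
  by rewrite (partw_id false (pures_colored hw)) odd_count big_map.
by move=> bs s n; apply: (ml0 (@word_multilinear _ A)); apply: (partw_neq false (pures_colored hw)) n.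
Qed.
End Todd.

End Words.

Section Tensor.
Variable K : comPzRingType.
Implicit Types A B : gmod K.

Lemma ml_letters_span (A M : lmodType K) (phi : seq A -> M) (S : A -> Prop) (P : M -> Prop) :
  multilinear phi -> (forall a, span S a) ->
  (forall w, (forall x, x \in w -> S x) -> span P (phi w)) -> forall w, span P (phi w).
Proof.
move=> ml sS e w; rewrite -[w]cat0s.
have : forall x, x \in ([::] : seq A) -> S x by [].
elim: w [::] => [|x w IH] u hu; first by rewrite cats0; apply: e.
apply: (span_image (ml_lin ml u w) _ (sS x)) => y Sy.
rewrite -cat_rcons; apply: IH => z; rewrite mem_rcons inE => /predU1P[-> //|]; exact: hu.
Qed.

Lemma T_span A (S : A -> Prop) (P : T A -> Prop) : (forall a, span S a) ->
  (forall w : seq A, (forall x, x \in w -> S x) -> span P (word w : T A)) -> forall x, span P x.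
Proof.
move=> sS e x; rewrite [x](pres_gen_sum x).
elim: (prep x) => [|p s IH].
  by rewrite big_nil; apply: span0.
rewrite big_cons; apply: span_add => [|//].
by apply: span_scale; apply: (ml_letters_span (@word_multilinear _ A) sS e).
Qed.

Lemma odd_bigsum (s : seq int) : isodd (\sum_(i <- s) i) = \big[addb/false]_(i <- s) isodd i.
Proof. by elim: s => [|i s IH]; rewrite ?big_nil // !big_cons isoddD IH. Qed.

Lemma homog_letters A (w : seq A) : (forall x, x \in w -> exists i, homog i x) ->
  exists ds : seq int, size ds = size w /\ List.Forall (fun p => homog p.1 p.2) (zip ds w).
Proof.
elim: w => [|x w IH] h; first by exists [::].
have [i hi] := h x (mem_head _ _).
have [|ds [s f]] := IH; first by move=> y yw; apply: h; rewrite inE yw orbT.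
by exists (i :: ds); rewrite /= s; split=> //; constructor.
Qed.

Lemma homog_pures A (pA : parited A) (w : seq (int * A)) :
  List.Forall (fun p => homog p.1 p.2) w ->
  pures (fun j => isodd (nth 0 (unzip1 w) j)) (unzip2 w).
Proof.
elim=> [|p {}w hp _ IH] j; first by rewrite !nth_nil; apply: pure0.
case: j => [|j]; [exact: hom_pure|exact: IH].
Qed.

Lemma wpar_nth (s : seq int) : wpar (fun j => isodd (nth 0 s j)) (size s) = isodd (\sum_(i <- s) i).
Proof. by rewrite odd_bigsum /wpar [RHS](big_nth 0) /index_iota subn0. Qed.

Lemma T_parited A : parited A -> parited (T A).
Proof.
move=> pA; split.
- by apply: lift_lin; apply: Todd_ml.
- move=> i; apply: (span_ext (f := @goddp _ (T A)) (g := fun x : T A => if odd `|i|%N then x else 0)).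
  + by apply: lift_lin; apply: Todd_ml.
  + by case: (odd _) => a x y; rewrite ?scaler0 ?addr0.
  move=> x [w [hw <- ->]].
  have := pure_word pA (homog_pures pA hw).
  by rewrite size_map -(size_map fst) wpar_nth big_map.
- move=> x; apply: (@T_span _ (fun a => exists i, homog i a)); first exact: par_span.
  move=> w hw; apply: span_gen.
  have [ds [s f]] := homog_letters hw.
  exists (\sum_(p <- zip ds w) p.1); apply: span_gen; exists (zip ds w); split=> //.
  by rewrite -[X in word X](@unzip2_zip _ _ ds) ?s.
Qed.

Lemma wt_ml A n : multilinear (fun w : seq A => if size w == n then word w : T A else 0).
Proof.
move=> l r a x y; rewrite !size_cat /=; case: ifP => _; first exact: word_multilinear.
by rewrite scaler0 addr0.
Qed.
Lemma wt_word A n (w : seq A) : wt n (word w) = if size w == n then word w else 0.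
Proof. exact: lift_word (@wt_ml A n). Qed.
Lemma wt_lin A n : linear (@wt K A n).
Proof. exact: lift_lin (@wt_ml A n). Qed.

Lemma letter_ml A : multilinear (fun w : seq A => if w is [:: v] then v else 0).
Proof.
by move=> [|? [|? l]] [|? r] a x y //=; rewrite scaler0 addr0.
Qed.
Lemma letter_word A (w : seq A) : letter (word w) = if w is [:: v] then v else 0.
Proof. exact: lift_word (@letter_ml A). Qed.
Lemma letter_lin A : linear (@letter K A).
Proof. exact: lift_lin (@letter_ml A). Qed.

Lemma tmul_inner_ml A (u : seq A) : multilinear (fun v : seq A => word (u ++ v) : T A).
Proof. by move=> l r a x y; rewrite !catA; apply: word_multilinear. Qed.
Lemma tmul_outer_ml A (y : T A) :
  multilinear (fun u : seq A => lift (fun v : seq A => word (u ++ v) : T A) y).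
Proof.
move=> l r a x x'; move: y; apply: T_ext => [||w].
- exact: lift_lin (@tmul_inner_ml A _).
- apply: lin_add; last exact: lift_lin (@tmul_inner_ml A _).
  by apply: lin_scale; exact: lift_lin (@tmul_inner_ml A _).
by rewrite !(lift_word _ (@tmul_inner_ml A _)) -!catA; apply: word_multilinear.
Qed.
Lemma tmul_linl A (y : T A) : linear (fun x : T A => tmul x y).
Proof. exact: lift_lin (@tmul_outer_ml A y). Qed.
Lemma tmul_word A (u v : seq A) : tmul (word u) (word v) = word (u ++ v).
Proof. by rewrite /tmul (lift_word _ (@tmul_outer_ml A _)) (lift_word _ (@tmul_inner_ml A _)). Qed.
Lemma tmul_linr A (x : T A) : linear (fun y : T A => tmul x y).
Proof.
move=> a y y'; move: x; apply: T_ext => [||w].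
- exact: tmul_linl.
- by apply: lin_add; [apply: lin_scale|]; apply: tmul_linl.
by rewrite /tmul !(lift_word _ (@tmul_outer_ml A _)); apply: lift_lin; exact: tmul_inner_ml.
Qed.
Lemma tmul0l A (y : T A) : tmul 0 y = 0. Proof. exact: lin0 (@tmul_linl A y). Qed.
Lemma tmul0r A (x : T A) : tmul x 0 = 0. Proof. exact: lin0 (@tmul_linr A x). Qed.
Lemma tmulDl A (x y z : T A) : tmul (x + y) z = tmul x z + tmul y z.
Proof. exact: linD (@tmul_linl A z) x y. Qed.
Lemma tmulDr A (z x y : T A) : tmul z (x + y) = tmul z x + tmul z y.
Proof. exact: linD (@tmul_linr A z) x y. Qed.
Lemma tmulNl A (x z : T A) : tmul (- x) z = - tmul x z.
Proof. exact: linN (@tmul_linl A z) x. Qed.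
Lemma tmulNr A (z x : T A) : tmul z (- x) = - tmul z x.
Proof. exact: linN (@tmul_linr A z) x. Qed.
Lemma tmulBl A (x y z : T A) : tmul (x - y) z = tmul x z - tmul y z.
Proof. exact: linB (@tmul_linl A z) x y. Qed.
Lemma tmulBr A (z x y : T A) : tmul z (x - y) = tmul z x - tmul z y.
Proof. exact: linB (@tmul_linr A z) x y. Qed.
Lemma tmulZl A a (x z : T A) : tmul (a *: x) z = a *: tmul x z.
Proof. exact: (linZ (@tmul_linl A z) a x). Qed.
Lemma tmulZr A a (z x : T A) : tmul z (a *: x) = a *: tmul z x.
Proof. exact: (linZ (@tmul_linr A z) a x). Qed.

Lemma T_ext2 A (M : lmodType K) (f g : T A -> T A -> M) :
  (forall y, linear (f^~ y)) -> (forall y, linear (g^~ y)) ->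
  (forall x, linear (f x)) -> (forall x, linear (g x)) ->
  (forall u v, f (word u) (word v) = g (word u) (word v)) -> forall x y, f x y = g x y.
Proof.
move=> fl gl fr gr e x y; apply: (T_ext (f := f^~ y) (g := g^~ y)) => // u.
exact: (T_ext (f := f (word u)) (g := g (word u))).
Qed.

Lemma tmap_ml A B (f : A -> B) : linear f ->
  multilinear (fun w : seq A => word [seq f v | v <- w] : T B).
Proof. by move=> hf l r a x y; rewrite !map_cat /= hf; apply: word_multilinear. Qed.
Lemma tmap_word A B (f : A -> B) w : linear f -> tmap f (word w) = word (map f w).
Proof. by move=> hf; apply: lift_word (tmap_ml hf). Qed.
Lemma tmap_lin A B (f : A -> B) : linear f -> linear (tmap f).
Proof. by move=> hf; apply: lift_lin (tmap_ml hf). Qed.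
Lemma tmap_tmul A B (f : A -> B) x y : linear f -> tmap f (tmul x y) = tmul (tmap f x) (tmap f y).
Proof.
move=> hf; move: x y; apply: T_ext2 => [y|y|x|x|u v].
- by apply: (lin_comp (tmap_lin hf)); apply: tmul_linl.
- by apply: (lin_comp (tmul_linl _)); apply: tmap_lin.
- by apply: (lin_comp (tmap_lin hf)); apply: tmul_linr.
- by apply: (lin_comp (tmul_linr _)); apply: tmap_lin.
by rewrite tmul_word !tmap_word // tmul_word map_cat.
Qed.
Lemma tmap_comp A B (D : gmod K) (f : A -> B) (g : B -> D) x : linear f -> linear g ->
  tmap g (tmap f x) = tmap (fun a => g (f a)) x.
Proof.
move=> hf hg; move: x; have hgf := lin_comp hg hf; apply: T_ext => [||w].
- by apply: lin_comp; apply: tmap_lin.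
- exact: tmap_lin.
by rewrite !tmap_word // -map_comp.
Qed.
Lemma eq_tmap A B (f g : A -> B) x : linear f -> f =1 g -> tmap f x = tmap g x.
Proof.
move=> hf e; have hg : linear g by move=> a u v; rewrite -!e hf.
move: x; apply: T_ext => [||w]; try exact: tmap_lin.
by rewrite !tmap_word // (eq_map e).
Qed.

Section Ksign.
Variables (A : gmod K) (pA : parited A).

Lemma ksign_word c (w : seq A) : ksign c (word w : T A) = word (map (ksign c) w).
Proof.
have lk := ksign_lin pA c.
have pT := T_parited pA; have lT := ksign_lin pT c.
rewrite -tmap_word //; move: (word w); apply: (T_pure_ext pA) => // [|b {}w hw].
  exact: tmap_lin.
rewrite (ksign_pure _ (pure_word pA hw)) tmap_word //.
elim: w b hw => [|x w IH] b hw; first by rewrite /wpar big_nil andbF scale1r.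
have hw' : pures (fun j => b j.+1) w by move=> j; apply: (hw j.+1).
rewrite /= -cat1s -tmul_word.
have -> : word (ksign c x :: map (ksign c) w) = tmul (word [:: ksign c x]) (word (map (ksign c) w)) :> T A.
  by rewrite tmul_word.
rewrite -(IH _ hw') (ksign_pure _ (hw 0%N)) /=.
rewrite (linZ (@word_multilinear _ A [::] [::])) tmulZl tmulZr scalerA -signr_addb.
congr (_ ^+ _ *: _); rewrite /wpar /= big_cons -andb_addr -[1%N]/(1 + 0)%N.
by rewrite iotaDl big_map.
Qed.

Lemma ksign_tmul c (x y : T A) : ksign c (tmul x y) = tmul (ksign c x) (ksign c y).
Proof.
have lT := ksign_lin (T_parited pA) c.
move: x y; apply: T_ext2 => [y|y|x|x|u v].
- by apply: (lin_comp lT); apply: tmul_linl.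
- by apply: (lin_comp (tmul_linl _)).
- by apply: (lin_comp lT); apply: tmul_linr.
- by apply: (lin_comp (tmul_linr _)).
by rewrite tmul_word !ksign_word tmul_word map_cat.
Qed.
End Ksign.
End Tensor.

(** * The action of permutations on tensor powers *)

Section Permutations.
Variable K : comPzRingType.
Implicit Types A B : gmod K.

Section Permw.
Variables (A : gmod K) (pA : parited A).

Definition permphi (L : seq nat) (w : seq A) : T A :=
  if perm_eq L (iota 0 (size w)) then
    tsum (size w) predT (fun bs => (-1) ^+ koszul (nth false bs) L *:
          word [seq part (nth false bs j) (nth 0 w j) | j <- L])
  else 0.

(** The varied letter occurs exactly once in the rearranged word, as L has no repetitions, and the
    other entries do not depend on it. *)
Lemma permphi_ml L : multilinear (permphi L).
Proof.
move=> l r a x y; rewrite /permphi !size_cat /=; case: ifP => [pL|_]; last by rewrite scaler0 addr0.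
move: a x y; apply: tsum_lin => bs s; apply: lin_scale => a x y.
set p := size l.
have pL' : p \in L by rewrite (perm_mem pL) mem_iota /p; lia.
have uL : uniq L by rewrite (perm_uniq pL) iota_uniq.
case/splitPr: pL' uL {pL} => L1 L2; rewrite cat_uniq /= => /and3P[_ /norP[/negP n1 _] /andP[/negP n2 _]].
pose G (z : A) j := part (nth false bs j) (nth 0 (l ++ z :: r) j).
have Gp z : G z p = part (nth false bs p) z by rewrite /G nth_cat ltnn subnn.
have Gn z j : j != p -> G z j = G 0 j.
  move=> nj; rewrite /G !nth_cat; case: ltnP => // lj.
  have : (0 < j - size l)%N by rewrite subn_gt0 ltn_neqAle eq_sym nj.
  by case: (j - size l)%N.
have GL z (L' : seq nat) : ~ p \in L' -> map (G z) L' = map (G 0) L'.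
  by move=> n; apply/eq_in_map => j jL; apply: Gn; apply: contra_not_neq n => <-.
have E z : [seq part (nth false bs j) (nth 0 (l ++ z :: r) j) | j <- L1 ++ p :: L2] =
    map (G 0) L1 ++ part (nth false bs p) z :: map (G 0) L2.
  by rewrite -[LHS]/(map (G z) _) map_cat /= Gp !GL.
by rewrite !E (part_lin pA); apply: word_multilinear.
Qed.

Lemma permw_word L (w : seq A) : permw L (word w) = permphi L w.
Proof. exact: lift_word (@permphi_ml L). Qed.

Lemma permw_lin L : linear (@permw K A L).
Proof. exact: lift_lin (@permphi_ml L). Qed.

Lemma permw_pure L (w : seq A) b : pures b w -> permw L (word w) =
  if perm_eq L (iota 0 (size w)) then (-1) ^+ koszul b L *: word [seq nth 0 w j | j <- L] else 0.
Proof.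
move=> hw; rewrite permw_word /permphi; case: ifP => // pL.
have memL j : j \in L -> (j < size w)%N by rewrite (perm_mem pL) mem_iota add0n.
rewrite (@tsum_pure _ _ _ _ _ _ (map b (iota 0 (size w)))) ?size_map ?size_iota //.
  have nb j : j \in L -> nth false [seq b i | i <- iota 0 (size w)] j = b j.
    by move=> /memL lj; rewrite (nth_map 0%N) ?size_iota // nth_iota.
  rewrite (koszul_ext nb); congr (_ *: word _); apply/eq_in_map => j jL.
  by rewrite nb // (part_pure _ (hw j)) eqxx.
move=> bs s /(bs_neq false s) [j lj nj]; rewrite (ml0 (@word_multilinear _ A)) ?scaler0 //.
apply/mapP; exists j; first by rewrite (perm_mem pL) mem_iota add0n.
by rewrite (part_pure _ (hw j)) eq_sym (negbTE nj).
Qed.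

Section Labelled.
Variables (b : nat -> bool) (W : nat -> A).
Hypothesis hW : forall j, pure (b j) (W j).

Lemma pures_lab (L : seq nat) : pures (fun j => b (nth 0%N L j)) (map W L).
Proof.
move=> j; case: (ltnP j (size L)) => l; first by rewrite (nth_map 0%N).
by rewrite [nth 0 _ _]nth_default ?size_map //; apply: pure0.
Qed.

(** Words are written [map W L] with W fixed, so that permutations act on the labels only and the
    letters are never touched. *)
Lemma permw_lab L L' : permw L' (word (map W L)) =
  if perm_eq L' (iota 0 (size L)) then
    (-1) ^+ koszul (fun j => b (nth 0%N L j)) L' *: word (map W [seq nth 0%N L j | j <- L'])
  else 0.
Proof.
rewrite (permw_pure _ (pures_lab L)) size_map; case: ifP => // pL.
congr (_ *: word _); rewrite -map_comp; apply/eq_in_map => j /=.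
by rewrite (perm_mem pL) mem_iota add0n => l; rewrite (nth_map 0%N).
Qed.
End Labelled.

Lemma T_lab_ext (M : lmodType K) (f g : T A -> M) : linear f -> linear g ->
  (forall b W n, (forall j, pure (b j) (W j)) -> f (word (map W (iota 0 n))) = g (word (map W (iota 0 n)))) ->
  f =1 g.
Proof.
move=> hf hg e; apply: (T_pure_ext pA) => // b w hw.
by rewrite -(mkseq_nth 0 w); apply: (e b).
Qed.

Lemma perm_iota_eq L n m : perm_eq L (iota 0 n) -> perm_eq L (iota 0 m) = (m == n).
Proof.
move=> p; apply/idP/eqP => [q|-> //].
by have := perm_size q; rewrite (perm_size p) !size_iota.
Qed.

Lemma perm_iota_comp L L' n : perm_eq L (iota 0 n) -> perm_eq L' (iota 0 n) ->
  perm_eq [seq nth 0%N L j | j <- L'] (iota 0 n).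
Proof.
move=> p p'; apply: (perm_trans _ p); apply: perm_iota_nth.
by rewrite (perm_size p) size_iota.
Qed.

Lemma map_nth_iota L n : perm_eq L (iota 0 n) -> [seq nth 0%N (iota 0 n) j | j <- L] = L.
Proof.
move=> p; rewrite -[RHS]map_id; apply/eq_in_map => j.
by rewrite (perm_mem p) mem_iota add0n => /= l; rewrite nth_iota.
Qed.

Lemma permw_iota_lab b (W : nat -> A) n L : (forall j, pure (b j) (W j)) -> perm_eq L (iota 0 n) ->
  permw L (word (map W (iota 0 n))) = (-1) ^+ koszul b L *: word (map W L).
Proof.
move=> hW pL; rewrite (permw_lab hW) size_iota pL (map_nth_iota pL).
congr (_ ^+ _ *: _); apply: koszul_ext => j.
by rewrite (perm_mem pL) mem_iota add0n => /= l; rewrite nth_iota.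
Qed.

Lemma permw_other (w : seq A) n L : perm_eq L (iota 0 n) -> size w != n -> permw L (word w) = 0.
Proof. by move=> p; rewrite permw_word /permphi (perm_iota_eq _ p) => /negbTE ->. Qed.

(** The signs match by the cocycle property [koszul_comp]. *)
Lemma permw_comp L L' n (x : T A) : perm_eq L (iota 0 n) -> perm_eq L' (iota 0 n) ->
  permw L' (permw L x) = permw [seq nth 0%N L j | j <- L'] x.
Proof.
move=> p p'; move: x; apply: T_lab_ext => [||b W m hW].
- by apply: lin_comp; apply: permw_lin.
- exact: permw_lin.
case: (altP (m =P n)) => [->|ne]; last first.
  rewrite (permw_other p) ?size_map ?size_iota // (lin0 (permw_lin _)).
  by rewrite (permw_other (perm_iota_comp p p')) // size_map size_iota.
have sL : size L = n by rewrite (perm_size p) size_iota.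
have uL : uniq L by rewrite (perm_uniq p) iota_uniq.
rewrite (permw_iota_lab hW p) (linZ (permw_lin _)) (permw_lab hW) sL p' scalerA.
rewrite (permw_iota_lab hW) ?(perm_iota_comp p p') //; congr (_ *: _).
rewrite -signr_odd -[in X in _ * X]signr_odd -[in RHS]signr_odd koszul_comp ?sL //.
by rewrite signr_addb.
Qed.

(** As [permw] kills words of other lengths, the identity permutation of n labels is the projection
    to the tensor power. Compatibility of a map with [wt] can thus be deduced from equivariance. *)
Lemma permw_iota (x : T A) n : permw (iota 0 n) x = wt n x.
Proof.
move: x; apply: T_lab_ext => [||b W m hW]; [exact: permw_lin|exact: wt_lin|].
rewrite wt_word size_map size_iota; case: (altP (m =P n)) => [->|ne].
  rewrite (permw_iota_lab hW) // (_ : koszul _ _ = 0%N) ?scale1r //.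
  suff : forall i, koszul b (iota i n) = 0%N by [].
  elim: n => //= n IH i; rewrite IH addn0 (_ : count _ _ = 0%N) ?muln0 //.
  apply/eqP; rewrite -leqn0 leqNgt -has_count; apply/hasPn => j; rewrite mem_iota.
  by case: (ltngtP j i) => //=; lia.
by rewrite (@permw_other _ n) // size_map size_iota.
Qed.

Lemma wt_permw n m L (x : T A) : perm_eq L (iota 0 n) -> wt m (permw L x) = permw L (wt m x).
Proof.
move=> p; move: x; apply: T_lab_ext => [||b W k hW].
- by apply: lin_comp; [exact: wt_lin|exact: permw_lin].
- by apply: lin_comp; [exact: permw_lin|exact: wt_lin].
rewrite wt_word size_map size_iota; case: (altP (k =P n)) => [->|ne].
  rewrite (permw_iota_lab hW p) (linZ (@wt_lin _ A m)) wt_word size_map (perm_size p) size_iota.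
  by case: ifP => _; rewrite ?(lin0 (permw_lin _)) ?scaler0 // (permw_iota_lab hW p).
by rewrite (permw_other p) ?size_map ?size_iota // (lin0 (@wt_lin _ A m)); case: ifP => _;
 rewrite ?(lin0 (permw_lin _)) // (permw_other p) // size_map size_iota.
Qed.

Lemma permw_wt n L (x : T A) : perm_eq L (iota 0 n) -> permw L (wt n x) = permw L x.
Proof.
move=> p; rewrite -permw_iota (permw_comp _ _ p) //.
by rewrite map_nth_iota.
Qed.

Lemma permw_par L : parmap false (@permw K A L).
Proof.
apply: T_lab_ext => [||b W n hW].
- by apply: lin_comp; [exact: (par_lin (T_parited pA))|exact: permw_lin].
- by apply: lin_comp; [exact: permw_lin|exact: (part_lin (T_parited pA))].
have q := pure_word pA (pures_lab hW (iota 0 n)).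
rewrite (part_pure _ q) (permw_lab hW) size_iota; case: ifP => p; last first.
  rewrite (lin0 (par_lin (T_parited pA))); case: ifP => _; rewrite ?(lin0 (permw_lin _)) //.
  by rewrite (permw_lab hW) size_iota p.
have q' := pure_word pA (pures_lab hW L).
rewrite (map_nth_iota p) (linZ (par_lin (T_parited pA))) q'.
rewrite (_ : wpar _ (size (map W L)) = wpar (fun j => b (nth 0%N (iota 0 n) j)) (size (map W (iota 0 n)))); last first.
  rewrite /wpar !size_map (perm_size p) size_iota.
  rewrite -(big_map (nth 0%N L) predT b) -(big_map (nth 0%N (iota 0 n)) predT b) (map_nth_iota (perm_refl _)).
  by apply: perm_big; exact: perm_iota_comp p (perm_refl _).
case: (wpar _ _); rewrite /= ?scaler0 ?(lin0 (permw_lin _)) // (permw_iota_lab hW p).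
congr (_ ^+ _ *: _); apply: koszul_ext => j.
by rewrite (perm_mem p) mem_iota add0n => /= l; rewrite nth_iota.
Qed.
End Permw.

Lemma permw_tmap A B (f : A -> B) L x : parited A -> parited B -> linear f -> parmap false f ->
  permw L (tmap f x) = tmap f (permw L x).
Proof.
move=> pA pB hf ef; move: x; apply: (T_lab_ext pA) => [||b W n hW].
- by apply: lin_comp; [exact: permw_lin|exact: tmap_lin].
- by apply: lin_comp; [exact: tmap_lin|exact: permw_lin].
have hfW j : pure (b j) (f (W j)) by apply: (parmap_pure pA hf ef (hW j)).
rewrite tmap_word // -map_comp (permw_lab pB hfW) (permw_lab pA hW); case: ifP => _.
  by rewrite (linZ (tmap_lin hf)) tmap_word // -!map_comp.
by rewrite (lin0 (tmap_lin hf)).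
Qed.
End Permutations.

(** * Derivations and tensor products of maps *)

Section Derivations.
Variable K : comPzRingType.
Implicit Types A B : gmod K.

Lemma tmul1l A (x : T A) : tmul (word [::]) x = x.
Proof.
by move: x; apply: T_ext => [||w]; [exact: tmul_linr|exact: lin_id|rewrite tmul_word].
Qed.

Lemma tmul1r A (x : T A) : tmul x (word [::]) = x.
Proof.
by move: x; apply: T_ext => [||w]; [exact: tmul_linl|exact: lin_id|rewrite tmul_word cats0].
Qed.

Lemma tmulA A (p q r : T A) : tmul p (tmul q r) = tmul (tmul p q) r.
Proof.
move: p; apply: T_ext => [||p].
- exact: tmul_linl.
- by apply: (lin_comp (tmul_linl _)); apply: tmul_linl.
move: q r; apply: T_ext2 => [r|r|q|q|q r].
- by apply: (lin_comp (tmul_linr _)); apply: tmul_linl.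
- by apply: (lin_comp (tmul_linl _)); apply: tmul_linr.
- by apply: (lin_comp (tmul_linr _)); apply: tmul_linr.
- exact: tmul_linr.
by rewrite !tmul_word catA.
Qed.

(** The sum of the al ... be ... al with one factor be, which is taken to be odd; it underlies
    C[al; be]. Recursion on the first letter, instead of a sum over positions as in [tder], turns
    the Leibniz rule into an induction. *)
Fixpoint dw A B (al be : A -> B) (w : seq A) : T B :=
  if w is x :: w' then word (be x :: map al w') + tmul (word [:: ksign true (al x)]) (dw al be w')
  else 0.

Definition tder2 A B (al be : A -> B) : T A -> T B := lift (dw al be).

Lemma word1_lin A : linear (fun x : A => word [:: x] : T A).
Proof. exact: (ml_lin (@word_multilinear _ A) [::] [::]). Qed.

Lemma word_cons A x (w : seq A) : word (x :: w) = tmul (word [:: x]) (word w) :> T A.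
Proof. by rewrite tmul_word. Qed.

Section TwoMaps.
Variables (A B : gmod K) (pB : parited B) (al be : A -> B).
Hypotheses (hal : linear al) (hbe : linear be).

Lemma dw_ml : multilinear (dw al be).
Proof.
move=> l r a x y; elim: l => [|z l IH] /=.
  rewrite hbe hal (ksign_lin pB true) word1_lin tmulDl tmulZl.
  have := @word_multilinear K B [::] (map al r) a (be x) (be y) => /= ->.
  by rewrite scalerDr addrACA.
rewrite IH !map_cat /= hal tmulDr tmulZr.
have := @word_multilinear _ B (be z :: map al l) (map al r) a (al x) (al y) => /= ->.
by rewrite scalerDr addrACA.
Qed.

Lemma tder2_word w : tder2 al be (word w) = dw al be w.
Proof. exact: lift_word dw_ml. Qed.
Lemma tder2_lin : linear (tder2 al be).
Proof. exact: lift_lin dw_ml. Qed.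

Lemma wt_tmul1 n (y : B) z : wt n.+1 (tmul (word [:: y]) z) = tmul (word [:: y]) (wt n z).
Proof.
move: z; apply: T_ext => [||w].
- by apply: lin_comp; [exact: wt_lin|exact: tmul_linr].
- by apply: lin_comp; [exact: tmul_linr|exact: wt_lin].
by rewrite tmul_word !wt_word /= eqSS; case: ifP => _; rewrite ?tmul_word ?tmul0r.
Qed.

Lemma wt0_tmul1 (y : B) z : wt 0 (tmul (word [:: y]) z) = 0.
Proof.
move: z; apply: T_ext => [||w].
- by apply: lin_comp; [exact: wt_lin|exact: tmul_linr].
- exact: lin_zero.
by rewrite tmul_word wt_word.
Qed.

Lemma wt_dw n w : wt n (dw al be w) = if size w == n then dw al be w else 0.
Proof.
elim: w n => [|x w IH] n /=; first by rewrite (lin0 (@wt_lin _ B n)) if_same.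
rewrite (linD (@wt_lin _ B n)) wt_word /= size_map; case: n => [|n].
  by rewrite wt0_tmul1 addr0.
rewrite wt_tmul1 IH eqSS; case: ifP => // _; by rewrite tmul0r addr0.
Qed.

Lemma wt_tder2 n x : wt n (tder2 al be x) = tder2 al be (wt n x).
Proof.
move: x; apply: T_ext => [||w].
- by apply: lin_comp; [exact: wt_lin|exact: tder2_lin].
- by apply: lin_comp; [exact: tder2_lin|exact: wt_lin].
by rewrite tder2_word wt_dw wt_word; case: ifP; rewrite ?tder2_word ?(lin0 tder2_lin).
Qed.
End TwoMaps.

Lemma tder_tder2 A (pA : parited A) (f : A -> A) : linear f -> tder f =1 tder2 id f.
Proof.
move=> hf.
have E (w : seq A) : \sum_(i < size w)
    (word ([seq ksign true v | v <- take i w] ++ f (nth 0 w i) :: drop i.+1 w) : T A) = dw id f w.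
  elim: w => [|x w IH]; first by rewrite big_ord0.
  rewrite big_ord_recl /= drop0 map_id; congr (_ + _).
  rewrite -IH (lin_sum (@tmul_linr _ A _)); apply: eq_bigr => i _.
  by rewrite tmul_word.
have ml : multilinear (fun w : seq A => \sum_(i < size w)
    (word ([seq ksign true v | v <- take i w] ++ f (nth 0 w i) :: drop i.+1 w) : T A)).
  by move=> l r a x y; rewrite !E; apply: (dw_ml pA).
apply: T_ext => [||w]; first exact: lift_lin ml.
  by apply: (tder2_lin pA).
by rewrite (tder2_word pA) // -E; apply: lift_word ml.
Qed.

Lemma tder2_tmap A B (D : gmod K) (ka : A -> B) (al be : B -> D) x : parited D ->
  linear ka -> linear al -> linear be ->
  tder2 al be (tmap ka x) = tder2 (fun a => al (ka a)) (fun a => be (ka a)) x.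
Proof.
move=> pD hk ha hb; have ha' := lin_comp ha hk; have hb' := lin_comp hb hk.
move: x; apply: T_ext => [||w].
- by apply: lin_comp; [exact: tder2_lin|exact: tmap_lin].
- exact: tder2_lin.
rewrite tmap_word // !tder2_word //; elim: w => //= x w ->.
by rewrite -map_comp.
Qed.

Lemma tmap_tder2 A B (D : gmod K) (al be : A -> B) (ga : B -> D) x : parited B -> parited D ->
  linear al -> linear be -> linear ga -> parmap false ga ->
  tmap ga (tder2 al be x) = tder2 (fun a => ga (al a)) (fun a => ga (be a)) x.
Proof.
move=> pB pD ha hb hg eg; have ha' := lin_comp hg ha; have hb' := lin_comp hg hb.
move: x; apply: T_ext => [||w].
- by apply: lin_comp; [exact: tmap_lin|exact: tder2_lin].
- exact: tder2_lin.
rewrite !tder2_word //; elim: w => [|x w IH] /=; first by rewrite (lin0 (tmap_lin hg)).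
rewrite (linD (tmap_lin hg)) tmap_tmul // IH !tmap_word //= -map_comp.
by rewrite (parmap_ksign _ _ pB pD hg eg) scale1r.
Qed.

Lemma eq_tder2 A B (pB : parited B) (al al' be be' : A -> B) x : linear al -> linear be ->
  al =1 al' -> be =1 be' -> tder2 al be x = tder2 al' be' x.
Proof.
move=> ha hb e e'.
have ha' : linear al' by move=> a u v; rewrite -!e ha.
have hb' : linear be' by move=> a u v; rewrite -!e' hb.
move: x; apply: T_ext => [||w]; try exact: tder2_lin.
by rewrite !tder2_word //; elim: w => //= x w ->; rewrite e e' (eq_map e).
Qed.

Lemma tder2_tmul A B (al be : A -> B) x y : parited A -> parited B -> linear al -> linear be ->
  parmap false al ->
  tder2 al be (tmul x y) =
    tmul (tder2 al be x) (tmap al y) + tmul (tmap al (ksign true x)) (tder2 al be y).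
Proof.
move=> pA pB ha hb ea; have ld := tder2_lin pB ha hb; have lm := tmap_lin ha.
have lk := ksign_lin (T_parited pA) true.
move: x y; apply: T_ext2 => [y|y|x|x|u v].
- by apply: (lin_comp ld); apply: tmul_linl.
- apply: lin_add; first exact: (lin_comp (tmul_linl _)).
  by apply: (lin_comp (tmul_linl _)); apply: lin_comp.
- by apply: (lin_comp ld); apply: tmul_linr.
- by apply: lin_add; apply: (lin_comp (tmul_linr _)).
rewrite tmul_word (ksign_word pA) !tmap_word // !tder2_word //.
elim: u => [|x u IH] /=; first by rewrite tmul0l add0r tmul1l.
rewrite IH tmulDl tmul_word map_cat -addrA; congr (_ + _).
rewrite tmulDr !tmulA; congr (_ + tmul _ _).
by rewrite tmul_word /= (parmap_ksign _ _ pA pB ha ea) scale1r.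
Qed.

Section Tensm.
Variables (A B : gmod K) (pA : parited A).
Implicit Type ms : seq (nat * (T A -> T B) * bool).

Definition lins ms := forall m, List.In m ms -> linear m.1.2.

Lemma tensw_lin ms l r : lins ms ->
  (size l + (size r).+1)%N = sumn [seq m.1.1 | m <- ms] ->
  linear (fun x => tensw ms (l ++ x :: r)).
Proof.
elim: ms l => [|[[a phi] p] ms IH] l hms /=; first by lia.
have hphi : linear phi by apply: (hms (a, phi, p)); left.
have hms' : lins ms by move=> m i; apply: hms; right.
set k := odd _.
have tw x : take a (l ++ x :: r) = if (size l < a)%N then l ++ x :: take (a - size l).-1 r else take a l.
  rewrite take_cat; case: (ltnP (size l) a) => h.
    by rewrite ltnNge (ltnW h) /=; case: (a - size l)%N (subn_gt0 (size l) a) => [|m] //=; rewrite h.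
  case: ltnP => // h'; have -> : a = size l by apply/eqP; rewrite eqn_leq h h'.
  by rewrite subnn take0 cats0 take_size.
have dr x : drop a (l ++ x :: r) = if (size l < a)%N then drop (a - size l).-1 r else drop a l ++ x :: r.
  rewrite drop_cat; case: (ltnP (size l) a) => h.
    by rewrite ltnNge (ltnW h) /=; case: (a - size l)%N (subn_gt0 (size l) a) => [|m] //=; rewrite h.
  case: ltnP => // h'; have -> : a = size l by apply/eqP; rewrite eqn_leq h h'.
  by rewrite subnn drop0 drop_size.
move=> s b x y; rewrite !tw !dr; case: (ltnP (size l) a) => h.
  rewrite !map_cat /= (ksign_lin pA) word_multilinear hphi tmulDl tmulZl //.
have e : (size (drop a l) + (size r).+1)%N = sumn [seq m.1.1 | m <- ms].
  by rewrite size_drop addnC addnBA // addnC s addKn.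
rewrite (IH _ hms' e).
by rewrite tmulDr tmulZr.
Qed.

Lemma tensm_ml ms : lins ms ->
  multilinear (fun w : seq A => if size w == sumn [seq m.1.1 | m <- ms] then tensw ms w else 0).
Proof.
move=> hms l r a x y; rewrite !size_cat /=; case: eqP => [s|_]; last by rewrite scaler0 addr0.
by apply: tensw_lin.
Qed.

Lemma tensm_word ms w : lins ms ->
  tensm ms (word w) = if size w == sumn [seq m.1.1 | m <- ms] then tensw ms w else 0.
Proof. by move=> h; apply: lift_word (tensm_ml h). Qed.
Lemma tensm_lin ms : lins ms -> linear (tensm ms).
Proof. by move=> h; apply: lift_lin (tensm_ml h). Qed.
End Tensm.

Section Letters.
Variables (A B : gmod K) (pA : parited A) (pB : parited B).
Variables (a : nat -> nat) (psi : nat -> T A -> B) (p : nat -> bool).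

(** Tensor factors that each output a single letter, indexed by labels: permuting the factors
    amounts to permuting J. *)
Definition lms J : seq (nat * (T A -> T B) * bool) :=
  [seq (a j, (fun y => word [:: psi j y]), p j) | j <- J].

Hypothesis hpsi : forall j, linear (psi j).

Lemma lms_lins J : lins (lms J).
Proof.
elim: J => [|j J IH] m //= [<-|]; last exact: IH.
exact: (lin_comp (@word1_lin B) (hpsi j)).
Qed.

Lemma lms_arity J : [seq m.1.1 | m <- lms J] = map a J.
Proof. by rewrite -map_comp. Qed.

Variables (b : nat -> bool) (W : nat -> A) (Ls : nat -> seq nat).
Hypothesis hW : forall j, pure (b j) (W j).

Lemma map_ksign_lab c L : word (map (ksign c) (map W L)) =
  (-1) ^+ (c && \big[addb/false]_(x <- L) b x) *: word (map W L) :> T A.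
Proof.
rewrite -(ksign_word pA) (ksign_pure c (pure_word pA (pures_lab pA hW L))).
by rewrite /wpar size_map -(big_map (nth 0%N L) predT b) map_nth_iota0 ?take_size.
Qed.

(** The map psi_j passes the letters of all earlier blocks i, which gives the exponent. *)
Lemma tensw_lab J : {in J, forall j, size (Ls j) = a j} ->
  tensw (lms J) (map W (flatten (map Ls J))) =
  (-1) ^+ pairx (fun i j => blockpar b Ls i && p j) J *:
    word [seq psi j (word (map W (Ls j))) | j <- J].
Proof.
elim: J => [|j J IH] s /=; first by rewrite scale1r.
have sj := s j (mem_head _ _).
rewrite map_cat take_size_cat ?size_map // drop_size_cat ?size_map // IH; last first.
  by move=> i iJ; apply: s; rewrite inE iJ orbT.
rewrite map_ksign_lab (linZ (hpsi j)) (linZ (@word1_lin B)) tmulZl tmulZr scalerA -signr_addb.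
rewrite tmul_word /=; congr (_ ^+ _ *: _); congr (nat_of_bool (_ (+) _)).
rewrite odd_count /unzip2 -map_comp big_map /blockpar andbC.
by rewrite xor_andl.
Qed.
End Letters.
End Derivations.

(** * Permutations of tensor factors and equivariance of derivations *)

Section BlockPermutations.
Variable K : comPzRingType.
Implicit Types A B : gmod K.

Section Letters.
Variables (A B : gmod K) (pA : parited A) (pB : parited B).
Variables (a : nat -> nat) (psi : nat -> T A -> B) (p : nat -> bool) (Ls : nat -> seq nat).
Hypothesis hpsi : forall j, linear (psi j).

Lemma tensm_lab b W J : (forall j, pure (b j) (W j)) -> {in J, forall j, size (Ls j) = a j} ->
  tensm (lms a psi p J) (word (map W (flatten (map Ls J)))) =
  (-1) ^+ pairx (fun i j => blockpar b Ls i && p j) J *: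
    word [seq psi j (word (map W (Ls j))) | j <- J].
Proof.
move=> hW hs; rewrite tensm_word //; last exact: lms_lins.
rewrite lms_arity size_map size_flatten /shape -map_comp.
rewrite (_ : [seq (size \o Ls) i | i <- J] = [seq a i | i <- J]); last exact/eq_in_map.
by rewrite eqxx (tensw_lab pA p hpsi hW).
Qed.

(** The sign comparison is [koszul_blocks], for output letters of parity p j plus that of block j.
    It yields both the left balancing of the evaluation of C o C and the equivariance of
    derivations. *)
Lemma permw_tensm r n J x : perm_eq J (iota 0 r) ->
  {in iota 0 r, forall j, size (Ls j) = a j} ->
  perm_eq (flatten (map Ls (iota 0 r))) (iota 0 n) ->
  (forall j, parmap (p j) (psi j)) ->
  permw J (tensm (lms a psi p (iota 0 r)) (permw (flatten (map Ls (iota 0 r))) x)) =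
  (-1) ^+ koszul p J *: tensm (lms a psi p J) (permw (flatten (map Ls J)) x).
Proof.
move=> pJ hs pL ppsi.
have pT := T_parited pA.
have pL' : perm_eq (flatten (map Ls J)) (iota 0 n).
  apply: (perm_trans _ pL); apply: perm_flatten; exact: perm_map.
have lt J' := tensm_lin pA (@lms_lins _ _ _ a _ p hpsi J').
have hsJ : {in J, forall j, size (Ls j) = a j} by move=> j; rewrite (perm_mem pJ); apply: hs.
move: x; apply: (T_lab_ext pA) => [||b W m hW].
- by apply: lin_comp; [exact: permw_lin|apply: lin_comp => //; exact: permw_lin].
- by apply: lin_scale; apply: lin_comp => //; exact: permw_lin.
case: (altP (m =P n)) => [->|ne]; last first.
  rewrite !(permw_other _ pL) ?(permw_other _ pL') ?size_map ?size_iota // !(lin0 (lt _)).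
  by rewrite (lin0 (permw_lin pB J)) scaler0.
rewrite (permw_iota_lab pA hW pL) (permw_iota_lab pA hW pL') !(linZ (lt _)) !(tensm_lab hW) //.
rewrite !(linZ (permw_lin pB J)).
pose Z j := psi j (word (map W (Ls j))).
have hZ j : pure (p j (+) blockpar b Ls j) (Z j).
  apply: parmap_pure pT _ _ _ => //.
  have := pure_word pA (pures_lab pA hW (Ls j)).
  by rewrite /wpar size_map -(big_map (nth 0%N (Ls j)) predT b) map_nth_iota0 ?take_size.
rewrite -!/(map Z _) (permw_iota_lab pB hZ pJ) !scalerA; congr (_ *: _).
rewrite -![(-1) ^+ koszul _ _]signr_odd -!signr_addb -(koszul_blocks b p pJ) //.
by rewrite (perm_uniq pL) iota_uniq.
Qed.
End Letters.

Section OneOdd.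
Variables (A B : gmod K) (pA : parited A) (pB : parited B) (al be : A -> B).
Hypotheses (hal : linear al) (hbe : linear be) (eal : parmap false al) (obe : parmap true be).

(** be at the label i and al elsewhere, on blocks of one letter: a derivation becomes a sum over i
    of tensor products to which [permw_tensm] applies. *)
Definition onepsi (i j : nat) (y : T A) : B := if j == i then be (letter y) else al (letter y).

Lemma onepsi_lin i j : linear (onepsi i j).
Proof. by rewrite /onepsi; case: (j == i); apply: lin_comp => //; apply: letter_lin. Qed.

Lemma letter_par : parmap false (@letter K A).
Proof.
apply: (T_pure_ext pA) => [||b w hw].
- by apply: lin_comp; [exact: par_lin pA|exact: letter_lin].
- by apply: lin_comp; [exact: letter_lin|exact: part_lin (T_parited pA) _].
rewrite (part_pure _ (pure_word pA hw)) letter_word.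
case: w hw => [|x [|y w]] hw.
- by rewrite (lin0 (par_lin pA)); case: ifP; rewrite ?(lin0 (@letter_lin _ A)) ?letter_word.
- have := hw 0%N; rewrite /wpar /= big_seq1 /pure /= => ->.
  by case: (b 0%N) => /=; rewrite ?(lin0 (@letter_lin _ A)) ?letter_word.
- by rewrite (lin0 (par_lin pA)); case: ifP; rewrite ?(lin0 (@letter_lin _ A)) ?letter_word.
Qed.

Lemma onepsi_par i j : parmap (j == i) (onepsi i j).
Proof.
have ll := @letter_lin _ A.
rewrite /onepsi /parmap => x; case: (j == i); rewrite ?obe ?eal.
  by congr be; rewrite -[LHS]/(letter x - goddp (letter x)) letter_par -(linB ll).
by congr al; rewrite -[LHS]/(goddp _) letter_par.
Qed.

Definition onems i J := lms (fun _ => 1%N) (onepsi i) (fun j => j == i) J.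

Lemma sumn_ones (T : Type) (J : seq T) : sumn [seq 1%N | _ <- J] = size J.
Proof. by elim: J => //= j J ->. Qed.

Lemma onems_none i J w : size J = size w -> i \notin J -> tensw (onems i J) w = word (map al w).
Proof.
elim: J w => [|j J IH] [|x w] //= [s]; rewrite inE negb_or eq_sym => /andP[nj nJ].
rewrite take0 drop0 IH // tmul_word /= /onepsi (negbTE nj) letter_word /=.
rewrite (_ : odd _ = false) // /unzip2 -map_comp count_map; apply/negbTE.
rewrite (eq_in_count (a2 := pred0)) ?count_pred0 // => k kJ /=.
by apply: contraNF nJ => /eqP <-.
Qed.

Lemma dw_sum J w : uniq J -> size J = size w -> dw al be w = \sum_(i <- J) tensw (onems i J) w.
Proof.
elim: J w => [|j J IH] [|x w] //=; first by rewrite big_nil.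
case/andP=> jJ uJ [s]; rewrite big_cons take0 drop0 -/(onems j J) onems_none //.
rewrite tmul_word /= /onepsi eqxx letter_word /=.
have cnt i : odd (count id (unzip2 (onems i J))) = (i \in J).
  rewrite /unzip2 -map_comp count_map -[count _ _]/(count_mem i J) count_uniq_mem //.
  by rewrite oddb.
rewrite cnt (negbTE jJ); congr (_ + _).
rewrite (IH _ uJ s) (lin_sum (@tmul_linr _ B _)); apply: eq_big_seq => i iJ.
rewrite cnt iJ letter_word (_ : j == i = false) /=; last first.
  by apply: contraNF jJ => /eqP ->.
by rewrite (parmap_ksign _ _ pA pB hal eal) scale1r.
Qed.

Lemma permw_tder2 L n x : perm_eq L (iota 0 n) ->
  permw L (tder2 al be x) = tder2 al be (permw L x).
Proof.
move=> pL; have ld := tder2_lin pB hal hbe.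
move: x; apply: (T_lab_ext pA) => [||b W m hW].
- by apply: lin_comp => //; exact: permw_lin.
- by apply: lin_comp => //; exact: permw_lin.
case: (altP (m =P n)) => [->|ne]; last first.
  rewrite (permw_other pA pL) ?size_map ?size_iota // (lin0 ld) tder2_word //.
  rewrite -(permw_wt pB _ pL) wt_dw size_map size_iota (negbTE ne) lin0 //.
  exact: permw_lin.
have uL : uniq L by rewrite (perm_uniq pL) iota_uniq.
have sL : size L = n by rewrite (perm_size pL) size_iota.
rewrite (permw_iota_lab pA hW pL) (linZ ld) !tder2_word //.
rewrite (@dw_sum (iota 0 n)) ?iota_uniq ?size_map //.
rewrite (@dw_sum L) ?size_map // (lin_sum (permw_lin pB L)) scaler_sumr.
rewrite -(perm_big _ pL) /=; apply: eq_big_seq => i iL.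
have ll J := @lms_lins _ _ _ (fun=> 1%N) _ (fun j => j == i) (onepsi_lin i) J.
have E J w : size w = size J -> tensw (onems i J) w = tensm (onems i J) (word w).
  move=> s; rewrite tensm_word; [|exact: pA|exact: ll].
  by rewrite lms_arity sumn_ones s eqxx.
rewrite !E ?size_map // -(linZ (tensm_lin pA (ll L))) -(permw_iota_lab pA hW pL).
have fl J : flatten [seq [:: j] | j <- J] = J by elim: J => //= j J ->.
have := @permw_tensm _ _ pA pB (fun=> 1%N) (onepsi i) (fun j => j == i) (fun j => [:: j])
   (onepsi_lin i) n n L (word (map W (iota 0 n))) pL.
rewrite !fl (permw_iota pA) wt_word size_map size_iota eqxx => -> //; last exact: onepsi_par.
(* Only the factor i is odd, so permuting the factors costs no sign. *)
rewrite -signr_odd odd_koszul (@pairx_eq (fun i j => i != j) _ (fun _ _ => false)) -?uniq_pairwise //.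
  by rewrite (_ : pairx _ _ = false) ?scale1r //; elim: (L) => //= j J ->; rewrite big1.
move=> j k njk; apply/negP => /and3P[_ /eqP ej /eqP ek].
by rewrite ej ek eqxx in njk.
Qed.
End OneOdd.

End BlockPermutations.

(** * Schur functors *)

Lemma size_labels n (s : 'S_n) : size (labels s) = n.
Proof. by rewrite size_map size_enum_ord. Qed.

Lemma perm_labels n (s : 'S_n) : perm_eq (labels s) (iota 0 n).
Proof.
rewrite /labels -val_enum_ord -[X in perm_eq X _]/(map (fun i => val (s i)) _).
rewrite (map_comp val s); apply: perm_map; apply: uniq_perm.
- by rewrite map_inj_uniq ?enum_uniq //; exact: perm_inj.
- exact: enum_uniq.
by move=> i; rewrite mem_enum -(permKV s i) map_f // mem_enum.
Qed.

Lemma labels1 n : labels (1%g : 'S_n) = iota 0 n.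
Proof. by rewrite -val_enum_ord; apply/eq_map => i; rewrite perm1. Qed.

Section Schur.
Variables (K : comPzRingType) (sym : bool) (C : sseq K sym).
Implicit Types A B : gmod K.

Lemma C_parited n : parited (C n).
Proof. by apply: graded_parited; apply: chain_graded. Qed.

Lemma act_par n (s : 'S_n) : parmap false (fun c : C n => act c s).
Proof.
have p := C_parited n.
apply: (@parmap_homog _ _ _ 0 _ p p (act_lin s)) => i x hx; rewrite addr0; exact: act_hom.
Qed.

Lemma part_act n b (c : C n) (s : 'S_n) : part b (act c s) = act (part b c) s.
Proof.
have e := act_par s c; case: b; first exact: e.
by rewrite -[LHS]/(act c s - goddp (act c s)) e -(linB (act_lin s)).
Qed.

Section OneModule.
Variable A : gmod K.

Lemma sten_linl n (x : T A) : linear (fun c : C n => sten c x).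
Proof. by move=> a c c'; exact: (bal_linl (sten_balanced C A)). Qed.
Lemma sten_linr n (c : C n) : linear (fun x : T A => sten c x).
Proof. by move=> a x y; exact: (bal_linr (sten_balanced C A)). Qed.
Lemma sten_wt n (c : C n) (x : T A) : sten c (wt n x) = sten c x.
Proof. by symmetry; exact: (bal_wt (sten_balanced C A)). Qed.
Lemma sten_act n (c : C n) (s : 'S_n) (x : T A) : sym -> sten (act c s) x = sten c (permw (labels s) x).
Proof. move=> h; exact: (bal_act (sten_balanced C A) h). Qed.
Lemma sten0l n (x : T A) : sten (0 : C n) x = 0. Proof. exact: lin0 (@sten_linl n x). Qed.
Lemma sten0r n (c : C n) : sten c (0 : T A) = 0. Proof. exact: lin0 (@sten_linr n c). Qed.
Lemma stenZl n a (c : C n) (x : T A) : sten (a *: c) x = a *: sten c x.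
Proof. exact: (linZ (@sten_linl n x) a c). Qed.
Lemma stenZr n a (c : C n) (x : T A) : sten c (a *: x) = a *: sten c x.
Proof. exact: (linZ (@sten_linr n c) a x). Qed.

Lemma sten_word_other n (c : C n) (w : seq A) : size w != n -> sten c (word w : T A) = 0.
Proof. by move=> h; rewrite -sten_wt wt_word (negbTE h) sten0r. Qed.

Lemma S_ext (M : lmodType K) (f g : schur C A -> M) : linear f -> linear g ->
  (forall n (c : C n) (w : seq A), size w = n -> f (sten c (word w)) = g (sten c (word w))) ->
  f =1 g.
Proof.
move=> hf hg e; apply: pres_lin_ext => // -[n [c x]].
rewrite -[gen _ _]/(sten c x); move: x; apply: T_ext => [||w].
- by apply: lin_comp => //; exact: sten_linr.
- by apply: lin_comp => //; exact: sten_linr.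
case: (altP (size w =P n)) => [|ne]; first exact: e.
by rewrite sten_word_other // (lin0 hf) (lin0 hg).
Qed.

Section Sbil.
Variables (M : lmodType K) (phi : forall n, C n -> T A -> M).
Definition sbal := balanced (fun g : {n : nat & (C n * T A)%type} => phi (tagged g).1 (tagged g).2).
Hypothesis hphi : sbal.
Lemma slift_lin : linear (slift phi : schur C A -> M).
Proof. exact: lift_linear hphi. Qed.
Lemma slift_sten n (c : C n) x : slift phi (sten c x) = @phi n c x.
Proof. exact: (lift_gen (existT _ n (c, x)) hphi). Qed.
End Sbil.

Lemma sbal_intro (M : lmodType K) (phi : forall n, C n -> T A -> M) :
  (forall n x, linear (fun c : C n => @phi n c x)) -> (forall n c, linear (@phi n c)) ->
  (forall n (c : C n) x, @phi n c (wt n x) = @phi n c x) ->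
  (sym -> forall n (c : C n) (s : 'S_n) x, @phi n (act c s) x = @phi n c (permw (labels s) x)) ->
  sbal phi.
Proof.
move=> hl hr hw ha; split=> /= [n a c c' x|n a c x y|n c x|].
- exact: hl.
- exact: hr.
- by rewrite hw.
- exact: ha.
Qed.

Lemma swt_bal m : sbal (fun n c x => if n == m then sten c x : schur C A else 0).
Proof.
apply: sbal_intro => [n x|n c|n c x|h n c s x].
- by move=> a c c'; case: ifP => _; rewrite ?sten_linl // scaler0 addr0.
- by move=> a x y; case: ifP => _; rewrite ?sten_linr // scaler0 addr0.
- by rewrite sten_wt.
- by rewrite sten_act.
Qed.
Lemma swt_lin m : linear (@swt _ _ C A m).
Proof. exact: slift_lin (swt_bal m). Qed.
Lemma swt_sten m n (c : C n) x : swt m (sten c x : schur C A) = if n == m then sten c x else 0.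
Proof. exact: (slift_sten (swt_bal m)). Qed.

Hypothesis pA : parited A.

Lemma part_permw b n (s : 'S_n) (x : T A) : part b (permw (labels s) x) = permw (labels s) (part b x).
Proof.
have e := permw_par pA (labels s) x; case: b; first exact: e.
by rewrite -[LHS]/(permw (labels s) x - goddp (permw (labels s) x)) e -(linB (permw_lin pA _)).
Qed.

Lemma part_wt b n (x : T A) : part b (wt n x) = wt n (part b x).
Proof. by rewrite -!(permw_iota pA) -labels1 part_permw. Qed.

Lemma Sodd_bal : sbal (fun n (c : C n) x =>
  sten (part true c) (part false x) + sten (part false c) (part true x) : schur C A).
Proof.
have pT := T_parited pA; have lT b := part_lin pT b.
apply: sbal_intro => [n x|n c|n c x|h n c s x].
- by apply: lin_add; apply: (lin_comp (sten_linl _)); apply: part_lin (C_parited n) _.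
- by apply: lin_add; apply: (lin_comp (sten_linr _)).
- by rewrite !part_wt !sten_wt.
- by rewrite !part_act !sten_act // !part_permw.
Qed.

Lemma pure_sten n b b' (c : C n) (x : T A) : pure b c -> pure b' x ->
  pure (b (+) b') (sten c x : schur C A).
Proof.
move=> hc hx; rewrite /pure [LHS](slift_sten Sodd_bal c x).
rewrite !(part_pure _ hc) !(part_pure _ hx).
by case: b b' {hc hx} => [] []; rewrite /= ?sten0l ?sten0r ?addr0 ?add0r.
Qed.

Lemma hom_sten n i j (c : C n) (x : T A) : homog i c -> homog j x -> homog (i + j) (sten c x : schur C A).
Proof. by move=> hc hx; apply: span_gen; exists n, c, x, i, j. Qed.

Lemma S_parited : parited (schur C A).
Proof.
split.
- exact: slift_lin Sodd_bal.
- move=> i; apply: (span_ext (f := @goddp _ (schur C A)) (g := fun x : schur C A => if odd `|i|%N then x else 0)).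
  + exact: slift_lin Sodd_bal.
  + by case: (odd _) => a x y; rewrite ?scaler0 ?addr0.
  move=> y [n [c [x [p [q [hc hx <- ->]]]]]].
  have := pure_sten (hom_pure (C_parited n) hc) (hom_pure (T_parited pA) hx).
  by rewrite /pure => ->; rewrite -isoddD.
- move=> y; rewrite [y](pres_gen_sum y).
  elim: (prep y) => [|[a [n [c x]]] s IH]; first by rewrite big_nil; apply: span0.
  rewrite big_cons; apply: span_add => [|//]; apply: span_scale => /=.
  rewrite -[gen _ _]/(sten c x).
  apply: (span_image (@sten_linl n x) _ (par_span (C_parited n) c)) => c' [i hi].
  apply: (span_image (@sten_linr n c') _ (par_span (T_parited pA) x)) => x' [j hj].
  by apply: span_gen; exists (i + j); apply: hom_sten.
Qed.

Lemma S_pure_ext (M : lmodType K) (f g : schur C A -> M) : linear f -> linear g ->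
  (forall n b (c : C n) b' x, pure b c -> pure b' x -> f (sten c x) = g (sten c x)) ->
  f =1 g.
Proof.
move=> hf hg e; apply: S_ext => // n c w _; move: (word w) => x.
move: c; apply: (pure_ext (C_parited n)) => [||b c hc].
- by apply: lin_comp => //; exact: sten_linl.
- by apply: lin_comp => //; exact: sten_linl.
move: x; apply: (pure_ext (T_parited pA)) => [||b' x hx].
- by apply: lin_comp => //; exact: sten_linr.
- by apply: lin_comp => //; exact: sten_linr.
exact: e hc hx.
Qed.
End OneModule.

(** The conditions under which 1 \otimes phi descends to the summands of C[A], with coinvariants in
    the symmetric case. *)
Record thickmap A B (phi : T A -> T B) : Prop := {
  tk_lin : linear phi;
  tk_wt : forall n x, phi (wt n x) = wt n (phi x);
  tk_sym : sym -> forall n (s : 'S_n) x, phi (permw (labels s) x) = permw (labels s) (phi x)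
}.

Section Smap.
Variables (A B : gmod K) (b : bool) (phi : T A -> T B).
Hypothesis tphi : thickmap phi.

Lemma ksign_act n c (x : C n) (s : 'S_n) : ksign c (act x s) = act (ksign c x) s.
Proof.
have p := C_parited n.
have := parmap_ksign c x p p (act_lin s) (act_par s); by rewrite scale1r.
Qed.

Lemma smap_bal : sbal (fun n (c : C n) x => sten (ksign b c) (phi x) : schur C B).
Proof.
have lk n := ksign_lin (C_parited n) b.
apply: sbal_intro => [n x|n c|n c x|h n c s x].
- exact: (lin_comp (sten_linl _) (lk n)).
- by apply: (lin_comp (sten_linr _)); apply: tk_lin.
- by rewrite tk_wt // sten_wt.
- by rewrite ksign_act sten_act // tk_sym.
Qed.
Lemma smap_lin : linear (smap (C:=C) b phi).
Proof. exact: slift_lin smap_bal. Qed.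
Lemma smap_sten n (c : C n) x : smap b phi (sten c x) = sten (ksign b c) (phi x).
Proof. exact: (slift_sten smap_bal). Qed.

Lemma smap_swt m (y : schur C A) : smap b phi (swt m y) = swt m (smap b phi y).
Proof.
move: y; apply: S_ext => [||n c w _].
- by apply: lin_comp; [exact: smap_lin|exact: swt_lin].
- by apply: lin_comp; [exact: swt_lin|exact: smap_lin].
rewrite swt_sten smap_sten swt_sten; case: ifP => _; rewrite ?smap_sten //; exact: lin0 smap_lin.
Qed.

Lemma smap_par : parited A -> parited B -> parmap b phi -> parmap b (smap (C:=C) b phi).
Proof.
move=> pA pB hp; have pS := S_parited pA; have pS' := S_parited pB.
have pT := T_parited pA.
apply: (S_pure_ext pA) => [||n d c d' x hc hx].
- by apply: lin_comp; [exact: par_lin|exact: smap_lin].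
- by apply: lin_comp; [exact: smap_lin|exact: part_lin].
have hc' : pure d (ksign b c).
  by rewrite (ksign_pure _ hc); apply: pureZ (C_parited n) _ _ _ hc.
have hx' := parmap_pure pT (tk_lin tphi) hp hx.
rewrite smap_sten (pure_sten pB hc' hx') (part_pure _ (pure_sten pA hc hx)).
have -> : d (+) (b (+) d') = (d (+) d' == ~~ b) by case: (b); case: (d); case: (d').
by case: ifP => _; rewrite ?smap_sten ?(lin0 smap_lin).
Qed.
End Smap.

Lemma smap_smap A B (D : gmod K) b b' (phi : T A -> T B) (psi : T B -> T D) y :
  thickmap phi -> thickmap psi ->
  smap (C:=C) b' psi (smap b phi y) = smap (b (+) b') (fun x => psi (phi x)) y.
Proof.
move=> h h'.
have h'' : thickmap (fun x => psi (phi x)).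
  split=> [|n x|s n p x]; first by apply: lin_comp; apply: tk_lin.
  - by rewrite !tk_wt.
  - by rewrite !tk_sym.
move: y; apply: S_ext => [||n c w _].
- by apply: lin_comp; apply: smap_lin.
- exact: smap_lin.
rewrite !smap_sten //; case: b b' => [] []; rewrite /= ?(ksignK (C_parited n)) //.
Qed.

Lemma thickmap_tmap A B (f : A -> B) : parited A -> parited B -> linear f -> parmap false f ->
  thickmap (tmap f).
Proof.
move=> pA pB hf ef; split=> [|n x|_ n s x]; first exact: tmap_lin.
  by rewrite -!permw_iota // permw_tmap.
by rewrite permw_tmap.
Qed.

Lemma thickmap_tder2 A B (al be : A -> B) : parited A -> parited B -> linear al -> linear be ->
  parmap false al -> parmap true be -> thickmap (tder2 al be).
Proof.
move=> pA pB hal hbe eal obe; split=> [|n x|_ n s x]; first exact: tder2_lin.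
  by rewrite wt_tder2.
by rewrite (permw_tder2 pA pB hal hbe eal obe _ (perm_labels s)).
Qed.
End Schur.

Section TensmMore.
Variable K : comPzRingType.

Section PhiLinear.
Variables (A B : gmod K) (pA : parited A).

Lemma tensw_phi (ms1 ms2 : seq (nat * (T A -> T B) * bool)) m p (k : K) (f g h : T A -> T B) w :
  (forall y, f y = k *: g y + h y) ->
  tensw (ms1 ++ (m, f, p) :: ms2) w =
  k *: tensw (ms1 ++ (m, g, p) :: ms2) w + tensw (ms1 ++ (m, h, p) :: ms2) w.
Proof.
move=> e; elim: ms1 w => [|[[a q] b] ms1 IH] w /=; first by rewrite e tmulDl tmulZl.
by rewrite IH tmulDr tmulZr /unzip2 !map_cat.
Qed.

Lemma tensm_phi (ms1 ms2 : seq (nat * (T A -> T B) * bool)) m p (k : K) (f g h : T A -> T B) x :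
  lins ms1 -> lins ms2 -> linear g -> linear h ->
  (forall y, f y = k *: g y + h y) ->
  tensm (ms1 ++ (m, f, p) :: ms2) x =
  k *: tensm (ms1 ++ (m, g, p) :: ms2) x + tensm (ms1 ++ (m, h, p) :: ms2) x.
Proof.
move=> l1 l2 hg hh e.
have hf : linear f.
  by move=> a u v; rewrite !e hg hh !scalerDr !scalerA addrACA [k * a]mulrC.
have L q : linear q -> lins (ms1 ++ (m, q, p) :: ms2).
  by move=> hq z /List.in_app_iff [/l1|[<-|/l2]].
move: x; apply: T_ext => [||w].
- by apply: tensm_lin => //; apply: L.
- by apply: lin_add; [apply: lin_scale|]; apply: tensm_lin => //; apply: L.
rewrite !tensm_word //; try exact: L.
rewrite !map_cat /=; case: ifP => _; last by rewrite scaler0 addr0.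
exact: tensw_phi.
Qed.

Lemma tensw_zero (ms : seq (nat * (T A -> T B) * bool)) w m :
  List.In m ms -> (forall y, m.1.2 y = 0) -> tensw ms w = 0.
Proof.
elim: ms w => [|[[a q] b] ms IH] w //= [<- /= e|i e]; first by rewrite e tmul0l.
by rewrite IH ?tmul0r.
Qed.
End PhiLinear.

Section Inner.
Variables (A B : gmod K) (pA : parited A).
Variables (a : nat -> nat) (psi : nat -> T A -> B) (p : nat -> bool) (Ls sg : nat -> seq nat).
Hypothesis hpsi : forall j, linear (psi j).

Lemma word_signs (e : nat -> bool) (z : nat -> B) J :
  word [seq (-1) ^+ e j *: z j | j <- J] =
  (-1) ^+ (\big[addb/false]_(j <- J) e j) *: word [seq z j | j <- J] :> T B.
Proof.
elim: J => [|j J IH] /=; first by rewrite big_nil scale1r.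
rewrite big_cons signr_addb -scalerA word_cons IH (linZ (@word1_lin _ B)) tmulZl tmulZr.
by rewrite tmul_word.
Qed.

(** Rearranging letters inside the blocks changes neither the block parities nor the set of letter
    pairs from different blocks. What remains is one Koszul sign per block, given by
    [koszul_comp]. *)
Lemma tensm_inner n J x : {in J, forall j, size (Ls j) = a j} ->
  {in J, forall j, perm_eq (sg j) (iota 0 (a j))} ->
  perm_eq (flatten (map Ls J)) (iota 0 n) ->
  let Ls' j := [seq nth 0%N (Ls j) i | i <- sg j] in
  tensm (lms a (fun j y => psi j (permw (sg j) y)) p J) (permw (flatten (map Ls J)) x) =
  tensm (lms a psi p J) (permw (flatten (map Ls' J)) x).
Proof.
move=> hs hg pL Ls'.
have pL' : perm_eq (flatten (map Ls' J)) (iota 0 n).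
  apply: (perm_trans _ pL); elim: (J) hs hg {pL} => //= j J' IH hs hg.
  apply: perm_cat; first by apply: perm_iota_nth; rewrite hs ?mem_head // hg ?mem_head.
  by apply: IH => i iJ; [apply: hs|apply: hg]; rewrite inE iJ orbT.
have hs' : {in J, forall j, size (Ls' j) = a j}.
  by move=> j jJ; rewrite size_map (perm_size (hg j jJ)) size_iota.
have hpsi' j : linear (fun y => psi j (permw (sg j) y)).
  by apply: lin_comp => //; apply: permw_lin.
have l1 := tensm_lin pA (@lms_lins _ _ _ a _ p hpsi J).
have l2 := tensm_lin pA (@lms_lins _ _ _ a _ p hpsi' J).
move: x; apply: (T_lab_ext pA) => [||b W m hW].
- by apply: lin_comp => //; exact: permw_lin.
- by apply: lin_comp => //; exact: permw_lin.
case: (altP (m =P n)) => [->|ne]; last first.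
  by rewrite !(permw_other _ pL) ?(permw_other _ pL') ?size_map ?size_iota // (lin0 l1) (lin0 l2).
have uL : uniq (flatten (map Ls J)) by rewrite (perm_uniq pL) iota_uniq.
have uLj : {in J, forall j, uniq (Ls j)}.
  move=> j jJ; move: uL; case/splitPr: jJ => J1 J2.
  by rewrite map_cat flatten_cat /= !cat_uniq => /and3P[_ _ /and3P[]].
rewrite (permw_iota_lab pA hW pL) (permw_iota_lab pA hW pL') (linZ l1) (linZ l2).
rewrite (tensm_lab pA _ hpsi hW) // (tensm_lab pA _ hpsi' hW) // !scalerA.
pose e j := odd (koszul (fun i => b (nth 0%N (Ls j) i)) (sg j)).
have E : {in J, forall j, psi j (permw (sg j) (word [seq W i | i <- Ls j])) =
   (-1) ^+ e j *: psi j (word [seq W i | i <- Ls' j])}.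
  move=> j jJ; rewrite (permw_lab pA hW) hs // hg // -(linZ (hpsi j)).
  by rewrite -signr_odd.
move/eq_in_map: E => ->; rewrite word_signs scalerA; congr (_ *: _).
rewrite -![(-1) ^+ koszul _ _]signr_odd -!signr_addb !odd_koszul !pairx_flatten.
have bp j : j \in J -> perm_eq (Ls' j) (Ls j).
  by move=> jJ; apply: perm_iota_nth; rewrite hs // hg.
have -> : \big[addb/false]_(j <- J) pairx (inv b) (Ls' j) =
   \big[addb/false]_(j <- J) pairx (inv b) (Ls j) (+) \big[addb/false]_(j <- J) e j.
  rewrite -big_split; apply: eq_big_seq => j jJ.
  by rewrite -!odd_koszul koszul_comp ?hs ?hg ?uLj.
have PE F G : (forall i j, i \in J -> j \in J -> F i j = G i j) -> pairx F J = pairx G J.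
  elim: (J) => //= j J' IH h; rewrite IH; last by move=> i k iJ kJ; apply: h; rewrite inE ?iJ ?kJ orbT.
  by congr addb; apply: eq_big_seq => i iJ; apply: h; rewrite inE ?eqxx ?iJ ?orbT.
have -> : pairx (fun i j => \big[addb/false]_(x <- Ls' i) \big[addb/false]_(y <- Ls' j) inv b x y) J =
  pairx (fun i j => \big[addb/false]_(x <- Ls i) \big[addb/false]_(y <- Ls j) inv b x y) J.
  apply: PE => i j iJ jJ; rewrite (perm_big _ (bp i iJ)); apply: eq_bigr => x _.
  exact: perm_big (bp j jJ).
have -> : pairx (fun i j => blockpar b Ls' i && p j) J = pairx (fun i j => blockpar b Ls i && p j) J.
  by apply: PE => i j iJ _; congr (_ && _); exact: perm_big (bp i iJ).
congr (_ ^+ nat_of_bool _).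
set u := \big[addb/false]_(j <- J) pairx _ _; set v := \big[addb/false]_(j <- J) e j.
move: u v => u v; move: (pairx _ J) => q; move: (pairx _ J) => r.
by case: u; case: v; case: q; case: r.
Qed.
End Inner.
End TensmMore.

(** * The composite of a symmetric sequence with itself *)

Lemma map_iota_nth (T U : Type) (f : T -> U) x0 (s : seq T) :
  map f s = [seq f (nth x0 s j) | j <- iota 0 (size s)].
Proof. by rewrite -{1}(mkseq_nth x0 s) /mkseq -map_comp. Qed.

Lemma if_perm (b : bool) L n :
  (if b then perm_eq L (iota 0 n) else L == iota 0 n) -> perm_eq L (iota 0 n).
Proof. by case: b => // /eqP ->. Qed.

Section Ccev.
Variables (K : comPzRingType) (sym : bool) (C : sseq K sym) (A : gmod K).
Hypothesis pA : parited A.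
Implicit Types (bl : seq (block C)) (bs : seq bool).

Definition bar bl j := tag (nth (block0 C) bl j).1.
Definition blab bl j := (nth (block0 C) bl j).2.
Definition bpsi bs bl j (y : T A) : schur C A :=
  sten (part (nth false bs j) (tagged (nth (block0 C) bl j).1)) y.

Definition blms bs bl : seq (nat * (T A -> T (schur C A)) * bool) :=
  [seq (tag p.2.1, (fun y : T A => word [:: (sten (part p.1 (tagged p.2.1)) y : schur C A)]), p.1)
  | p <- zip bs bl].

Lemma blmsE bs bl : size bs = size bl ->
  blms bs bl = lms (bar bl) (bpsi bs bl) (nth false bs) (iota 0 (size bl)).
Proof.
move=> s; rewrite /blms (map_iota_nth _ (false, block0 C)) size_zip s minnn.
apply/eq_in_map => j; rewrite mem_iota add0n => /= lj.
by rewrite nth_zip.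
Qed.

Lemma bpsi_lin bs bl j : linear (bpsi bs bl j).
Proof. exact: sten_linr. Qed.

Lemma blms_lins bs bl : lins (blms bs bl).
Proof.
rewrite /blms; elim: (zip bs bl) => [|p s IH] m //= [<-|]; last exact: IH.
exact: (lin_comp (@word1_lin _ (schur C A)) (@sten_linr _ _ C A _ _)).
Qed.

Definition ccterm r (c : C r) bs bl (x : T A) : schur C (schur C A) :=
  sten c (tensm (blms bs bl) (permw (flatten [seq b.2 | b <- bl]) x)).

Definition ccphi n (x : T A) (g : cosym C) : schur C (schur C A) :=
  if cosym_valid n g then
    tsum (size g.2) predT (fun bs => ccterm (tagged g.1) bs g.2 x) else 0.

Lemma ccterm_linr r (c : C r) bs bl : linear (ccterm c bs bl).
Proof.
apply: lin_comp; first exact: sten_linr.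
by apply: lin_comp; [apply: tensm_lin => //; apply: blms_lins|exact: permw_lin].
Qed.

Lemma ccphi_lin n g : linear (fun x => ccphi n x g).
Proof.
rewrite /ccphi; case: (cosym_valid n g); last by move=> a u v; rewrite scaler0 addr0.
exact: (tsum_lin predT (fun bs _ => @ccterm_linr _ (tagged g.1) bs g.2)).
Qed.

Lemma ccterm_zero r (c : C r) bs bl x j : size bs = size bl -> (j < size bl)%N ->
  part (nth false bs j) (tagged (nth (block0 C) bl j).1) = 0 -> ccterm c bs bl x = 0.
Proof.
move=> s lj e; rewrite /ccterm; suff -> : tensm (blms bs bl) (permw (flatten [seq b.2 | b <- bl]) x) = 0 by exact: sten0r.
move: (permw _ x); apply: T_ext => [||w].
- by apply: tensm_lin => //; apply: blms_lins.
- exact: lin_zero.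
rewrite tensm_word //; last exact: blms_lins.
case: ifP => // _; apply: tensw_zero => [|y].
  rewrite blmsE //; apply: (@List.in_map nat _ (fun j => (bar bl j, fun y => word [:: bpsi bs bl j y], nth false bs j)) _ j).
  have : j \in iota 0 (size bl) by rewrite mem_iota.
  by elim: (iota 0 _) => //= i t IH; rewrite inE => /predU1P[->|h]; [left|right; apply: IH].
by rewrite /= /bpsi e sten0l (lin0 (@word1_lin _ _)).
Qed.

Definition bpure bs bl := forall j, pure (nth false bs j) (tagged (nth (block0 C) bl j).1).

(** Any other choice of parities makes one of the inner factors zero. *)
Lemma ccphi_pure n x (g : cosym C) bs : size bs = size g.2 -> bpure bs g.2 ->
  ccphi n x g = if cosym_valid n g then ccterm (tagged g.1) bs g.2 x else 0.
Proof.
move=> s hb; rewrite /ccphi; case: ifP => // _; rewrite (@tsum_pure _ _ _ _ _ _ bs) //.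
move=> bs' s' ne; have eb : bs = [seq nth false bs i | i <- iota 0 (size g.2)].
  by rewrite -s -[LHS](mkseq_nth false).
rewrite eb in ne; have [j lj nj] := bs_neq false s' ne.
apply: (@ccterm_zero _ _ _ _ _ j) => //.
by rewrite (part_pure _ (hb j)) eq_sym (negbTE nj).
Qed.

Lemma valid_sym n (g : cosym C) : sym -> cosym_valid n g =
  [&& size g.2 == tag g.1, all (fun b : block C => size b.2 == tag b.1) g.2 &
      perm_eq (flatten [seq b.2 | b <- g.2]) (iota 0 n)].
Proof. by move=> h; rewrite /cosym_valid (ifT _ _ h). Qed.

Lemma valid_actr n g l r m (c : C m) (s : 'S_m) (L : seq nat) : sym -> size L = m ->
  cosym_valid n (g, l ++ (existT _ m (act c s), L) :: r) =
  cosym_valid n (g, l ++ (existT _ m c, [seq nth 0%N L j | j <- labels s]) :: r).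
Proof.
move=> hs sL; set L' := [seq _ | _ <- _].
have pL : perm_eq L' L by apply: perm_iota_nth; rewrite sL; apply: perm_labels.
rewrite !valid_sym //= !map_cat !size_cat !all_cat !flatten_cat /= (perm_size pL).
congr [&& _, _ & _]; apply: permPl; apply: perm_cat => //; apply: perm_cat => //.
by rewrite perm_sym.
Qed.

Lemma flat_blab bl : flatten [seq b.2 | b <- bl] = flatten (map (blab bl) (iota 0 (size bl))).
Proof. by rewrite (map_iota_nth _ (block0 C)). Qed.

Lemma valid_actl n r (c : C r) (s : 'S_r) bl : sym -> size bl = r ->
  cosym_valid n (existT _ r (act c s), bl) =
  cosym_valid n (existT (fun r => C r : Type) r c, [seq nth (block0 C) bl j | j <- labels s]).
Proof.
move=> hs sr; set bl' := [seq _ | _ <- _].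
have pp := perm_labels s.
have sS : size (labels s) = r by apply: size_labels.
rewrite !valid_sym //= size_map sS sr; congr [&& _, _ & _].
  rewrite /bl' all_map (perm_all _ pp) -(all_map (nth (block0 C) bl)) -sr.
  by rewrite (_ : map _ _ = bl) // [LHS]mkseq_nth.
apply: permPl; rewrite perm_sym /bl' -map_comp flat_blab sr; apply: perm_flatten.
exact: perm_map.
Qed.

Lemma valid_perm n (g : cosym C) : cosym_valid n g -> perm_eq (flatten [seq b.2 | b <- g.2]) (iota 0 n).
Proof. by case/and3P => _ _; apply: if_perm. Qed.

Lemma valid_size n (g : cosym C) : cosym_valid n g -> size g.2 = tag g.1.
Proof. by case/and3P => /eqP. Qed.

Lemma valid_block n (g : cosym C) j : cosym_valid n g -> (j < size g.2)%N ->
  size (blab g.2 j) = bar g.2 j.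
Proof. by case/and3P => _ /allP a _ lj; apply/eqP; apply: a; apply: mem_nth. Qed.

Lemma sten_par b r (c : C r) : pure b c -> parmap b (fun y : T A => (sten c y : schur C A)).
Proof.
move=> hc; apply: (parmap_intro (T_parited pA) (S_parited C pA)); first exact: sten_linr.
by move=> b' y; apply: pure_sten.
Qed.

Lemma valid_set n g l r m (c c' : C m) L :
  cosym_valid n (g, l ++ (existT _ m c, L) :: r) = cosym_valid n (g, l ++ (existT _ m c', L) :: r).
Proof. by rewrite /cosym_valid /= !map_cat !size_cat !all_cat. Qed.

Lemma ccphi_linr n x g l r m k (c c' : C m) L :
  ccphi n x (g, l ++ (existT _ m (k *: c + c'), L) :: r) =
  k *: ccphi n x (g, l ++ (existT _ m c, L) :: r) + ccphi n x (g, l ++ (existT _ m c', L) :: r).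
Proof.
rewrite /ccphi (valid_set _ _ _ _ _ c) (valid_set _ _ _ _ c' c).
case: ifP => _; last by rewrite scaler0 addr0.
rewrite /= !size_cat /=.
rewrite /tsum scaler_sumr -big_split; apply: eq_bigr => bs _; rewrite /ccterm !map_cat /=.
set bs0 := (tval bs).
have s : size bs0 = (size l + (size r).+1)%N by apply: size_tuple.
have E (d : C m) : blms bs0 (l ++ (existT _ m d, L) :: r) =
   blms (take (size l) bs0) l ++
   (m, (fun y : T A => word [:: (sten (part (nth false bs0 (size l)) d) y : schur C A)]), nth false bs0 (size l))
   :: blms (drop (size l).+1 bs0) r.
  rewrite /blms -{1}(cat_take_drop (size l) bs0) (drop_nth false) ?s; last by lia.
  by rewrite zip_cat ?map_cat // size_takel // s; lia.
rewrite -sten_linr; set X := tensm _ _; set Y := k *: _ + _.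
suff -> : X = Y by []; rewrite /X /Y !E; apply: (tensm_phi pA) => [||||y].
- exact: blms_lins.
- exact: blms_lins.
- exact: (lin_comp (@word1_lin _ (schur C A)) (@sten_linr _ _ C A _ _)).
- exact: (lin_comp (@word1_lin _ (schur C A)) (@sten_linr _ _ C A _ _)).
by rewrite (part_lin (C_parited _ _)) sten_linl word1_lin.
Qed.

(** The permutation acts inside the block at position [size l], and [tensm_inner] absorbs it into
    the labels of that block. *)
Lemma ccphi_actr n x : sym -> forall g l r m (c : C m) (s : 'S_m) (L : seq nat), size L = m ->
  ccphi n x (g, l ++ (existT _ m (act c s), L) :: r) =
  ccphi n x (g, l ++ (existT _ m c, [seq nth 0%N L j | j <- labels s]) :: r).
Proof.
move=> hs g l r m c s L sL.
set L' := [seq _ | _ <- _].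
have pL : perm_eq L' L by apply: perm_iota_nth; rewrite sL; apply: perm_labels.
set bl := l ++ (_, L) :: r; set bl' := l ++ _ :: r.
have V : cosym_valid n (g, bl) = cosym_valid n (g, bl') by apply: valid_actr.
have sb : size bl = size bl' by rewrite /bl /bl' !size_cat.
rewrite /ccphi -V; case: ifP => // vg; rewrite -[(g, bl).2]/bl -[(g, bl').2]/bl' sb.
apply: eq_tsum => bs sbs; rewrite /ccterm.
suff -> : tensm (blms bs bl) (permw (flatten [seq b.2 | b <- bl]) x) =
          tensm (blms bs bl') (permw (flatten [seq b.2 | b <- bl']) x) by [].
(* The other blocks get the identity permutation. It acts as the projection [wt], which is invisible
   in [sten]. *)
pose sg j := if j == size l then labels s else iota 0 (bar bl j).
have nl z : nth (block0 C) (l ++ z :: r) (size l) = z by rewrite nth_cat ltnn subnn.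
have nn z z' j : j != size l -> nth (block0 C) (l ++ z :: r) j = nth (block0 C) (l ++ z' :: r) j.
  move=> nj; rewrite !nth_cat; case: ltnP => // lj.
  have : (0 < j - size l)%N by rewrite subn_gt0 ltn_neqAle eq_sym nj.
  by case: (j - size l)%N.
have eb : bar bl = bar bl'.
  apply: funext => j; rewrite /bar; case: (altP (j =P size l)) => [->|nj]; first by rewrite !nl.
  by rewrite /bl (nn _ (existT _ m c, L') _ nj).
have ep : bpsi bs bl = fun j y => bpsi bs bl' j (permw (sg j) y).
  apply: funext => j; apply: funext => y; rewrite /bpsi /sg.
  case: (altP (j =P size l)) => [->|nj]; first by rewrite !nl /= part_act sten_act.
  rewrite (permw_iota pA) /bl /bar (nn _ (existT _ m c, L') _ nj) sten_wt //.
rewrite !blmsE ?sbs // eb ep !flat_blab sb.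
rewrite (@tensm_inner _ A (schur C A) pA (bar bl') (bpsi bs bl') (nth false bs) (blab bl) sg
  (bpsi_lin bs bl') n (iota 0 (size bl')) x); last first.
- by rewrite -sb -flat_blab; apply: (valid_perm vg).
- move=> j _; rewrite /sg eb; case: eqP => // ->.
  by rewrite /bar nl; apply: perm_labels.
- by move=> j; rewrite mem_iota add0n -sb -eb => /= lj; rewrite (valid_block vg).
rewrite -sb; congr (tensm _ (permw (flatten _) _)); apply/eq_in_map => j; rewrite mem_iota add0n => /= lj.
rewrite /sg; case: (altP (j =P size l)) => [->|nj].
  by rewrite /blab !nl.
rewrite -(valid_block vg lj) [LHS]mkseq_nth /blab /bl (nn _ (existT _ m c, L') _ nj) //.
Qed.

(** The permutation of the outer inputs is moved to the tensor by the balancing of [sten] and then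
    permutes the blocks by [permw_tensm]. *)
Lemma ccphi_actl n x : sym -> forall r (c : C r) (s : 'S_r) bl bs, size bl = r ->
  (forall j, goddp (tagged (nth (block0 C) bl j).1) =
               if nth false bs j then tagged (nth (block0 C) bl j).1 else 0) ->
  ccphi n x (existT _ r (act c s), bl) =
    (-1) ^+ koszul (nth false bs) (labels s) *:
      ccphi n x (existT _ r c, [seq nth (block0 C) bl j | j <- labels s]).
Proof.
move=> hs r c s bl bs0 sr hb.
have pp := perm_labels s; set S := labels s in pp *.
(* The given list of parities may have any length; it is cut or padded to the number r of blocks. *)
pose bs := mkseq (nth false bs0) r.
have sbs : size bs = size bl by rewrite size_mkseq.
have lS j : j \in S -> (j < r)%N by rewrite (perm_mem pp) mem_iota add0n.
have hbs : bpure bs bl.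
  move=> j; case: (ltnP j r) => lj; first by rewrite nth_mkseq //; exact: hb.
  by rewrite [nth (block0 C) _ _]nth_default ?sr //; apply: pure0 (C_parited _ _) _.
have -> : koszul (nth false bs0) S = koszul (nth false bs) S.
  by apply: koszul_ext => j /lS lj; rewrite nth_mkseq.
set bl' := [seq _ | _ <- _].
pose bs' := [seq nth false bs j | j <- S].
have sS : size S = r by rewrite (perm_size pp) size_iota.
have sbs' : size bs' = size bl' by rewrite !size_map.
have nbl' j : (j < r)%N -> nth (block0 C) bl' j = nth (block0 C) bl (nth 0%N S j).
  by move=> lj; rewrite (nth_map 0%N) ?sS.
have nbs' j : (j < r)%N -> nth false bs' j = nth false bs (nth 0%N S j).
  by move=> lj; rewrite (nth_map 0%N) ?sS.
have hbs' : bpure bs' bl'.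
  move=> j; case: (ltnP j r) => lj.
    by rewrite nbs' // nbl' //; exact: hbs.
  rewrite [nth _ bl' j]nth_default; first exact: pure0 (C_parited _ _) _.
  by rewrite /bl' size_map sS.
have V : cosym_valid n (existT _ r (act c s), bl) = cosym_valid n (existT (fun r => C r : Type) r c, bl').
  exact: valid_actl.
rewrite (@ccphi_pure n x (existT (fun r => C r : Type) r (act c s), bl) bs) //.
rewrite (@ccphi_pure n x (existT (fun r => C r : Type) r c, bl') bs') // -V.
case: ifP => vg; last by rewrite scaler0.
rewrite /ccterm /= sten_act // -stenZr.
suff -> : permw (labels s) (tensm (blms bs bl) (permw (flatten [seq b.2 | b <- bl]) x)) =
  (-1) ^+ koszul (nth false bs) S *: tensm (blms bs' bl') (permw (flatten [seq b.2 | b <- bl']) x) by [].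
rewrite flat_blab blmsE // sr (@permw_tensm _ _ _ pA (S_parited C pA) _ _ _ _ _ _ n) //; last first.
- by move=> j; apply: sten_par; apply: pure_part (C_parited _ _) _ _.
- by rewrite -sr -flat_blab; exact: (valid_perm vg).
- by move=> j; rewrite mem_iota add0n -sr => /= lj; apply: (valid_block vg).
- exact: bpsi_lin.
have -> : flatten [seq b.2 | b <- bl'] = flatten [seq blab bl i | i <- S] by rewrite -map_comp.
suff -> : blms bs' bl' = lms (bar bl) (bpsi bs bl) (nth false bs) S by [].
rewrite blmsE // /lms size_map sS -[in RHS](mkseq_nth 0%N S) sS /mkseq -[RHS]map_comp.
apply/eq_in_map => j; rewrite mem_iota add0n => /= lj.
by rewrite /bar /bpsi nbl' // nbs'.
Qed.

Lemma ccphi_composable n x : composable n (ccphi n x).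
Proof.
split.
- by move=> g /negbTE v; rewrite /ccphi v.
- move=> r a c c' bl; rewrite /ccphi; 
  rewrite -[cosym_valid n (existT _ r (a *: c + c'), bl)]/(cosym_valid n (existT (fun r => C r : Type) r c', bl)).
  rewrite -[cosym_valid n (existT _ r c, bl)]/(cosym_valid n (existT (fun r => C r : Type) r c', bl)).
  case: ifP => _; last by rewrite scaler0 addr0.
  rewrite /tsum scaler_sumr -big_split; apply: eq_bigr => bs _.
  exact: sten_linl.
- by move=> *; apply: ccphi_linr.
- by move=> h *; apply: ccphi_actr.
- by move=> h *; apply: ccphi_actl.
Qed.

Lemma ccev_gen n g (x : T A) : ccev (gen (composable n) g) x = ccphi n x g.
Proof. exact: lift_gen (ccphi_composable n x). Qed.

Lemma ccev_linl n (x : T A) : linear (fun u : CC C n => ccev u x).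
Proof. exact: lift_linear (ccphi_composable n x). Qed.

Lemma ccev_linr n (u : CC C n) : linear (@ccev _ _ _ A _ u).
Proof.
move=> a x y; move: u; apply: pres_lin_ext => [||g].
- exact: ccev_linl.
- by apply: lin_add; [apply: lin_scale|]; apply: ccev_linl.
by rewrite !ccev_gen ccphi_lin.
Qed.
End Ccev.

Lemma tmap_par (K : comPzRingType) (A B : gmod K) (f : A -> B) : parited A -> parited B ->
  linear f -> parmap false f -> parmap false (tmap f).
Proof.
move=> pA pB hf ef; have lf := tmap_lin hf.
apply: (T_pure_ext pA) => [||b w hw].
- by apply: lin_comp => //; apply: par_lin (T_parited pB).
- by apply: lin_comp => //; apply: part_lin (T_parited pA) _.
rewrite (part_pure _ (pure_word pA hw)) tmap_word //.
have hw' : pures b (map f w).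
  move=> j; case: (ltnP j (size w)) => lj; last by rewrite nth_default ?size_map //; apply: pure0.
  by rewrite (nth_map 0) //; apply: (parmap_pure pA hf ef (hw j)).
have := pure_word pB hw'; rewrite size_map /pure => ->.
by case: (wpar _ _); rewrite /= ?tmap_word ?(lin0 lf).
Qed.

Section TensmMaps.
Variable K : comPzRingType.
Variables (A B D : gmod K) (pA : parited A) (pB : parited B).

Lemma tmap_tensm (f : B -> D) ms (x : T A) : linear f -> @lins _ A B ms ->
  tmap f (tensm ms x) = tensm [seq (m.1.1, (fun y => tmap f (m.1.2 y)), m.2) | m <- ms] x.
Proof.
move=> hf hms; have lf := tmap_lin hf.
have hms' : lins [seq (m.1.1, (fun y => tmap f (m.1.2 y)), m.2) | m <- ms].
  elim: ms hms => [|m ms IH] h m' //= [<-|]; first by apply: (lin_comp lf); apply: h; left.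
  by apply: IH => z hz; apply: h; right.
move: x; apply: T_ext => [||w].
- by apply: lin_comp => //; apply: tensm_lin.
- exact: tensm_lin.
rewrite !tensm_word // -map_comp; case: ifP => _; last by rewrite (lin0 lf).
elim: ms w {hms hms'} => [|[[a phi] p] ms IH] w /=; first by rewrite tmap_word.
by rewrite tmap_tmul // IH /unzip2 -map_comp.
Qed.

Lemma tensm_tmap (ka : A -> B) ms (x : T A) : linear ka -> parmap false ka -> @lins _ B D ms ->
  tensm ms (tmap ka x) = tensm [seq (m.1.1, (fun y => m.1.2 (tmap ka y)), m.2) | m <- ms] x.
Proof.
move=> hk ek hms; have lk := tmap_lin hk.
have hms' : lins [seq (m.1.1, (fun y => m.1.2 (tmap ka y)), m.2) | m <- ms].
  elim: ms hms => [|m ms IH] h m' //= [<-|]; first by apply: lin_comp lk; apply: h; left.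
  by apply: IH => z hz; apply: h; right.
move: x; apply: T_ext => [||w].
- by apply: (lin_comp (tensm_lin pB hms)).
- exact: tensm_lin.
rewrite tmap_word // !tensm_word // size_map -map_comp; case: ifP => // _.
elim: ms w {hms hms'} => [|[[a phi] p] ms IH] w //=.
rewrite -map_take -map_drop IH /unzip2 -map_comp; congr (tmul (phi _) _).
rewrite tmap_word // -!map_comp; congr word; apply: eq_map => z /=.
by rewrite (parmap_ksign _ _ pA pB hk ek) scale1r.
Qed.
End TensmMaps.

(** * The right action on C o C and naturality of its evaluation *)

Section Ccact.
Variables (K : comPzRingType) (sym : bool) (C : sseq K sym).

Definition relab (L : seq nat) (b : block C) : block C := (b.1, [seq nth 0%N L j | j <- b.2]).

Definition ccactphi n (s : 'S_n) (g : cosym C) : CC C n :=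
  if cosym_valid n g then gen (composable n) (g.1, map (relab (labels s)) g.2) else 0.

Lemma ccactphi_composable n (s : 'S_n) : composable n (ccactphi s).
Proof.
have gc := gen_composable C n; set L0 := labels s.
split.
- by move=> g /negbTE v; rewrite /ccactphi v.
- move=> r a c c' bl; rewrite /ccactphi;
  rewrite -[cosym_valid n (existT _ r (a *: c + c'), bl)]/(cosym_valid n (existT (fun r => C r : Type) r c', bl)).
  rewrite -[cosym_valid n (existT _ r c, bl)]/(cosym_valid n (existT (fun r => C r : Type) r c', bl)).
  case: ifP => _; last by rewrite scaler0 addr0.
  exact: (co_linl gc).
- move=> g l r m a c c' L; rewrite /ccactphi (valid_set _ _ _ _ _ c) (valid_set _ _ _ _ c' c).
  case: ifP => _; last by rewrite scaler0 addr0.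
  rewrite /= !map_cat /=; exact: (co_linr gc).
- move=> h g l r m c p L sL; rewrite /ccactphi valid_actr //; case: ifP => // _.
  rewrite /= !map_cat /= {1}/relab /= (co_actr gc) ?size_map //.
  congr gen; congr (_, _ ++ _ :: _); congr (_, _).
  rewrite /= -[RHS]map_comp; apply/eq_in_map => j; rewrite (perm_mem (perm_labels p)) mem_iota add0n -sL => /= lj.
  by rewrite (nth_map 0%N).
- move=> h r c p bl bs sr hb; rewrite /ccactphi valid_actl //; case: ifP => _; last by rewrite scaler0.
  have nm j : nth (block0 C) (map (relab L0) bl) j = relab L0 (nth (block0 C) bl j).
    case: (ltnP j (size bl)) => lj; first exact: nth_map.
    by rewrite !nth_default ?size_map.
  rewrite /= (co_actl gc h c p (bl := map (relab L0) bl) (bs := bs)) ?size_map //.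
    congr (_ *: gen _ (_, _)); rewrite -map_comp; exact: eq_map.
  by move=> j; rewrite nm; exact: hb.
Qed.

Lemma ccact_gen n g (s : 'S_n) : ccact (gen (composable n) g) s = ccactphi s g.
Proof. exact: lift_gen (ccactphi_composable s). Qed.

Lemma ccact_lin n (s : 'S_n) : linear (fun u : CC C n => ccact u s).
Proof. exact: lift_linear (ccactphi_composable s). Qed.

(** Relabelling the blocks composes the two permutations. This is what makes [sdelta] well defined
    on coinvariants. *)
Lemma ccev_ccact (A : gmod K) n (u : CC C n) (s : 'S_n) (x : T A) : parited A -> sym ->
  ccev (ccact u s) x = ccev u (permw (labels s) x).
Proof.
move=> pA h; move: u; apply: pres_lin_ext => [||g].
- by apply: (lin_comp (ccev_linl pA x)); exact: ccact_lin.
- exact: ccev_linl.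
rewrite ccact_gen /ccactphi ccev_gen //; case: (boolP (cosym_valid n g)) => v; last first.
  by rewrite (lin0 (ccev_linl pA x)) /ccphi (negbTE v).
have pL := valid_perm v.
rewrite ccev_gen // /ccphi v valid_sym //=.
have fl : flatten [seq b.2 | b <- map (relab (labels s)) g.2] =
          [seq nth 0%N (labels s) j | j <- flatten [seq b.2 | b <- g.2]].
  by rewrite map_flatten -!map_comp.
rewrite size_map fl (perm_iota_comp (perm_labels s) pL) andbT.
have -> : all (fun b : block C => size b.2 == tag b.1) (map (relab (labels s)) g.2).
  by case/and3P: v => _ a _; rewrite all_map; apply: sub_all a => b /=; rewrite size_map.
rewrite (valid_size v) eqxx /=; apply: eq_tsum => bs sb; rewrite /ccterm fl.
rewrite (permw_comp pA _ (perm_labels s) pL).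
suff -> : blms A bs (map (relab (labels s)) g.2) = blms A bs g.2 by [].
rewrite /blms; elim: (g.2) (bs) => [|b bl IH] [|b' bs'] //=; by rewrite IH.
Qed.

Lemma ccev_wt (A : gmod K) n (u : CC C n) (x : T A) : parited A -> ccev u (wt n x) = ccev u x.
Proof.
move=> pA; move: u; apply: pres_lin_ext => [||g]; try exact: ccev_linl.
rewrite !ccev_gen // /ccphi; case: ifP => // v; apply: eq_tsum => bs _.
by rewrite /ccterm (permw_wt pA _ (valid_perm v)).
Qed.

Lemma ccev_tmap (A B : gmod K) n (u : CC C n) (ka : A -> B) (x : T A) :
  parited A -> parited B -> linear ka -> parmap false ka ->
  ccev u (tmap ka x) = smap false (tmap (smap false (tmap ka) : schur C A -> schur C B)) (ccev u x).
Proof.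
move=> pA pB hk ek.
have tk := thickmap_tmap sym pA pB hk ek.
have lS := smap_lin (C := C) false tk; have eS := smap_par (C := C) tk pA pB.
have pSA := S_parited C pA; have pSB := S_parited C pB.
have ekT : parmap false (tmap ka).
  exact: tmap_par.
have tS := thickmap_tmap sym pSA pSB lS (eS false ekT).
move: u; apply: pres_lin_ext => [||g].
- exact: ccev_linl.
- by apply: (lin_comp (smap_lin (C := C) false tS)); exact: ccev_linl.
rewrite !ccev_gen // /ccphi; case: ifP => v; last by rewrite (lin0 (smap_lin (C := C) false tS)).
rewrite /tsum (lin_sum (smap_lin (C := C) false tS)); apply: eq_bigr => bs _.
rewrite /ccterm smap_sten //=.
suff -> : tensm (blms B bs g.2) (permw (flatten [seq b.2 | b <- g.2]) (tmap ka x)) =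
  tmap (smap false (tmap ka)) (tensm (blms A bs g.2) (permw (flatten [seq b.2 | b <- g.2]) x)) by [].
rewrite permw_tmap // tmap_tensm //; last exact: blms_lins.
rewrite (tensm_tmap pA pB) //; last exact: blms_lins.
congr tensm; rewrite /blms -!map_comp; apply: eq_map => p /=; congr (_, _, _).
by apply: funext => y; rewrite tmap_word // /= smap_sten.
Qed.
End Ccact.

(** * Cofree coalgebras *)

Section Weights.
Variables (K : comPzRingType) (sym : bool) (C : sseq K sym) (A : gmod K).
Implicit Type y : schur C A.

(** The measure for inductions on weight and the bound that truncates the series. *)
Definition wlt N y := forall m, (N <= m)%N -> swt m y = 0.

Lemma wlt_lin N a y y' : wlt N y -> wlt N y' -> wlt N (a *: y + y').
Proof. by move=> h h' m l; rewrite swt_lin h // h' // scaler0 addr0. Qed.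

Lemma wlt_le M N y : (M <= N)%N -> wlt M y -> wlt N y.
Proof. by move=> l h m l'; apply: h; apply: leq_trans l'. Qed.

Lemma wlt_sten n (c : C n) (x : T A) : wlt n.+1 (sten c x : schur C A).
Proof. by move=> m l; rewrite swt_sten; case: eqP => // e; subst m; rewrite ltnn in l. Qed.

Lemma S_decomp y : exists N, wlt N y /\ forall M, (N <= M)%N -> y = \sum_(m < M) swt m y.
Proof.
rewrite [y](pres_gen_sum y); elim: (prep y) => [|[a [n [c x]]] s [N [w IH]]].
  exists 0%N; rewrite big_nil; split=> [m _|M _]; first exact: lin0 (@swt_lin _ _ C A m).
  by rewrite big1 // => m _; exact: lin0 (@swt_lin _ _ C A m).
rewrite big_cons; exists (maxn n.+1 N); split=> [|M].
  apply: wlt_lin; last by apply: wlt_le w; exact: leq_maxr.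
  by apply: wlt_le (wlt_sten c x); exact: leq_maxl.
rewrite geq_max => /andP[l1 l2]; rewrite {1}(IH _ l2).
under [RHS]eq_bigr => m _ do rewrite (swt_lin m).
rewrite big_split /=; congr (_ + _); rewrite -scaler_sumr; congr (_ *: _).
rewrite (bigD1 (Ordinal l1)) //= -[gen _ _]/(sten c x) swt_sten eqxx big1 ?addr0 // => m nm.
by rewrite swt_sten; case: eqP => // e; case/eqP: nm; apply: val_inj.
Qed.

Lemma wlt0_eq0 y : wlt 0 y -> y = 0.
Proof.
move=> w; have [N [_ h]] := S_decomp y.
by rewrite (h N (leqnn N)) big1 // => m _; apply: w.
Qed.
End Weights.

Section Atoms.
Variables (K : comPzRingType) (sym : bool) (C : sseq K sym) (A : gmod K).
Hypothesis pA : parited A.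

Definition atom (a : nat) (z : schur C A) := exists (c : C a) (w : seq A), size w = a /\ z = sten c (word w).

(** The evaluation produces combinations of c \otimes (z_1 ... z_r) with z_j decomposable, of
    arities adding up to n. Keeping track of these arities is what permits inductions on n. *)
Lemma ccev_ext (M : lmodType K) (f g : schur C (schur C A) -> M) n (u : CC C n) (x : T A) :
  linear f -> linear g ->
  (forall r (c : C r) (zs : seq (schur C A)) (az : nat -> nat), size zs = r ->
     (forall j, (j < r)%N -> atom (az j) (nth 0 zs j)) -> (\sum_(j < r) az j)%N = n ->
     f (sten c (word zs)) = g (sten c (word zs))) ->
  f (ccev u x) = g (ccev u x).
Proof.
move=> hf hg e; move: u; apply: pres_lin_ext => [||g0].
- exact: (lin_comp hf (ccev_linl pA x)).
- exact: (lin_comp hg (ccev_linl pA x)).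
rewrite ccev_gen // /ccphi; case: ifP => v; last by rewrite (lin0 hf) (lin0 hg).
rewrite /tsum (lin_sum hf) (lin_sum hg); apply: eq_bigr => bs0 _.
set bs := tval bs0; have sb : size bs = size g0.2 by apply: size_tuple.
move: x; apply: (T_lab_ext pA) => [||b W m hW].
- by apply: (lin_comp hf); exact: ccterm_linr.
- by apply: (lin_comp hg); exact: ccterm_linr.
have pL := valid_perm v.
case: (altP (m =P n)) => [->|ne]; last first.
  have l := ccterm_linr pA (tagged g0.1) bs g0.2.
  suff -> : ccterm (tagged g0.1) bs g0.2 (word [seq W i | i <- iota 0 m]) = 0 by rewrite (lin0 hf) (lin0 hg).
  rewrite /ccterm (permw_other pA pL) ?size_map ?size_iota //.
  by rewrite (lin0 (tensm_lin pA (@blms_lins _ _ _ _ _ _))) sten0r.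
have hs : {in iota 0 (size g0.2), forall j, size (blab g0.2 j) = bar g0.2 j}.
  by move=> j; rewrite mem_iota add0n => /= lj; apply: (valid_block v).
rewrite /ccterm (permw_iota_lab pA hW pL) (linZ (tensm_lin pA (@blms_lins _ _ _ _ _ _))) flat_blab.
rewrite blmsE // (tensm_lab pA _ (bpsi_lin _ _) hW hs) scalerA stenZr (linZ hf) (linZ hg).
congr (_ *: _).
have sz := valid_size v.
apply: (e _ _ _ (bar g0.2)); first by rewrite size_map size_iota.
  move=> j; rewrite -sz => lj; rewrite (nth_map 0%N) ?size_iota // nth_iota // add0n.
  exists (part (nth false bs j) (tagged (nth (block0 C) g0.2 j).1)), (map W (blab g0.2 j)).
  by rewrite size_map (valid_block v).
rewrite -sz -(big_mkord predT (bar g0.2)) /index_iota subn0.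
have := perm_size pL; rewrite size_iota => <-.
rewrite flat_blab size_flatten /shape -map_comp sumnE big_map.
by apply: eq_big_seq => j /hs /= ->.
Qed.
End Atoms.

(** * Counit and coproduct of C[A], for structure maps not yet known to form a cooperad *)

Section RawCoalgebra.
Variables (K : comPzRingType) (sym : bool) (C : sseq K sym) (A : gmod K).
Hypothesis pA : parited A.

Section Counit.
Variable cu : {linear C 1%N -> K^o}.
Local Notation eps := (@scounit _ _ _ cu A).

Definition epsphi (n : nat) : C n -> T A -> A :=
    match n return C n -> T A -> A with
    | 1%N => fun c x => cu c *: letter x
    | _ => fun _ _ => 0
    end.

Lemma epsphi_bal : sbal epsphi.
Proof.
apply: sbal_intro => [[|[|n]] x|[|[|n]] c|[|[|n]] c x|_ [|[|n]] c s x] //=; try exact: lin_zero.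
- by move=> a c c'; rewrite linearP scalerDl -scalerA.
- by apply: lin_scale; exact: letter_lin.
- congr (_ *: _); move: x; apply: T_ext => [||w].
  + by apply: lin_comp; [exact: letter_lin|exact: wt_lin].
  + exact: letter_lin.
  rewrite wt_word letter_word; case: w => [|v [|v' w]] /=; rewrite ?letter_word //; exact: lin0 (@letter_lin _ A).
have -> : s = 1%g by apply/permP => i; rewrite [LHS]ord1 [RHS]ord1.
rewrite act_1 labels1 permw_iota //; congr (_ *: _); move: x; apply: T_ext => [||w].
- exact: letter_lin.
- by apply: lin_comp; [exact: letter_lin|exact: wt_lin].
by rewrite wt_word letter_word; case: w => [|v [|v' w]] /=; rewrite ?letter_word // (lin0 (@letter_lin _ A)).
Qed.

Lemma scounit_lin : linear (eps : schur C A -> A).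
Proof. exact: slift_lin epsphi_bal. Qed.
Lemma scounit1 (c : C 1%N) (x : T A) : eps (sten c x) = cu c *: letter x.
Proof. exact: (slift_sten epsphi_bal (n := 1%N)). Qed.
Lemma scounit_other n (c : C n) (x : T A) : n != 1%N -> eps (sten c x) = 0.
Proof. by move=> ne; rewrite [LHS](slift_sten epsphi_bal); case: n c ne => [|[|n]]. Qed.

Hypothesis cu_odd : forall c, cu (goddp c) = 0.

Lemma scounit_par : parmap false (eps : schur C A -> A).
Proof.
have pS := S_parited C pA.
apply: (S_pure_ext pA) => [||n b c b' x hc hx].
- by apply: lin_comp; [exact: par_lin pA|exact: scounit_lin].
- by apply: lin_comp; [exact: scounit_lin|exact: part_lin pS _].
rewrite (part_pure _ (pure_sten pA hc hx)).
case: (altP (n =P 1%N)) => [e|ne]; last first.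
  by rewrite scounit_other // (lin0 (par_lin pA)); case: ifP => _; rewrite ?(lin0 scounit_lin) ?scounit_other.
subst n; have pl := parmap_pure (T_parited pA) (@letter_lin _ A) (letter_par pA) hx.
rewrite scounit1 (linZ (par_lin pA)) pl.
case: b hc => hc; last by case: b' {hx pl} => /=; rewrite ?scounit1 ?scaler0 ?(lin0 scounit_lin).
have -> : cu c = 0 by rewrite -hc cu_odd.
by rewrite scale0r; case: ifP => _; rewrite ?scounit1 ?(lin0 scounit_lin) // -hc cu_odd scale0r.
Qed.

End Counit.

Section Coproduct.
Variable dl : forall n, {linear C n -> CC C n}.
Hypothesis dl_act : sym -> forall n (c : C n) (s : 'S_n), dl n (act c s) = ccact (dl n c) s.

Lemma sdelta_bal : sbal (fun n (c : C n) (x : T A) => ccev (dl n c) x).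
Proof.
apply: sbal_intro => [n x|n c|n c x|h n c s x].
- exact: (lin_comp (ccev_linl pA x) (linearP (dl n))).
- exact: ccev_linr.
- by rewrite ccev_wt.
- by rewrite dl_act // ccev_ccact.
Qed.

Lemma sdelta_lin : linear (@sdelta _ _ C dl A : schur C A -> schur C (schur C A)).
Proof. exact: slift_lin sdelta_bal. Qed.
Lemma sdelta_sten n (c : C n) (x : T A) : @sdelta _ _ C dl A (sten c x) = ccev (dl n c) x.
Proof. exact: (slift_sten sdelta_bal). Qed.
End Coproduct.
End RawCoalgebra.

Section Coalgebra.
Variables (K : comPzRingType) (sym : bool) (C : cooperad K sym).
Local Notation Delta := (@sdelta _ _ _ (delta C) _).
Local Notation eps := (@scounit _ _ _ (counit C) _).

Section OneModule.
Variable (A : gmod K).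
Hypothesis pA : parited A.

Lemma eps_lin : linear (eps : schur C A -> A).
Proof. exact: scounit_lin. Qed.
Lemma eps1 (c : C 1%N) (x : T A) : eps (sten c x) = counit C c *: letter x.
Proof. exact: scounit1. Qed.
Lemma eps_other n (c : C n) (x : T A) : n != 1%N -> eps (sten c x) = 0.
Proof. exact: scounit_other. Qed.

Lemma counit_odd (c : C 1%N) : counit C (goddp c) = 0.
Proof.
have p := C_parited C 1; move: c; apply: (hom_ext p) => [||i c hc].
- by apply: (lin_comp (linearP (counit C))); exact: par_lin p.
- by move=> a x y; rewrite scaler0 addr0.
rewrite (par_hom p hc); case: ifP => [o|_]; last exact: linear0.
by apply: (counit_homog hc); apply: contraTneq o => ->.
Qed.

Lemma eps_par : parmap false (eps : schur C A -> A).
Proof. exact: scounit_par counit_odd. Qed.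

Lemma Delta_lin : linear (Delta : schur C A -> schur C (schur C A)).
Proof. exact: sdelta_lin (@delta_act _ _ C). Qed.
Lemma Delta_sten n (c : C n) (x : T A) : Delta (sten c x) = ccev (delta C n c) x.
Proof. exact: (sdelta_sten pA (@delta_act _ _ C)). Qed.
End OneModule.

Lemma Delta_nat (A B : gmod K) (ka : A -> B) (y : schur C A) : parited A -> parited B ->
  linear ka -> parmap false ka ->
  Delta (smap false (tmap ka) y) = smap false (tmap (smap false (tmap ka))) (Delta y).
Proof.
move=> pA pB hk ek.
have tk := thickmap_tmap sym pA pB hk ek; have lk := smap_lin (C := C) false tk.
have ekS := smap_par (C := C) tk pA pB (tmap_par pA pB hk ek).
have tk' := thickmap_tmap sym (S_parited C pA) (S_parited C pB) lk ekS.
move: y; apply: S_ext => [||n c w _].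
- by apply: (lin_comp (Delta_lin pB)).
- by apply: (lin_comp (smap_lin (C := C) false tk')); exact: Delta_lin.
by rewrite smap_sten // !Delta_sten // -ccev_tmap.
Qed.

Section Connected.
Variables (one : C 1%N) (hone : connected one) (A : gmod K).
Hypothesis pA : parited A.

Lemma one_pure : pure false one.
Proof.
have [_ _ h] := hone; rewrite /pure (h (goddp one)) (_ : (counit C (goddp one) : K) = 0) ?scale0r //.
exact: counit_odd.
Qed.

Lemma swt0 (y : schur C A) : swt 0 y = 0.
Proof.
have [h _ _] := hone; move: y; apply: S_ext => [||n c w _].
- exact: swt_lin.
- by move=> a u v; rewrite scaler0 addr0.
by rewrite swt_sten; case: eqP => // e; subst n; rewrite (h c) sten0l.
Qed.

(** C(1) is spanned by [one], so the weight 1 part is a copy of A, which the counit reads off. *)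
Lemma swt1 (y : schur C A) : swt 1 y = sten one (word [:: eps y]).
Proof.
have [_ h1 h] := hone; move: y; apply: S_ext => [||n c w sw].
- exact: swt_lin.
- apply: (lin_comp (@sten_linr _ _ C A _ one)); apply: (lin_comp (@word1_lin _ A)); exact: eps_lin.
rewrite swt_sten; case: (altP (n =P 1%N)) => [e|ne]; last first.
  by rewrite eps_other // (lin0 (@word1_lin _ A)) sten0r.
move: c sw; rewrite e => c; case: w => [|v [|v' w]] // _; rewrite eps1 // letter_word.
by rewrite (linZ (@word1_lin _ A)) stenZr -stenZl -h.
Qed.
End Connected.
End Coalgebra.

(** * Pseudo-derivations *)

(** Identities in abelian groups by reflection: both sides are quoted over a common list of atoms
    and their integer coefficients compared. *)
Inductive zexp := ZVar of nat | ZAdd of zexp & zexp | ZOpp of zexp | ZZero.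

Fixpoint zeval (V : zmodType) (env : seq V) (e : zexp) : V :=
  match e with
  | ZVar i => nth 0 env i
  | ZAdd e1 e2 => zeval env e1 + zeval env e2
  | ZOpp e1 => - zeval env e1
  | ZZero => 0
  end.

Fixpoint zcoef (e : zexp) (i : nat) : int :=
  match e with
  | ZVar j => if i == j then 1 else 0
  | ZAdd e1 e2 => zcoef e1 i + zcoef e2 i
  | ZOpp e1 => - zcoef e1 i
  | ZZero => 0
  end.

Lemma zevalE (V : zmodType) (env : seq V) e :
  zeval env e = \sum_(i < size env) nth 0 env i *~ zcoef e i.
Proof.
elim: e => [j|e1 IH1 e2 IH2|e1 IH|] /=.
- case: (ltnP j (size env)) => l.
    rewrite (bigD1 (Ordinal l)) //= eqxx mulr1z big1 ?addr0 // => i ni.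
    by case: eqP => [e|]; rewrite ?mulr0z //; case/eqP: ni; apply: val_inj.
  rewrite nth_default // big1 // => i _; case: eqP => [e|]; rewrite ?mulr0z //.
  by move: (ltn_ord i); rewrite e ltnNge l.
- by rewrite IH1 IH2 -big_split; apply: eq_bigr => i _; rewrite mulrzDr.
- by rewrite IH -sumrN; apply: eq_bigr => i _; rewrite mulrNz.
- by rewrite big1 // => i _; rewrite mulr0z.
Qed.

Lemma zeval_eq (V : zmodType) (env : seq V) e1 e2 :
  all (fun i => zcoef e1 i == zcoef e2 i) (iota 0 (size env)) -> zeval env e1 = zeval env e2.
Proof.
move=> /allP h; rewrite !zevalE; apply: eq_bigr => i _; congr (_ *~ _).
by apply/eqP; apply: h; rewrite mem_iota /=.
Qed.

Ltac zlookup x env :=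
  match env with
  | x :: _ => constr:(0%N)
  | _ :: ?env' => let n := zlookup x env' in constr:(n.+1)
  end.
Ltac zinsert x env :=
  match env with
  | nil => constr:(x :: env)
  | x :: _ => env
  | ?y :: ?env' => let r := zinsert x env' in constr:(y :: r)
  end.
Ltac zatoms e env :=
  match e with
  | (?a + ?b)%R => let env1 := zatoms a env in zatoms b env1
  | (- ?a)%R => zatoms a env
  | 0%R => env
  | _ => zinsert e env
  end.
Ltac zquote e env :=
  match e with
  | (?a + ?b)%R => let a' := zquote a env in let b' := zquote b env in constr:(ZAdd a' b')
  | (- ?a)%R => let a' := zquote a env in constr:(ZOpp a')
  | 0%R => constr:(ZZero)
  | _ => let n := zlookup e env in constr:(ZVar n)
  end.
Ltac abel :=
  match goal with
  | |- @eq ?V ?l ?r =>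
    let env0 := zatoms l (@nil V) in
    let env := zatoms r env0 in
    let l' := zquote l env in
    let r' := zquote r env in
    apply: (@zeval_eq _ env l' r' isT)
  end.

Section PseudoDerivation.
Variables (K : comPzRingType) (sym : bool) (A B : chain K).
Variables (f : {linear A -> B}) (g : {linear B -> A}) (h : {linear A -> A}) (hh : {linear T A -> T A}).
Hypotheses (hc : contraction f g h) (ht : thick_homotopy sym f g h hh).

Lemma chain_parited (X : chain K) : parited X.
Proof. by apply: graded_parited; apply: chain_graded. Qed.

Let pA := chain_parited A.
Let pB := chain_parited B.
Let pTA := T_parited pA.
Let lh : linear hh := linearP hh.
Let lf : linear f := linearP f.
Let lg : linear g := linearP g.

Lemma hom0_par (X Y : gmod K) (phi : X -> Y) : parited X -> parited Y -> linear phi ->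
  (forall i x, homog i x -> homog i (phi x)) -> parmap false phi.
Proof.
by move=> pX pY l hp; apply: (@parmap_homog _ _ _ 0 _ pX pY l) => i x /hp; rewrite addr0.
Qed.

Lemma f_par : parmap false f.
Proof. exact: (hom0_par pA pB lf (ctr_f_hom hc)). Qed.
Lemma g_par : parmap false g.
Proof. exact: (hom0_par pB pA lg (ctr_g_hom hc)). Qed.
Lemma hh_par : parmap true hh.
Proof. exact: (@parmap_homog _ _ _ 1 _ pTA pTA lh (th_hom ht)). Qed.

Local Notation "a ** b" := (tmul a b) (at level 40, left associativity).
Local Notation k := (ksign true).

Lemma ttens_word (X Y : gmod K) (pX : parited X) p q (phi psi : T X -> T Y) b b' (u v : seq X) :
  linear phi -> linear psi -> size u = p -> size v = q ->
  ttens p q phi b psi b' (word (u ++ v)) = phi (ksign b' (word u : T X)) ** psi (word v).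
Proof.
move=> hp hs su sv; rewrite /ttens tensm_word //; last first.
  by move=> m /= [<-|[<-|//]].
rewrite /= addn0 size_cat su sv eqxx take_size_cat // drop_size_cat // take_oversize ?sv //.
rewrite (ksign_word pX) tmul1r addn0 oddb.
by rewrite map_id.
Qed.

(** The second pseudo-derivation identity for all p and q at once; [k] is the sign of h passing the
    first factor. *)
Lemma pd (a b : T A) : hh (hh a ** b - k a ** hh b) = - (hh (k a) ** hh b).
Proof.
have lk := ksign_lin pTA true.
move: a b; apply: T_ext2 => [b|b|a|a|u v].
- apply: (lin_comp lh); apply: lin_sub; first exact: (lin_comp (tmul_linl b) lh).
  exact: (lin_comp (tmul_linl _) lk).
- by apply: lin_opp; apply: (lin_comp (tmul_linl _)); exact: (lin_comp lh lk).
- apply: (lin_comp lh); apply: lin_sub; first exact: tmul_linr.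
  exact: (lin_comp (tmul_linr _) lh).
- by apply: lin_opp; exact: (lin_comp (tmul_linr _) lh).
have := (th_pder ht (size u) (size v) (word (u ++ v))).2.
rewrite !(ttens_word pA) //.
Qed.

Local Notation d := (tder (diff A)).
Local Notation P x := (tmap g (tmap f x)).

Lemma diff_par (X : chain K) : parmap true (diff X).
Proof.
apply: (@parmap_homog _ _ _ (-1) _ (chain_parited X) (chain_parited X) (linearP (diff X))).
exact: diff_hom.
Qed.

Lemma id_par (X : gmod K) : parmap false (@id X).
Proof. by []. Qed.

Lemma d_lin : linear d.
Proof.
move=> a x y; rewrite !(tder_tder2 pA (linearP (diff A))).
exact: (tder2_lin pA (@lin_id _ _) (linearP (diff A))).
Qed.

Lemma tmap_id (X : gmod K) (x : T X) : tmap id x = x.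
Proof.
move: x; apply: T_ext => [||w]; [exact: (tmap_lin (@lin_id _ _))|exact: lin_id|].
by rewrite tmap_word // map_id.
Qed.

Lemma d_tmul (x y : T A) : d (x ** y) = d x ** y + k x ** d y.
Proof.
rewrite !(tder_tder2 pA (linearP (diff A))).
rewrite (tder2_tmul _ _ pA pA (@lin_id _ _) (linearP (diff A)) (@id_par A)).
by rewrite !tmap_id.
Qed.

Lemma ksign_tder2 (X Y : gmod K) (al be : X -> Y) x : parited X -> parited Y ->
  linear al -> linear be -> parmap false al -> parmap true be ->
  k (tder2 al be x) = - tder2 al be (k x).
Proof.
move=> pX pY ha hb ea ob; have ld := tder2_lin pY ha hb.
have lkX := ksign_lin (T_parited pX) true; have lkY := ksign_lin (T_parited pY) true.
move: x; apply: T_ext => [||w].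
- exact: (lin_comp lkY ld).
- by apply: lin_opp; exact: (lin_comp ld lkX).
rewrite (ksign_word pX) !tder2_word //; elim: w => [|x w IH] /=.
  by rewrite (lin0 lkY) oppr0.
have kb y : k (be y) = - be (k y) by rewrite (parmap_ksign _ _ pX pY hb ob) expr1 scaleN1r.
have ka y : k (al y) = al (k y) by rewrite (parmap_ksign _ _ pX pY ha ea) scale1r.
rewrite (linD lkY) (ksign_tmul pY) IH !(ksign_word pY) /= kb -map_comp.
have -> : word (- be (k x) :: map (k \o al) w) = - word (be (k x) :: map al (map k w)) :> T Y.
  rewrite -scaleN1r [LHS]word_cons (linZ (@word1_lin _ Y)) tmulZl tmul_word scaleN1r -map_comp.
  by congr (- word (_ :: _)); apply: eq_map => y /=; rewrite ka.
by rewrite tmulNr -opprD !ka.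
Qed.

Lemma ksign_d x : k (d x) = - d (k x).
Proof.
rewrite !(tder_tder2 pA (linearP (diff A))).
apply: (ksign_tder2 x pA pA) => //; [exact: linearP|exact: diff_par].
Qed.

Lemma ksign_hh x : k (hh x) = - hh (k x).
Proof. by rewrite (parmap_ksign _ _ pTA pTA lh hh_par) expr1 scaleN1r. Qed.

Lemma kk (x : T A) : k (k x) = x.
Proof. exact: (ksignK pTA true x). Qed.

Lemma P_tmul x y : P (x ** y) = P x ** P y.
Proof. by rewrite !tmap_tmul. Qed.

Lemma Pg y : P (tmap g y) = tmap g y.
Proof.
congr tmap; rewrite tmap_comp // -[RHS]tmap_id; apply: eq_tmap; first exact: lin_comp lf lg.
exact: (ctr_fg hc).
Qed.

Lemma ksign_tmap (X Y : gmod K) (al : X -> Y) x : parited X -> parited Y -> linear al ->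
  parmap false al -> k (tmap al x) = tmap al (k x).
Proof.
move=> pX pY ha ea; have la := tmap_lin ha.
by rewrite (parmap_ksign _ _ (T_parited pX) (T_parited pY) la (tmap_par pX pY ha ea)) scale1r.
Qed.

Lemma d_hh x : d (hh x) = P x - x - hh (d x).
Proof. by rewrite -(th_diff ht) addrK. Qed.

(* [k a] is generalized, lest [tmulBl] and [linB] unfold it as a difference. *)
Lemma hh_P_diff a b : hh (P a ** b) - hh (a ** P b) = P (k a) ** hh b - hh a ** P b.
Proof.
have lP : linear (fun x : T A => P x) by apply: lin_comp (tmap_lin lg) (tmap_lin lf).
(* The relation dh + hd = gf - 1 is applied to the bracket of [pd]. There gf vanishes as fh = 0, the
   terms with d a or d b are further instances of [pd], and what survives are the gf created by d h
   inside the bracket. *)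
have E := th_diff ht (hh a ** b - k a ** hh b).
rewrite pd (linN d_lin) (linB d_lin) !d_tmul !d_hh !ksign_hh !kk in E.
have p1 := pd (d a) b; have p2 := pd (k a) (d b).
rewrite ksign_d tmulNl opprK (linN lh) tmulNl opprK in p1.
rewrite !kk in p2.
move: (k a) E p1 p2 => ka.
rewrite (linB lP) !P_tmul !(th_fh ht) (lin0 (tmap_lin lg)) tmul0l tmul0r subrr.
rewrite !(tmulBl, tmulBr, tmulNl, tmulNr) !(linD lh) !(linN lh) !(linD lh) !(linN lh) => E p1 p2.
have {}p1 : hh (hh (d a) ** b) = hh (d ka) ** hh b - hh (d ka ** hh b).
  by rewrite -p1; abel.
have {}p2 : hh (hh ka ** d b) = hh (a ** hh (d b)) - hh a ** hh (d b).
  by rewrite -[- (hh a ** _)]p2; abel.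
rewrite p1 p2 in E.
move/eqP: E; rewrite -subr_eq0 => /eqP E.
by apply/eqP; rewrite -subr_eq0 -E; apply/eqP; abel.
Qed.

(** [hh_P_diff] with second factor gy, which gf fixes. Moreover h kills gy and the product of gf(a)
    with gy, both being in the image of g. *)
Lemma hh_tmul_g a y : hh (a ** tmap g y) = hh a ** tmap g y.
Proof.
have := hh_P_diff a (tmap g y); rewrite Pg (th_hg ht) tmul0r -tmap_tmul // (th_hg ht).
by rewrite !sub0r => /oppr_inj.
Qed.

Lemma hh_g_tmul y b : hh (tmap g y ** b) = tmap g (k y) ** hh b.
Proof.
have := hh_P_diff (tmap g y) b; rewrite Pg (th_hg ht) tmul0l -tmap_tmul // (th_hg ht).
by rewrite !subr0 (ksign_tmap _ pB pA lg g_par) Pg.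
Qed.

(** Write D for the derivation. By the Leibniz rule D(xw) = D(x) ka(w) + ka(kx) D(w), and
    inductively ka = hD + ge on each factor. Then h of this is hD(x) hD(w) + hD(x) ge(w) + ge(x)
    hD(w), by [pd] for the first product and g-linearity for the others. That is ka(x) ka(w) - ge(x)
    ge(w). *)
Lemma hh_tder2 (X : gmod K) (e : X -> B) (u ka : X -> A) z : parited X ->
  linear e -> linear u -> linear ka -> parmap false e -> parmap true u -> parmap false ka ->
  (forall x, ka x = g (e x) + h (u x)) ->
  hh (tder2 ka u z) = tmap ka z - tmap (fun x => g (e x)) z.
Proof.
move=> pX he hu hk ee ou ek E.
have ld := tder2_lin pA hk hu; have lk := tmap_lin hk; have hge := lin_comp lg he.
move: z; apply: T_ext => [||w]; first exact: (lin_comp lh ld).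
  by apply: lin_sub => //; exact: tmap_lin hge.
elim: w => [|x w IH]; first by rewrite tder2_word // !tmap_word // subrr (lin0 lh).
have D1 y : tder2 ka u (word [:: y]) = word [:: u y].
  by rewrite tder2_word //= tmul0r addr0.
have kx (y : X) : k (word [:: y] : T X) = word [:: k y] by rewrite (ksign_word pX).
have gE y : tmap (fun x => g (e x)) y = tmap g (tmap e y) by rewrite tmap_comp.
have hD1 y : hh (tder2 ka u (word [:: y])) = tmap ka (word [:: y]) - tmap g (tmap e (word [:: y])).
  by rewrite D1 -gE (th_1 ht) !tmap_word //= E (linD (@word1_lin _ A)) addrC addKr.
rewrite word_cons (tder2_tmul _ _ pX pA hk hu ek) !tmap_tmul // !gE in IH *.
set x1 : T X := word [:: x].
have q1 : tmap ka (word w) = hh (tder2 ka u (word w)) + tmap g (tmap e (word w)) by rewrite IH subrK.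
have q2 : tmap ka (k x1) = hh (tder2 ka u (k x1)) + tmap g (tmap e (k x1)).
  by rewrite /x1 kx hD1 subrK.
have q3 : tmap ka x1 = hh (tder2 ka u x1) + tmap g (tmap e x1) by rewrite hD1 subrK.
(* One instance of [pd] covers both products without a factor in the image of g; its first argument
   is twisted by [k] because D is odd. *)
have p := pd (tder2 ka u (k x1)) (tder2 ka u (word w)).
have kD := ksign_tder2 (k x1) pX pA hk hu ek ou.
rewrite (ksignK (T_parited pX)) in kD.
rewrite kD !tmulNl opprK (linN lh) tmulNl opprK (linD lh) in p.
rewrite q1 q2 tmulDr tmulDl !(linD lh) hh_tmul_g hh_g_tmul -(ksign_tmap _ pX pB he ee).
rewrite (ksignK (T_parited pB)) q3 !tmulDl !tmulDr.
by rewrite -p; abel.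
Qed.
End PseudoDerivation.

(** * Parity of the coproduct of C[A] *)

Section DeltaParity.
Variables (K : comPzRingType) (sym : bool).

Lemma pure_lab (X : gmod K) (pX : parited X) (b : nat -> bool) (W : nat -> X) L :
  (forall j, pure (b j) (W j)) -> pure (\big[addb/false]_(j <- L) b j) (word (map W L) : T X).
Proof.
move=> hW; have := pure_word pX (pures_lab pX hW L).
by rewrite /wpar size_map -(big_map (nth 0%N L) predT b) map_nth_iota0 ?take_size.
Qed.

Lemma tensm_par (X Y : gmod K) (pX : parited X) (pY : parited Y) a (psi : nat -> T X -> Y) p Ls r n d x :
  (forall j, linear (psi j)) -> (forall j, parmap (p j) (psi j)) ->
  {in iota 0 r, forall j, size (Ls j) = a j} ->
  perm_eq (flatten (map Ls (iota 0 r))) (iota 0 n) -> pure d x ->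
  pure (\big[addb/false]_(j <- iota 0 r) p j (+) d)
    (tensm (lms a psi p (iota 0 r)) (permw (flatten (map Ls (iota 0 r))) x)).
Proof.
move=> hpsi ppsi hs pL hx.
have pT := T_parited pX; have pTY := T_parited pY.
set q := \big[addb/false]_(j <- iota 0 r) p j; set J := iota 0 r.
pose Phi x := tensm (lms a psi p J) (permw (flatten (map Ls J)) x).
have lPhi : linear Phi.
  exact: (lin_comp (tensm_lin pX (@lms_lins _ _ _ a _ p hpsi J)) (permw_lin pX _)).
apply: (parmap_pure pT lPhi _ hx) => {x hx}.
apply: (T_lab_ext pX) => [||b W m hW].
- exact: (lin_comp (par_lin pTY) lPhi).
- exact: (lin_comp lPhi (part_lin pT _)).
rewrite (part_pure _ (pure_lab pX (iota 0 m) hW)).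
case: (altP (m =P n)) => [->|ne]; last first.
  have -> : Phi (word [seq W i | i <- iota 0 m]) = 0.
    by rewrite /Phi (permw_other pX pL) ?size_map ?size_iota // lin0 //; apply: tensm_lin => //; apply: lms_lins.
  rewrite (lin0 (par_lin pTY)); case: ifP => _; last by rewrite (lin0 lPhi).
  by rewrite /Phi (permw_other pX pL) ?size_map ?size_iota // lin0 //; apply: tensm_lin => //; apply: lms_lins.
set w := word _.
suff : pure (q (+) \big[addb/false]_(j <- iota 0 n) b j) (Phi w).
  rewrite /pure => ->; case: q => /=; case: (\big[addb/false]_(_ <- _) _) => //=; by rewrite (lin0 lPhi).
rewrite /Phi (permw_iota_lab pX hW pL) (linZ (tensm_lin pX (@lms_lins _ _ _ a _ p hpsi J))).
rewrite (tensm_lab pX _ hpsi hW) //; apply: (pureZ pTY); apply: (pureZ pTY).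
have hZ j : pure (p j (+) blockpar b Ls j) (psi j (word (map W (Ls j)))).
  by apply: (parmap_pure pT) => //; exact: pure_lab.
have := pure_lab pY J hZ; rewrite big_split /=.
suff -> : \big[addb/false]_(i <- J) blockpar b Ls i = \big[addb/false]_(j <- iota 0 n) b j by [].
by rewrite -(perm_big _ pL) /= big_flatten big_map.
Qed.

Variable C : cooperad K sym.
Local Notation Delta := (@sdelta _ _ _ (delta C) _).

Lemma ccev_pure (A : gmod K) (pA : parited A) n i (u : CC C n) d (x : T A) :
  cchomog i u -> pure d x -> pure (isodd i (+) d) (ccev u x).
Proof.
move=> hu hx; have pS := S_parited C (S_parited C pA).
elim: hu => [|a u1 u2 hu1 _ IH]; first by rewrite (lin0 (ccev_linl pA x)); apply: pure0.
rewrite (ccev_linl pA); apply: (pureD pS) => //; apply: (pureZ pS) => {IH u2}.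
case: hu1 => r [c [p [bl [hc hbl <- ->]]]].
rewrite ccev_gen //; set g := (existT _ _ _, _).
pose bs := [seq isodd b.1 | b <- bl].
have sbs : size bs = size g.2 by rewrite !size_map.
have hbs : bpure bs g.2.
  rewrite {sbs}/bs /g /= {g bs}; elim: hbl => [|b bl' hb _ IH] j.
    by rewrite !nth_nil; exact: pure0 (C_parited C 0) _.
  by case: j => [|j] /=; [apply: (hom_pure (C_parited C (tag b.2.1)) hb)|apply: IH].
rewrite (@ccphi_pure K sym C A pA n x g bs) //; case: ifP => v; last exact: pure0.
rewrite /ccterm isoddD -addbA; apply: (pure_sten (S_parited C pA)).
  exact: (hom_pure (C_parited C r) hc).
rewrite flat_blab blmsE //.
have -> : isodd (\sum_(b <- bl) b.1) = \big[addb/false]_(j <- iota 0 (size g.2)) nth false bs j.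
  rewrite -sbs -(big_map (nth false bs) predT id) -/(mkseq _ _) mkseq_nth /bs big_map.
  by elim: (bl) => [|b bl' IH]; rewrite ?big_nil // !big_cons isoddD IH.
apply: (tensm_par pA (S_parited C pA) (n := n)) => //.
- by move=> j; exact: bpsi_lin.
- by move=> j; apply: (sten_par pA); apply: pure_part (C_parited C _) _ _.
- by move=> j; rewrite mem_iota add0n => /= lj; apply: (valid_block v).
- by rewrite -flat_blab; apply: (valid_perm v).
Qed.

(** The cooperad axioms give the degree of the coproduct on the C(n) only; on C[A] it is read off
    from the evaluation of homogeneous symbols. *)
Lemma Delta_par (A : gmod K) : parited A -> parmap false (Delta : schur C A -> schur C (schur C A)).
Proof.
move=> pA; have pS := S_parited C pA; have pSS := S_parited C pS.
have lD := Delta_lin (C := C) pA.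
apply: S_ext => [||n c w _].
- exact: (lin_comp (par_lin pSS) lD).
- exact: (lin_comp lD (part_lin pS _)).
move: (word w) => x {w}; move: c; apply: (hom_ext (C_parited C n)) => [||i c hc].
- exact: (lin_comp (par_lin pSS) (lin_comp lD (@sten_linl _ _ C A n x))).
- exact: (lin_comp lD (lin_comp (part_lin pS _) (@sten_linl _ _ C A n x))).
move: x; apply: (pure_ext (T_parited pA)) => [||d x hx].
- exact: (lin_comp (par_lin pSS) (lin_comp lD (@sten_linr _ _ C A n c))).
- exact: (lin_comp lD (lin_comp (part_lin pS _) (@sten_linr _ _ C A n c))).
have hcp := hom_pure (C_parited C n) hc.
rewrite (part_pure _ (pure_sten pA hcp hx)) Delta_sten //.
rewrite (ccev_pure pA (delta_homog hc) hx).
by case: (_ (+) _); rewrite /= ?Delta_sten ?(lin0 lD).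
Qed.
End DeltaParity.

(** * The series *)

Lemma parmap_comp0 (K : comPzRingType) (X Y Z : gmod K) b (phi : X -> Y) (psi : Y -> Z) :
  parmap false psi -> parmap b phi -> parmap b (fun x => psi (phi x)).
Proof. by move=> e p x; rewrite e -[part _ _]/(goddp (phi x)) p. Qed.

Section Series.
Variables (K : comPzRingType) (sym : bool) (C : sseq K sym) (A : gmod K).

Lemma wlt_sum N (y : schur C A) : wlt N y -> y = \sum_(m < N) swt m y.
Proof.
move=> w; have [M [_ h]] := S_decomp y.
rewrite {1}(h _ (leq_maxl M N)) -(big_mkord predT (fun m => swt m y)).
have z : \sum_(N <= i < maxn M N) swt i y = 0.
  by rewrite big_nat_cond big1 // => m /andP[/andP[l _] _]; apply: w.
by rewrite (big_cat_nat (n := N)) ?leq_maxr //= z addr0 big_mkord.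
Qed.

Lemma fsum_ord (M : zmodType) N (u : nat -> M) : (forall m, (N <= m)%N -> u m = 0) ->
  \sum_(m \in [set: nat]) u m = \sum_(m < N) u m.
Proof.
move=> z; rewrite fsbig_ord; apply/esym/fsbig_widen => // m [_ /= n].
by apply: z; rewrite leqNgt; apply/negP.
Qed.

Section Iter.
Variables (M : lmodType K) (P : schur C A -> M) (N : schur C A -> schur C A).
Hypotheses (lP : linear P) (lN : linear N).
Hypothesis low : forall n y, wlt n.+1 y -> wlt n (N y).

Lemma iter_lin m : linear (iter m N).
Proof. by elim: m => [|m IH] //=; exact: lin_comp lN IH. Qed.

(** Each application of N lowers the weight bound by one, whence the finiteness of all the
    series. *)
Lemma iter_low n y m : wlt n y -> (n <= m)%N -> iter m N y = 0.
Proof.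
elim: n y m => [|n IH] y m w l.
  by rewrite (wlt0_eq0 w) (lin0 (iter_lin m)).
by case: m l => // m l; rewrite iterSr; apply: IH => //; apply: low.
Qed.

(** The common shape of the four series: P is F or H with N = tH, and P is the identity or Ft with N
    = Ht, evaluated at G y. *)
Definition ser (y : schur C A) : M := \sum_(m \in [set: nat]) P (iter m N y).

Lemma ser_ord n y : wlt n y -> ser y = \sum_(m < n) P (iter m N y).
Proof. by move=> w; apply: fsum_ord => m l; rewrite (iter_low w l) (lin0 lP). Qed.

Lemma ser_lin : linear ser.
Proof.
move=> a x y; have [n [wx _]] := S_decomp x; have [n' [wy _]] := S_decomp y.
have wx' := wlt_le (leq_maxl n n') wx; have wy' := wlt_le (leq_maxr n n') wy.
rewrite (ser_ord (wlt_lin a wx' wy')) (ser_ord wx') (ser_ord wy') scaler_sumr -big_split.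
by apply: eq_bigr => m _; rewrite (iter_lin m) lP.
Qed.

Lemma ser_rec y : ser y = P y + ser (N y).
Proof.
have [n [w _]] := S_decomp y; have w' := wlt_le (leqnSn n) w.
by rewrite (ser_ord w') (ser_ord (low w')) big_ord_recl; congr (_ + _); apply: eq_bigr => m _; rewrite -iterSr.
Qed.
End Iter.

Lemma ser_left (N : schur C A -> schur C A) y : linear N ->
  (forall n y, wlt n.+1 y -> wlt n (N y)) -> ser id N y = y + N (ser id N y).
Proof.
move=> lN low; have [n [w _]] := S_decomp y; have w' := wlt_le (leqnSn n) w.
have li : linear (@id (schur C A)) by [].
rewrite {1}(ser_ord li lN low w') (ser_ord li lN low w) big_ord_recl; congr (_ + _).
by rewrite (lin_sum lN).
Qed.

Lemma ser_comp (M : lmodType K) (P : schur C A -> M) (N : schur C A -> schur C A) y : linear P -> linear N ->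
  (forall n y, wlt n.+1 y -> wlt n (N y)) -> ser P N y = P (ser id N y).
Proof.
move=> lP lN low; have [n [w _]] := S_decomp y.
have li : linear (@id (schur C A)) by [].
by rewrite (ser_ord lP lN low w) (ser_ord li lN low w) (lin_sum lP).
Qed.
End Series.

(** * The coderivation t and its corestriction tau *)

Section OmegaAlgebra.
Variables (K : comPzRingType) (sym : bool) (C : cooperad K sym) (one : C 1%N) (hone : connected one).
Variables (A : chain K) (t : {linear schur C A -> schur C A}).
Hypothesis om : omega_algebra t.
Local Notation Delta := (@sdelta _ _ _ (delta C) _).
Local Notation eps := (@scounit _ _ _ (counit C) _).

Let pA := chain_parited A.
Let pS := S_parited C pA.
Let lt : linear t := linearP t.

Definition tau (y : schur C A) : A := eps (t y).

Lemma t_par : parmap true t.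
Proof. exact: (@parmap_homog _ _ _ (-1) _ pS pS lt (om_hom om)). Qed.

Lemma tau_lin : linear tau.
Proof. by move=> a x y; rewrite /tau lt (eps_lin (C := C) pA). Qed.

Lemma tau_par : parmap true tau.
Proof. by apply: (parmap_comp0 (psi := eps)); [exact: eps_par | exact: t_par]. Qed.

Lemma t_low n y : wlt n.+1 y -> wlt n (t y).
Proof.
move=> w m l; rewrite (wlt_sum w) (lin_sum lt) (lin_sum (@swt_lin _ _ C A m)).
by rewrite big1 // => k _; apply: (om_weight om); apply: leq_trans l; rewrite -ltnS.
Qed.

Lemma t_wt1 y : wlt 2 y -> t y = 0.
Proof.
move=> /t_low w; apply: wlt0_eq0 => m _; case: m => [|m]; first exact: (swt0 hone).
exact: w.
Qed.

Lemma tau_wt1 (c : C 1%N) x : tau (sten c x) = 0.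
Proof. by rewrite /tau t_wt1 ?(lin0 (eps_lin (C := C) pA)) //; apply: wlt_sten. Qed.

Let tk_id_t : thickmap sym (tder2 id t).
Proof. by apply: (thickmap_tder2 sym pS pS) => //; exact: t_par. Qed.

Let tk_eps : thickmap sym (tmap (eps : schur C A -> A)).
Proof. by apply: (thickmap_tmap sym pS pA (eps_lin (C := C) pA)); exact: eps_par. Qed.

Lemma thick_eps_tau : thickmap sym (tder2 (eps : schur C A -> A) tau).
Proof.
apply: (thickmap_tder2 sym pS pA (eps_lin (C := C) pA) tau_lin); [exact: eps_par|exact: tau_par].
Qed.

(** By the counit axiom t is followed by C[eps] Delta; the coderivation identity then moves t behind
    the coproduct. *)
Lemma t_formula y : t y = smap true (tder2 (eps : schur C A -> A) tau) (Delta y).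
Proof.
have gA := chain_graded A.
rewrite -[t y](delta_counit gA) (om_coder om).
have -> : smap true (tder t) (Delta y) = smap true (tder2 id t) (Delta y).
  by congr (smap _ _ _); apply: funext => z; rewrite (tder_tder2 pS).
rewrite smap_smap //=; congr (smap _ _ _); apply: funext => z.
rewrite (tmap_tder2 _ pS pA) //; [exact: eps_lin | exact: eps_par].
Qed.
End OmegaAlgebra.

Lemma part_parmap (K : comPzRingType) (X Y : gmod K) b d (phi : X -> Y) x : linear phi ->
  parmap b phi -> part d (phi x) = phi (part (b (+) d) x).
Proof.
move=> l p; case: d; first by rewrite addbT; exact: p.
rewrite addbF -[LHS]/(phi x - goddp (phi x)) p -(linB l); congr phi.
by case: b {p} => //; rewrite /part /= opprB addrC subrK.
Qed.

Lemma parmap_comp (K : comPzRingType) (X Y Z : gmod K) b c (phi : X -> Y) (psi : Y -> Z) :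
  linear psi -> linear phi -> parmap b phi -> parmap c psi ->
  parmap (b (+) c) (fun x => psi (phi x)).
Proof. by move=> lp l p q x; rewrite q (part_parmap _ _ l p) addbN. Qed.

Section ConnectedExt.
Variables (K : comPzRingType) (sym : bool) (C : cooperad K sym) (one : C 1%N) (hone : connected one).
Variables (A : gmod K).
Hypothesis pA : parited A.

(** The outer arity 0 does not occur, and inner factors of arity 0 vanish. With at least two outer
    inputs all inner arities are therefore smaller than n; a single outer input has an inner factor
    of arity n and needs its own argument. *)
Lemma ccev_ext_conn (M : lmodType K) (f g : schur C (schur C A) -> M) n (u : CC C n) (x : T A) :
  linear f -> linear g ->
  (forall (c : C 1%N) z, f (sten c (word [:: z])) = g (sten c (word [:: z]))) ->
  (forall r (c : C r) (zs : seq (schur C A)), (1 < r)%N ->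
     (forall z, z \in zs -> exists2 a, (a < n)%N & atom a z) ->
     f (sten c (word zs)) = g (sten c (word zs))) ->
  f (ccev u x) = g (ccev u x).
Proof.
have [c0 _ _] := hone.
move=> hf hg e1 e2; apply: (ccev_ext pA) => // r c zs az sz hz hs.
case: r c sz hz hs => [|[|r]] c sz hz hs.
- by rewrite (c0 c) sten0l (lin0 hf) (lin0 hg).
- by case: zs sz {hz} => [|z [|z' zs]].
have atom0 j : (j < r.+2)%N -> az j = 0%N -> word zs = 0 :> T (schur C A).
  move=> lj e; have [d [w [sw ez]]] := hz j lj.
  apply: (ml0 (@word_multilinear _ (schur C A))).
  have <- : nth 0 zs j = 0 by rewrite ez; move: d {ez}; rewrite e => d; rewrite (c0 d) sten0l.
  by apply: mem_nth; rewrite sz.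
case: (boolP [exists j : 'I_r.+2, az j == 0%N]) => [/existsP[j /eqP ej]|].
  by rewrite (atom0 j) // !sten0r (lin0 hf) (lin0 hg).
rewrite negb_exists => /forallP nz; apply: e2 => // z /(nthP 0)[j]; rewrite sz => lj <-.
exists (az j); last exact: hz.
pose j0 := Ordinal lj.
(* A second factor, of arity at least 1, keeps the arity of the factor [j0] below n. *)
have [k nk] : exists k : 'I_r.+2, k != j0.
  case: (altP (j0 =P ord0)) => [->|ne]; first by exists ord_max.
  by exists ord0; rewrite eq_sym.
rewrite -hs (bigD1 j0) //= (bigD1 k) //=.
by move: (nz k); rewrite -lt0n; lia.
Qed.
End ConnectedExt.

Lemma dw_zero (K : comPzRingType) (A B : gmod K) (al be : A -> B) zs :
  (forall z, z \in zs -> be z = 0) -> dw al be zs = 0.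
Proof.
elim: zs => //= z zs IH h; rewrite h ?mem_head // IH ?tmul0r ?addr0; last first.
  by move=> y hy; apply: h; rewrite inE hy orbT.
by apply: (ml0 (@word_multilinear _ B)); rewrite mem_head.
Qed.

Lemma tder2_addr (K : comPzRingType) (A B : gmod K) (al be be' : A -> B) z : parited B ->
  linear al -> linear be -> linear be' ->
  tder2 al (fun x => be x + be' x) z = tder2 al be z + tder2 al be' z.
Proof.
move=> pB la lb lb'; have ls := lin_add lb lb'.
move: z; apply: T_ext => [||w]; first exact: tder2_lin.
  by apply: lin_add; exact: tder2_lin.
rewrite !tder2_word //; elim: w => [|x w IH] /=; first by rewrite addr0.
have := @word_multilinear _ B [::] (map al w) 1 (be x) (be' x) => /=; rewrite !scale1r => ->.
by rewrite IH tmulDr addrACA.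
Qed.

(** * The equation G' = C[kappa] Delta *)

Section Transferred.
Variables (K : comPzRingType) (sym : bool) (C : cooperad K sym) (one : C 1%N) (hone : connected one).
Variables (A B : chain K) (f : {linear A -> B}) (g : {linear B -> A}) (h : {linear A -> A}).
Variables (t : {linear schur C A -> schur C A}).
Hypotheses (hc : contraction f g h) (om : omega_algebra t).
Local Notation Delta := (@sdelta _ _ _ (delta C) _).
Local Notation eps := (@scounit _ _ _ (counit C) _).

Let pA := chain_parited A.
Let pB := chain_parited B.
Let pSA := S_parited C pA.
Let pSB := S_parited C pB.
Let lt : linear t := linearP t.
Let lg : linear g := linearP g.
Let eg := g_par hc.
Let le : linear (eps : schur C A -> A) := eps_lin pA.
Let leB : linear (eps : schur C B -> B) := eps_lin pB.

Lemma counit_ksign b (c : C 1%N) : counit C (ksign b c) = counit C c.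
Proof. by case: b => //; rewrite /ksign linearB linearMn counit_odd mul0rn subr0. Qed.

(** The counit sees weight 1 only, where phi is p. The sign on C(1) disappears because the counit
    vanishes on odd elements. *)
Lemma eps_smap (X Y : gmod K) b (phi : T X -> T Y) (p : X -> Y) y : parited X -> parited Y ->
  thickmap sym phi -> linear p -> (forall x, phi (word [:: x]) = word [:: p x]) ->
  eps (smap b phi y : schur C Y) = p (eps (y : schur C X)).
Proof.
move=> pX pY tp lp e1; move: y; apply: S_ext => [||n c w sw].
- exact: (lin_comp (eps_lin pY) (smap_lin (C := C) b tp)).
- exact: (lin_comp lp (eps_lin pX)).
rewrite smap_sten //; case: (altP (n =P 1%N)) => [e|ne]; last by rewrite !eps_other // (lin0 lp).
move: c sw; rewrite e => c; case: w => [|x [|x' w]] // _.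
by rewrite !eps1 // e1 !letter_word (linZ lp) counit_ksign.
Qed.

Section OneHomotopy.
Variable hh : {linear T A -> T A}.
Hypothesis ht : thick_homotopy sym f g h hh.
Let lh : linear hh := linearP hh.

Lemma hh_thick : thickmap sym hh.
Proof. by split; [exact: lh | exact: (th_thick ht) | exact: (th_sym ht)]. Qed.

Local Notation H := (smap (C := C) true hh).
Local Notation G := (smap (C := C) false (tmap g)).
Local Notation G' := (trG g t hh).
Local Notation kap := (fun y : schur C B => (eps (G' y) : A)).
Local Notation Kp := (fun y : schur C B => smap false (tmap kap) (Delta y)).

Lemma H_lin : linear H.
Proof. exact: smap_lin hh_thick. Qed.
Lemma H_wlt n y : wlt n y -> wlt n (H y).
Proof. by move=> w m l; rewrite -(smap_swt _ hh_thick) w // (lin0 H_lin). Qed.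
Lemma Ht_lin : linear (H \o t).
Proof. exact: (lin_comp H_lin lt). Qed.
Lemma Ht_low n y : wlt n.+1 y -> wlt n ((H \o t) y).
Proof. by move=> w; apply: H_wlt; apply: (t_low om). Qed.
Lemma g_thick : thickmap sym (tmap g).
Proof. exact: (thickmap_tmap sym pB pA lg eg). Qed.
Lemma G_lin : linear G.
Proof. exact: smap_lin g_thick. Qed.

Lemma trG_ser y : G' y = ser id (H \o t) (G y).
Proof. by []. Qed.

Lemma trG_lin : linear G'.
Proof.
exact: (lin_comp (ser_lin (@lin_id _ _) Ht_lin Ht_low) G_lin).
Qed.

Lemma trG_rec y : G' y = G y + H (t (G' y)).
Proof. by rewrite {1}trG_ser (ser_left _ Ht_lin Ht_low). Qed.

Lemma trG_par : parmap false G'.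
Proof.
have eG : parmap false G by apply: (smap_par g_thick pB pA); exact: tmap_par.
have eHt : parmap false (H \o t).
  apply: (@parmap_comp _ _ _ _ true true); [exact: H_lin|exact: lt|exact: t_par om|].
  by apply: (smap_par hh_thick pA pA); exact: hh_par ht.
move=> y; rewrite !trG_ser -[part (~~ false) y]/(goddp y).
have -> : G (goddp y) = goddp (G y) by rewrite (eG y).
have [n [w _]] := S_decomp (G y); have [n' [w' _]] := S_decomp (goddp (G y)).
have li := @lin_id K (schur C A).
rewrite (ser_ord li Ht_lin Ht_low (wlt_le (leq_maxl n n') w)).
rewrite (ser_ord li Ht_lin Ht_low (wlt_le (leq_maxr n n') w')).
rewrite (lin_sum (par_lin pSA)); apply: eq_bigr => m _.
set N := (H \o t) in eHt *; elim: (val m) => // m' IH.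
by rewrite !iterS eHt -IH.
Qed.

Lemma eps_H y : eps (H y) = h (eps y).
Proof. by apply: (eps_smap _ _ pA pA hh_thick (linearP h)); exact: (th_1 ht). Qed.

Lemma kap_rec y : kap y = g (eps y) + h (tau t (G' y)).
Proof.
rewrite /= {1}trG_rec (linD le) eps_H (eps_smap _ _ pB pA g_thick lg) // => x.
by rewrite tmap_word.
Qed.

Lemma kap_lin : linear kap. Proof. exact: (lin_comp le trG_lin). Qed.
Lemma kap_par : parmap false kap.
Proof. by apply: (parmap_comp0 (psi := eps)); [exact: eps_par|exact: trG_par]. Qed.

Lemma kap_thick : thickmap sym (tmap kap).
Proof. exact: (thickmap_tmap sym pSB pA kap_lin kap_par). Qed.

Lemma Kp_lin : linear Kp.
Proof. exact: (lin_comp (smap_lin (C := C) false kap_thick) (Delta_lin pB)). Qed.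

Lemma eps_Kp y : eps (Kp y) = kap y.
Proof.
rewrite (eps_smap _ _ pSB pA kap_thick kap_lin) ?(counit_delta (chain_graded B)) // => x.
by rewrite tmap_word //; exact: kap_lin.
Qed.

Lemma Kp_par : parmap false Kp.
Proof.
apply: (parmap_comp0 (psi := smap (C := C) false (tmap kap))); last exact: Delta_par.
apply: (smap_par kap_thick pSB pA); exact: (tmap_par pSB pA kap_lin kap_par).
Qed.

(** Naturality of the coproduct in kappa, then coassociativity. *)
Lemma Delta_Kp y : Delta (Kp y) = smap false (tmap Kp) (Delta y).
Proof.
have pSSB := S_parited C pSB.
rewrite (Delta_nat _ pSB pA kap_lin kap_par) -(delta_coassoc (chain_graded B)).
have lD := Delta_lin (C := C) pB; have eD := Delta_par (C := C) pB.
have tD := thickmap_tmap sym pSB pSSB lD eD.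
have lk := smap_lin (C := C) false kap_thick.
have ek : parmap false (smap (C := C) false (tmap kap)).
  by apply: (smap_par kap_thick pSB pA); exact: (tmap_par pSB pA kap_lin kap_par).
rewrite smap_smap //; last exact: (thickmap_tmap sym pSSB pSA lk ek).
congr (smap _ _ _); apply: funext => z; exact: tmap_comp.
Qed.

Lemma t_Kp y : t (Kp y) = smap true (tder2 kap (fun z => tau t (Kp z))) (Delta y).
Proof.
have tK : thickmap sym (tmap Kp) by exact: (thickmap_tmap sym pSB pSA Kp_lin Kp_par).
rewrite (t_formula om) Delta_Kp smap_smap //; last exact: (thick_eps_tau om).
congr (smap _ _ _); apply: funext => z.
rewrite (tder2_tmap _ pA Kp_lin le (tau_lin t)); apply: (eq_tder2 pA) => //.
- exact: (lin_comp le Kp_lin).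
- exact: (lin_comp (tau_lin t) Kp_lin).
- exact: eps_Kp.
Qed.

(** [hh_tder2] inside the Schur functor, with e = eps and u = tau G'; the counit axiom writes G as
    C[g eps] Delta. *)
Lemma H_tder2 y : H (smap true (tder2 kap (fun z => tau t (G' z))) (Delta y)) = Kp y - G y.
Proof.
have lu : linear (fun z => tau t (G' z)) by exact: (lin_comp (tau_lin t) trG_lin).
have ou : parmap true (fun z => tau t (G' z)).
  by apply: (@parmap_comp _ _ _ _ false true); [exact: tau_lin|exact: trG_lin|exact: trG_par|exact: tau_par].
have tu := thickmap_tder2 sym pSB pA kap_lin lu kap_par ou.
have lge : linear (fun z : schur C B => g (eps z)) by exact: (lin_comp lg leB).
have ege : parmap false (fun z : schur C B => g (eps z)) by apply: (parmap_comp0 eg); exact: eps_par.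
have tge := thickmap_tmap sym pSB pA lge ege.
have te := thickmap_tmap sym pSB pB leB (eps_par pB).
rewrite smap_smap //; last exact: hh_thick.
have -> : G y = smap false (tmap (fun z : schur C B => g (eps z))) (Delta y).
  rewrite -{1}(delta_counit (chain_graded B) y) smap_smap //; last exact: g_thick.
  congr (smap _ _ _); apply: funext => z; exact: tmap_comp.
have E z : hh (tder2 kap (fun z => tau t (G' z)) z) = tmap kap z - tmap (fun z => g (eps z)) z.
  apply: (hh_tder2 hc ht z pSB leB lu kap_lin (eps_par pB) ou kap_par); exact: kap_rec.
have tE : thickmap sym (fun z => hh (tder2 kap (fun z => tau t (G' z)) z)).
  split=> [|n z|hs n s z].
  - exact: (lin_comp lh (tk_lin tu)).
  - by rewrite (tk_wt tu) (tk_wt hh_thick).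
  - by rewrite (tk_sym tu) // (tk_sym hh_thick).
move: (Delta y); apply: S_ext => [||n c w _].
- exact: (smap_lin (C := C) _ tE).
- by apply: lin_sub; [exact: (smap_lin (C := C) _ kap_thick)|exact: (smap_lin (C := C) _ tge)].
rewrite (smap_sten _ tE) (smap_sten _ kap_thick) (smap_sten _ tge).
by rewrite [X in sten _ X]E (linB (@sten_linr _ _ C A n _)).
Qed.

(** In [t_Kp] the distinguished factor is tau applied to [Kp], in [H_tder2] it is tau applied to G'.
    This difference measures the mismatch. *)
Let Er (y : schur C B) : schur C A := Kp y - G' y.

Let Er_lin : linear Er.
Proof. exact: (lin_sub Kp_lin trG_lin). Qed.

Let Er_par : parmap false Er.
Proof. by move=> y; rewrite /Er (linB (par_lin pSA)) Kp_par trG_par. Qed.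

(** Ht lowers weight bounds, so the bound of e descends to 0. The weights 0 and 1, for which no
    equation is assumed, vanish by connectedness and by eps e = 0. *)
Lemma wlt_fix e : eps e = 0 -> (forall m, (1 < m)%N -> swt m e = swt m (H (t e))) -> e = 0.
Proof.
move=> e0 h2; have [N [w _]] := S_decomp e.
elim: N w => [|N IH] w; first exact: wlt0_eq0.
apply: IH => m l; case: m l => [|[|m]] l.
- exact: (swt0 hone).
- by rewrite (swt1 hone pA) e0 (lin0 (@word1_lin _ A)) sten0r.
by rewrite h2 //; apply: (H_wlt (t_low om w)).
Qed.

(** Induction on the arity of y. One has t Kp = C[kappa; tau G'] Delta + R with R = C[kappa; tau Er]
    Delta, hence H t Er = Er + H R. As R lives in weight 1, [wlt_fix] applies to Er. *)
Lemma trG_Kp y : G' y = Kp y.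
Proof.
suff E0 n (c : C n) w : size w = n -> Er (sten c (word w)) = 0.
  move: y; apply: S_ext => [||n c w sw]; [exact: trG_lin|exact: Kp_lin|].
  by apply/esym/eqP; rewrite -subr_eq0; apply/eqP; apply: E0.
elim/ltn_ind: n c w => n IH c w sw {y}; set y := sten c (word w).
have lD : linear (fun z => tau t (Er z)) by exact: (lin_comp (tau_lin t) Er_lin).
have oD : parmap true (fun z => tau t (Er z)).
  by apply: (@parmap_comp _ _ _ _ false true); [exact: tau_lin|exact: Er_lin|exact: Er_par|exact: tau_par].
have lu : linear (fun z => tau t (G' z)) by exact: (lin_comp (tau_lin t) trG_lin).
have ou : parmap true (fun z => tau t (G' z)).
  by apply: (@parmap_comp _ _ _ _ false true); [exact: tau_lin|exact: trG_lin|exact: trG_par|exact: tau_par].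
have tu := thickmap_tder2 sym pSB pA kap_lin lu kap_par ou.
have tD := thickmap_tder2 sym pSB pA kap_lin lD kap_par oD.
pose R := smap true (tder2 kap (fun z => tau t (Er z))) (Delta y).
have eE : eps (Er y) = 0 by rewrite /Er (linB le) eps_Kp subrr.
have eR : t (Kp y) = smap true (tder2 kap (fun z => tau t (G' z))) (Delta y) + R.
  rewrite t_Kp /R; move: (Delta y); apply: S_ext => [||m d v _].
  - apply: smap_lin; apply: (thickmap_tder2 sym pSB pA kap_lin _ kap_par).
      exact: (lin_comp (tau_lin t) Kp_lin).
    by apply: (@parmap_comp _ _ _ _ false true); [exact: tau_lin|exact: Kp_lin|exact: Kp_par|exact: tau_par].
  - by apply: lin_add; [exact: (smap_lin (C := C) _ tu)|exact: (smap_lin (C := C) _ tD)].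
  rewrite !smap_sten //; last first.
    apply: (thickmap_tder2 sym pSB pA kap_lin _ kap_par); first exact: (lin_comp (tau_lin t) Kp_lin).
    by apply: (@parmap_comp _ _ _ _ false true); [exact: tau_lin|exact: Kp_lin|exact: Kp_par|exact: tau_par].
  rewrite -(linD (@sten_linr _ _ C A m _)); congr sten; rewrite -(tder2_addr _ pA kap_lin lu lD).
  apply: (eq_tder2 pA) => //; first exact: kap_lin.
    exact: (lin_comp (tau_lin t) Kp_lin).
  by move=> z; rewrite /= -(linD (tau_lin t)) /Er addrC subrK.
(* Terms with one outer input land in weight 1; in all others the inner factors have arity below n,
   where Er vanishes by induction. *)
have swtR m : (1 < m)%N -> swt m R = 0.
  move=> lm; rewrite /R /y (Delta_sten pB).
  have lR := lin_comp (@swt_lin _ _ C A m) (smap_lin (C := C) true tD).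
  apply: (ccev_ext_conn hone pB (g := fun=> 0) _ _ lR) => [|d z|r d zs lr hz].
  - by move=> a u v; rewrite scaler0 addr0.
  - by rewrite smap_sten // swt_sten; case: eqP lm => // <-.
  rewrite smap_sten // tder2_word //; last exact: kap_lin.
  rewrite dw_zero ?sten0r ?(lin0 (@swt_lin _ _ C A m)) // => z /hz [a la [d' [w' [sw' ->]]]].
  by rewrite (IH _ la) // (lin0 (tau_lin t)).
apply: wlt_fix => // m lm.
have -> : H (t (Er y)) = Er y + H R.
  rewrite /Er (linB lt) eR (linB H_lin) (linD H_lin) H_tder2.
  have -> : G y = G' y - H (t (G' y)) by rewrite {1}trG_rec addrK.
  by abel.
by rewrite (linD (@swt_lin _ _ C A m)) -(smap_swt _ hh_thick) swtR // (lin0 H_lin) addr0.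
Qed.
End OneHomotopy.
End Transferred.

(** * Independence of t' and G' from the pseudo-derivation *)

Section Independence.
Variables (K : comPzRingType) (sym : bool) (C : cooperad K sym) (one : C 1%N) (hone : connected one).
Variables (A B : chain K) (f : {linear A -> B}) (g : {linear B -> A}) (h : {linear A -> A}).
Variables (t : {linear schur C A -> schur C A}).
Hypotheses (hc : contraction f g h) (om : omega_algebra t).
Local Notation Delta := (@sdelta _ _ _ (delta C) _).
Local Notation eps := (@scounit _ _ _ (counit C) _).

Let pA := chain_parited A.
Let pB := chain_parited B.
Let pSB := S_parited C pB.

Lemma tau_smap_kap_lin hh (ht : thick_homotopy sym f g h hh) :
  linear (fun z : schur C (schur C B) =>
    tau t (smap false (tmap (fun y : schur C B => (eps (trG g t hh y) : A))) z)).
Proof.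
exact: (lin_comp (tau_lin t) (smap_lin (C := C) false (kap_thick hc om ht))).
Qed.

Section TwoHomotopies.
Variables (hh hh' : {linear T A -> T A}).
Hypotheses (ht : thick_homotopy sym f g h hh) (ht' : thick_homotopy sym f g h hh').

(** The equation kappa = g eps + h tau C[kappa] Delta involves h alone. Its terms with one outer
    input are killed by tau, and the others evaluate kappa in smaller arity. *)
Lemma kap_eq (y : schur C B) : eps (trG g t hh y) = eps (trG g t hh' y).
Proof.
suff E n (c : C n) w : size w = n ->
    eps (trG g t hh (sten c (word w))) = eps (trG g t hh' (sten c (word w))).
  move: y; apply: S_ext => //; [exact: (kap_lin hc om ht)|exact: (kap_lin hc om ht')].
elim/ltn_ind: n c w => n IH c w sw {y}; set y := sten c (word w).
rewrite (kap_rec hc om ht) (kap_rec hc om ht'); congr (_ + h _).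
rewrite (trG_Kp hone hc om ht) (trG_Kp hone hc om ht') (Delta_sten pB).
have tk := kap_thick hc om ht; have tk' := kap_thick hc om ht'.
apply: (ccev_ext_conn hone pB _ _ (tau_smap_kap_lin ht) (tau_smap_kap_lin ht')) => [d z|r d zs lr hz].
  by rewrite (smap_sten _ tk) (smap_sten _ tk') !(tau_wt1 hone om).
rewrite (smap_sten _ tk) (smap_sten _ tk') !tmap_word; last first.
- exact: (kap_lin hc om ht).
- exact: (kap_lin hc om ht').
congr (tau t (sten _ (word _))); apply/eq_in_map => z /hz [a la [d' [w' [sw' ->]]]].
exact: IH.
Qed.

Lemma trG_indep (y : schur C B) : trG g t hh y = trG g t hh' y.
Proof.
rewrite (trG_Kp hone hc om ht) (trG_Kp hone hc om ht'); congr (smap _ (tmap _) _).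
by apply: funext => z; exact: kap_eq.
Qed.
End TwoHomotopies.

Lemma F_lin : linear (smap (C := C) false (tmap f)).
Proof.
by apply: smap_lin; apply: (thickmap_tmap sym pA pB (linearP f)); exact: f_par hc.
Qed.

Lemma trt_trG hh (ht : thick_homotopy sym f g h hh) (y : schur C B) :
  trt f g t hh y = smap false (tmap f) (t (trG g t hh y)).
Proof.
have lFt : linear (fun z => smap false (tmap f) (t z)) by exact: (lin_comp F_lin (linearP t)).
exact: (ser_comp _ lFt (Ht_lin t ht) (Ht_low om ht)).
Qed.
End Independence.

(** * Components *)

Lemma unzip1_nseq (U V : Type) m (p : U * V) : unzip1 (nseq m p) = nseq m p.1.
Proof. by rewrite /unzip1 map_nseq. Qed.

Lemma Forall_nseq (U : Type) (P : U -> Prop) m u : P u -> List.Forall P (nseq m u).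
Proof. by move=> h; elim: m => //= m IH; constructor. Qed.

Section Cten.
Variables (K : comPzRingType) (sym : bool) (C : sseq K sym) (A : gmod K).
Hypothesis pA : parited A.
Implicit Type l : seq ({a : nat & C a} * bool).

Definition cms l : seq (nat * (T A -> T (schur C A)) * bool) :=
  [seq (tag p.1, (fun y : T A => word [:: (sten (tagged p.1) y : schur C A)]), p.2) | p <- l].

Lemma cms_lins l : lins (cms l).
Proof.
rewrite /cms; elim: l => [|p s IH] m //= [<-|]; last exact: IH.
exact: (lin_comp (@word1_lin _ (schur C A)) (@sten_linr _ _ C A _ _)).
Qed.

(** The blocks of labels glue back to [labels s], and for factors of known parity the sum over
    parities has one term. *)
Lemma ccev_cten n r (c : C r) l (s : 'S_n) (x : T A) : size l = r ->
  sumn [seq tag p.1 | p <- l] = n -> sym || (s == 1%g) ->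
  List.Forall (fun p => pure p.2 (tagged p.1)) l ->
  ccev (cten c (unzip1 l) s) x = sten c (tensm (cms l) (permw (labels s) x)).
Proof.
move=> sl sn hs hl; rewrite /cten ccev_gen //.
set R := reshape _ _.
have sh : [seq tag a | a <- unzip1 l] = [seq tag p.1 | p <- l] by rewrite -map_comp.
have sR : size R = size l by rewrite size_reshape !size_map.
have shR : shape R = [seq tag p.1 | p <- l].
  by rewrite /R sh reshapeKl // size_labels sn.
have flR : flatten R = labels s by rewrite /R sh reshapeKr // size_labels sn.
have e2 : [seq b.2 | b <- zip (unzip1 l) R] = R by apply: unzip2_zip; rewrite size_map sR.
set g := (existT _ _ _, _).
have v : cosym_valid n g.
  rewrite /cosym_valid /= e2 flR size_zip size_map sR minnn sl eqxx /=; apply/andP; split.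
    move: shR sR; elim: (l) (R) => [|p l' IH] [|L R'] //= [<- e1] [e3].
    by rewrite eqxx IH.
  by case: ifP hs => h /=; rewrite ?perm_labels // => /eqP ->; rewrite labels1.
have sb : size (unzip2 l) = size g.2 by rewrite /= size_zip !size_map sR minnn.
have hb : bpure (unzip2 l) g.2.
  rewrite /= ; elim: hl (R) sR {sl sn sh shR flR e2 g v sb} => [|p l' hp _ IH] [|L R'] //= sR j.
    by rewrite !nth_nil; exact: pure0 (C_parited C 0) _.
  by case: j => [|j] /=; [exact: hp|apply: IH; case: sR].
rewrite (@ccphi_pure _ _ _ _ pA n x g (unzip2 l)) // v /ccterm /= e2 flR.
suff -> : blms A (unzip2 l) (zip (unzip1 l) R) = cms l by [].
rewrite /blms /cms; elim: hl (R) sR {sl sn sh shR flR e2 g v sb hb} => [|p l' hp _ IH] [|L R'] //= [sR].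
rewrite IH //; congr (_ :: _); congr (_, _, _); apply: funext => y.
by rewrite (part_pure _ hp) eqxx.
Qed.

Lemma tensm_wt (D : gmod K) (ms : seq (nat * (T A -> T D) * bool)) n (x : T A) : lins ms ->
  sumn [seq m.1.1 | m <- ms] = n -> tensm ms (wt n x) = tensm ms x.
Proof.
move=> lm sn; have l := tensm_lin pA lm; move: x; apply: T_ext => [||w].
- exact: (lin_comp l (@wt_lin _ A n)).
- exact: l.
rewrite wt_word; case: ifP => // ne; rewrite (lin0 l) tensm_word // sn ne //.
Qed.

Lemma cms_arity l : [seq m.1.1 | m <- cms l] = [seq tag p.1 | p <- l].
Proof. by rewrite -map_comp. Qed.

(* On words, the letters of [tensm (cms l)] are decomposable elements. *)
Lemma tensw_cms l w : size w = sumn [seq tag p.1 | p <- l] ->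
  exists zs : seq (schur C A), [/\ tensw (cms l) w = word zs, size zs = size l &
    List.Forall (fun q => exists w', size w' = tag q.1.1 /\ q.2 = sten (tagged q.1.1) (word w')) (zip l zs)].
Proof.
elim: l w => [|p l IH] w /= sw; first by exists [::].
have [|zs [e s h]] := IH (drop (tag p.1) w); first by rewrite size_drop sw addKn.
exists (sten (tagged p.1) (word [seq ksign (odd (count id (unzip2 (cms l)))) v | v <- take (tag p.1) w]) :: zs).
split; [by rewrite e tmul_word|by rewrite /= s|].
constructor => //=; eexists; split; last by [].
by rewrite size_map size_takel // sw leq_addr.
Qed.

Lemma tensw_ones m (c : C 1%N) w : size w = m ->
  tensw (cms (nseq m (existT _ 1%N c, false))) w =
  word [seq (sten c (word [:: x]) : schur C A) | x <- w].
Proof.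
move=> <-; elim: w => //= x w IH; rewrite take0 drop0 IH tmul_word /=.
rewrite (_ : odd _ = false) // /unzip2 -map_comp /= (_ : count _ _ = 0%N) //.
by elim: (w).
Qed.
End Cten.

(** * The two extreme terms of the coproduct *)

Section TrivialTerms.
Variables (K : comPzRingType) (sym : bool) (C : sseq K sym) (one : C 1%N) (hone : pure false one).
Local Notation o := (@existT nat (fun a => C a : Type) 1%N one).

Lemma sumn_tags m (c : C 1%N) b :
  sumn [seq tag p.1 | p <- nseq m ((existT _ 1%N c : {a : nat & C a}), b : bool)] = m.
Proof. by elim: m => //= m ->. Qed.

Variables (X : gmod K) (pX : parited X) (n : nat) (ii : bool) (nu : C n) (x : T X).
Hypothesis hnu : pure ii nu.

Lemma ccev_ones : ccev (cten nu (nseq n o) (1%g : 'S_n)) x =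
  sten nu (tensm (cms X (nseq n (o, false))) x).
Proof.
have -> : nseq n o = unzip1 (nseq n (o, false)) by rewrite unzip1_nseq.
rewrite ccev_cten ?size_nseq ?sumn_tags ?eqxx ?orbT //; last first.
  by apply: Forall_nseq; exact: hone.
rewrite labels1 permw_iota // tensm_wt //; first exact: cms_lins.
by rewrite cms_arity sumn_tags.
Qed.

Lemma ccev_top : ccev (cten one [:: existT _ n nu] (1%g : 'S_n)) x =
  sten one (word [:: (sten nu x : schur C X)]).
Proof.
pose l : seq ({a : nat & C a} * bool) := [:: (existT _ n nu, ii)].
have sl : sumn [seq tag p.1 | p <- l] = n by rewrite /= addn0.
have hl : List.Forall (fun p => pure p.2 (tagged p.1)) l.
  by constructor; [exact: hnu|constructor].
have hs : sym || ((1%g : 'S_n) == 1%g) by rewrite eqxx orbT.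
rewrite (@ccev_cten _ _ _ X pX n 1%N one l 1%g x erefl sl hs hl).
rewrite labels1 permw_iota // (tensm_wt pX _ (@cms_lins _ _ _ X l)); last by rewrite cms_arity.
suff -> : tensm (cms X l) x = word [:: (sten nu x : schur C X)] by [].
move: x; apply: T_ext => [||w].
- by apply: tensm_lin => //; exact: cms_lins.
- exact: (lin_comp (@word1_lin _ (schur C X)) (@sten_linr _ _ C X n nu)).
rewrite tensm_word //; last exact: cms_lins.
rewrite /= addn0; case: (altP (size w =P n)) => [e|ne].
  by rewrite take_oversize ?e // tmul1r map_id.
by rewrite sten_word_other // (lin0 (@word1_lin _ _)).
Qed.
End TrivialTerms.

Section Formulas.
Variables (K : comPzRingType) (sym : bool) (C : cooperad K sym) (one : C 1%N) (hone : connected one).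
Variables (A B : chain K) (f : {linear A -> B}) (g : {linear B -> A}) (h : {linear A -> A}).
Variables (t : {linear schur C A -> schur C A}) (hh : {linear T A -> T A}).
Hypotheses (hc : contraction f g h) (om : omega_algebra t) (ht : thick_homotopy sym f g h hh).
Local Notation Delta := (@sdelta _ _ _ (delta C) _).
Local Notation eps := (@scounit _ _ _ (counit C) _).
Local Notation o := (@existT nat (fun a => C a : Type) 1%N one).

Let pA := chain_parited A.
Let pB := chain_parited B.
Let pSA := S_parited C pA.
Let pSB := S_parited C pB.
Let lt : linear t := linearP t.
Let le : linear (eps : schur C A -> A) := eps_lin pA.
Let lg : linear g := linearP g.
Let lf : linear f := linearP f.

Local Notation G' := (trG g t hh).
Local Notation kap := (fun y : schur C B => (eps (G' y) : A)).

(** t vanishes on weight at most 1, so the series stops at its first term. *)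
Lemma trG_wt1 (y : schur C B) : wlt 2 y -> G' y = smap false (tmap g) y.
Proof.
move=> w; rewrite trG_ser.
have lHt := Ht_lin t ht; have low := Ht_low om ht.
have wG : wlt 2 (smap (C := C) false (tmap g) y).
  by move=> m lm; rewrite -(smap_swt _ (g_thick sym hc)) w // (lin0 (G_lin (C := C) hc)).
rewrite (ser_rec (@lin_id _ _) lHt low) /= (t_wt1 hone om wG) (lin0 (H_lin (C := C) ht)).
by rewrite (lin0 (ser_lin (@lin_id _ _) lHt low)) addr0.
Qed.

Lemma kap_one (x : T B) : kap (sten one x) = g (letter x).
Proof.
have [_ h1 _] := hone.
rewrite trG_wt1; last exact: wlt_sten.
rewrite (eps_smap _ _ pB pA (g_thick sym hc) (linearP g)) => [|y]; last by rewrite tmap_word.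
by rewrite eps1 // h1 scale1r.
Qed.

Lemma tau_ones n (nu : C n) (x : T B) :
  smap false (tmap kap) (sten nu (tensm (cms B (nseq n (o, false))) x)) = sten nu (tmap g x).
Proof.
rewrite (smap_sten _ (kap_thick hc om ht)).
have lk := kap_lin hc om ht.
have lt1 := tensm_lin pB (@cms_lins _ _ _ B (nseq n (o, false))).
move: x; apply: T_ext => [||w].
- exact: (lin_comp (@sten_linr _ _ C A n _) (lin_comp (tmap_lin lk) lt1)).
- exact: (lin_comp (@sten_linr _ _ C A n _) (tmap_lin (linearP g))).
rewrite tensm_word //; last exact: cms_lins.
rewrite cms_arity sumn_tags tmap_word; last exact: linearP.
case: (altP (size w =P n)) => [e|ne]; last first.
  by rewrite (lin0 (tmap_lin lk)) sten0r sten_word_other // size_map.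
rewrite tensw_ones // tmap_word // -map_comp; congr (sten _ (word _)).
by apply: eq_map => x /=; rewrite kap_one letter_word.
Qed.

Lemma tmap_cms l (z : T B) :
  tmap kap (tensm (cms B [seq (p.1, isodd p.2) | p <- l]) z) = comp_ins G' l z.
Proof.
rewrite tmap_tensm //; [|exact: (kap_lin hc om ht)|exact: cms_lins].
rewrite /comp_ins /cms -!map_comp; congr tensm; apply: eq_map => p /=; congr (_, _, _).
by apply: funext => y; rewrite tmap_word //; exact: (kap_lin hc om ht).
Qed.

Lemma ccev_term (X : gmod K) (pX : parited X) n i (q : term C n) (x : T X) : homogeneous_term i q -> size (tins q) = tar q ->
  sumn (arities q) = n -> sym || (tsigma q == 1%g) ->
  ccev (term_val q) x =
  sten (ttop q) (tensm (cms X [seq (p.1, isodd p.2) | p <- tins q]) (permw (labels (tsigma q)) x)).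
Proof.
move=> [_ hq _] sq sn hs.
have hl : List.Forall (fun p => pure p.2 (tagged p.1)) [seq (p.1, isodd p.2) | p <- tins q].
  elim: hq => [|p l hp _ IH]; constructor => //; exact: (hom_pure (C_parited C _) hp).
have e : unzip1 (tins q) = unzip1 [seq (p.1, isodd p.2) | p <- tins q] by rewrite /unzip1 -map_comp.
have sq' : size [seq (p.1, isodd p.2) | p <- tins q] = tar q by rewrite size_map.
have sn' : sumn [seq tag p.1 | p <- [seq (p.1, isodd p.2) | p <- tins q]] = n by rewrite -map_comp.
by rewrite /term_val e (@ccev_cten _ _ _ X pX n _ (ttop q) _ (tsigma q) x sq' sn' hs hl).
Qed.

(** Expand G' = C[kappa] Delta: the term nu o 1^n contributes t^nu on g^n since kappa is g in weight
    1, while 1 o nu is killed by tau. Applying f gives t', applying h gives g^nu. *)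
Lemma tau_trG n i (nu : C n) ts (x : T B) : homog i nu -> (1 < n)%N -> coproduct_terms one i nu ts ->
  tau t (G' (sten nu x)) = component t nu (tmap g x) +
    \sum_(q <- ts) component t (ttop q) (comp_ins G' (tins q) (permw (labels (tsigma q)) x)).
Proof.
move=> hnu n2 [hts hD].
have lT := tau_smap_kap_lin hc om ht.
rewrite (trG_Kp hone hc om ht) (Delta_sten pB) hD.
pose Phi (u : CC C n) := tau t (smap false (tmap kap) (ccev u x)).
have lP : linear Phi by exact: (lin_comp lT (ccev_linl pB x)).
have E1 : Phi (cten nu (nseq n o) 1%g) = component t nu (tmap g x).
  by rewrite /Phi (ccev_ones (one_pure hone)) // tau_ones.
have E2 : Phi (cten one [:: existT _ n nu] 1%g) = 0.
  by rewrite /Phi (ccev_top one pB x (hom_pure (C_parited C n) hnu)) (smap_sten _ (kap_thick hc om ht)) (tau_wt1 hone om).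
rewrite -[LHS]/(Phi _) !(linD lP) (lin_sum lP) E1 E2 addr0; congr (_ + _).
elim: hts => [|q l [hq [/andP[_ _] sq sn _ hs]] _ IH]; first by rewrite !big_nil.
rewrite !big_cons IH; congr (_ + _).
by rewrite /Phi (ccev_term pB x hq) // (smap_sten _ (kap_thick hc om ht)) tmap_cms.
Qed.
End Formulas.

(** * The quadratic part of the coproduct and the recursions for F' and H' *)

Section QuadraticFormulas.
Variables (K : comPzRingType) (sym : bool) (C : cooperad K sym) (one : C 1%N) (hone : connected one).
Variables (A : chain K) (t : {linear schur C A -> schur C A}).
Hypothesis om : omega_algebra t.
Local Notation Delta := (@sdelta _ _ _ (delta C) _).
Local Notation eps := (@scounit _ _ _ (counit C) _).
Local Notation o := (@existT nat (fun a => C a : Type) 1%N one).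
Local Notation k := (ksign true).

Let pA := chain_parited A.
Let pSA := S_parited C pA.
Let le : linear (eps : schur C A -> A) := eps_lin pA.
Let ltau : linear (tau t) := tau_lin t.
Let tet : thickmap sym (tder2 (eps : schur C A -> A) (tau t)) := thick_eps_tau om.

Lemma tau_low n (c : C n) x : (n <= 1)%N -> tau t (sten c x) = 0.
Proof.
move=> n1; rewrite /tau (t_wt1 hone om) ?(lin0 le) //.
by apply: wlt_le (wlt_sten c x).
Qed.

(** eps kills arities above 1 and tau kills arity at most 1. With no factor of arity above 1, tau
    has nothing to act on; with two or more, one of them always meets eps. *)
Lemma dw_count (l : seq ({a : nat & C a} * bool)) (zs : seq (schur C A)) : size zs = size l ->
  List.Forall (fun q => exists w', size w' = tag q.1.1 /\ q.2 = sten (tagged q.1.1) (word w')) (zip l zs) ->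
  all (fun p => 0 < tag p.1)%N l -> count (fun p => 1 < tag p.1)%N l != 1%N ->
  dw eps (tau t) zs = 0.
Proof.
have noeps l' (zs' : seq (schur C A)) : size zs' = size l' ->
    List.Forall (fun q => exists w', size w' = tag q.1.1 /\ q.2 = sten (tagged q.1.1) (word w')) (zip l' zs') ->
    (0 < count (fun p : {a : nat & C a} * bool => 1 < tag p.1)%N l')%N -> 0 \in map eps zs'.
  elim: l' zs' => [|p l' IH] [|z zs'] //= [s] /List.Forall_cons_iff[[w' [_ /= ez]] hf'].
  case: (ltnP 1 (tag p.1)) => [p1 _|_].
    by rewrite ez eps_other ?mem_head // neq_ltn p1 orbT.
  by rewrite add0n => /(IH _ s hf') i; rewrite inE i orbT.
elim: l zs => [|p l IH] [|z zs] //= [s] /List.Forall_cons_iff[[w' [_ /= ez]] hf'].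
case/andP=> p0 al; case: (ltnP 1 (tag p.1)) => [p1|p1] cnt.
  have e0 : eps z = 0 by rewrite ez eps_other // neq_ltn p1 orbT.
  rewrite e0 (lin0 (ksign_lin pA true)) (lin0 (@word1_lin _ A)) tmul0l addr0.
  apply: (ml0 (@word_multilinear _ A)); rewrite inE (noeps l) ?orbT //.
  by move: cnt; case: (count _ _).
have t0 : tau t z = 0 by rewrite ez tau_low.
rewrite add0n in cnt; rewrite t0 (IH _ s hf' al cnt) tmul0r addr0.
by apply: (ml0 (@word_multilinear _ A)); rewrite mem_head.
Qed.

Lemma tder2_tensm0 (l : seq ({a : nat & C a} * bool)) z : all (fun p => 0 < tag p.1)%N l ->
  count (fun p => 1 < tag p.1)%N l != 1%N ->
  tder2 eps (tau t) (tensm (cms A l) z) = 0.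
Proof.
move=> al cnt; have ld := tder2_lin pA le ltau.
have lm := tensm_lin pA (@cms_lins _ _ _ A l).
move: z; apply: T_ext => [||w].
- exact: (lin_comp ld lm).
- exact: lin_zero.
rewrite tensm_word //; last exact: cms_lins.
rewrite cms_arity; case: eqP => [sw|_]; last exact: lin0 ld.
have [zs [-> sz hz]] := tensw_cms sw; rewrite tder2_word //.
exact: dw_count hz al cnt.
Qed.

Lemma ksign_ksign p (x : A) : k (ksign p x) = ksign (~~ p) x.
Proof. by case: p; rewrite //= (ksignK pA). Qed.

Lemma eps_one (x : A) : eps (sten one (word [:: x])) = x.
Proof. by have [_ h1 _] := hone; rewrite eps1 // h1 scale1r letter_word. Qed.

Lemma tau_one x : tau t (sten one x) = 0.
Proof. exact: tau_low. Qed.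

Lemma tensw_insert a (c : C a) p w1 w2 w3 : size w2 = a ->
  tensw (cms A (nseq (size w1) (o, false) ++ (existT _ a c, p) :: nseq (size w3) (o, false))) (w1 ++ w2 ++ w3) =
  word ([seq (sten one (word [:: ksign p x]) : schur C A) | x <- w1] ++
    (sten c (word w2) : schur C A) :: [seq (sten one (word [:: x]) : schur C A) | x <- w3]).
Proof.
have cnt0 m : count id (unzip2 (cms A (nseq m (o, false)))) = 0%N.
  by elim: m => //= m ->.
move=> sw2; elim: w1 => [|x w1 IH].
  rewrite /= take_size_cat // drop_size_cat // cnt0 map_id tensw_ones //.
  by rewrite tmul_word.
rewrite /= take0 drop0 -/(cms A _) IH tmul_word /=.
suff -> : odd (count id (unzip2 (cms A (nseq (size w1) (o, false) ++
  (existT _ a c, p) :: nseq (size w3) (o, false))))) = p by [].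
rewrite /cms map_cat /unzip2 map_cat count_cat -/(cms A _) -/(unzip2 _) cnt0 add0n /=.
by rewrite -/(cms A _) -/(unzip2 _) cnt0 addn0 oddb.
Qed.

(** The twist [~~ p] joins p, from the inner cooperation, with the odd degree of tau: t^nu'' has
    degree |nu''| - 1. *)
Lemma dw_insert a (c : C a) p w1 w2 w3 :
  dw eps (tau t) ([seq (sten one (word [:: ksign p x]) : schur C A) | x <- w1] ++
    (sten c (word w2) : schur C A) :: [seq (sten one (word [:: x]) : schur C A) | x <- w3]) =
  word ([seq ksign (~~ p) x | x <- w1] ++ tau t (sten c (word w2)) :: w3).
Proof.
elim: w1 => [|x w1 IH] /=.
  rewrite dw_zero ?tmul0r ?addr0 => [|z /mapP[x _ ->]]; last exact: tau_one.
  by rewrite -map_comp (eq_map (g := id)) ?map_id // => x /=; rewrite eps_one.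
rewrite IH tau_one eps_one ksign_ksign tmul_word /= (ml0 (@word_multilinear _ A)) ?add0r //.
exact: mem_head.
Qed.

Lemma tder2_insert m1 m2 a (c : C a) p z :
  tder2 eps (tau t) (tensm (cms A (nseq m1 (o, false) ++ (existT _ a c, p) :: nseq m2 (o, false))) z) =
  tensm [:: (m1, id, false); (a, (fun x => word [:: tau t (sten c x)]), ~~ p); (m2, id, false)] z.
Proof.
set l := _ ++ _; have ld := tder2_lin pA le ltau.
have lm := tensm_lin pA (@cms_lins _ _ _ A l).
set ms := [:: _; _; _].
have lms : @lins _ A A ms.
  move=> m /= [<-|[<-|[<-|//]]] //=.
  exact: (lin_comp (@word1_lin _ A) (lin_comp ltau (@sten_linr _ _ C A a c))).
move: z; apply: T_ext => [||w].
- exact: (lin_comp ld lm).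
- exact: tensm_lin.
rewrite !tensm_word //; last exact: cms_lins.
rewrite cms_arity.
have -> : sumn [seq tag p.1 | p <- l] = sumn [seq m.1.1 | m <- ms].
  rewrite /l map_cat sumn_cat /= !map_nseq /= addn0 !sumn_nseq !mul1n //.
case: eqP => [sw|_]; last exact: lin0 ld.
move: sw; rewrite /= addn0 => sw.
pose w1 := take m1 w; pose w2 := take a (drop m1 w); pose w3 := drop a (drop m1 w).
have s1 : size w1 = m1 by rewrite size_takel // sw leq_addr.
have s2 : size w2 = a by rewrite size_takel // size_drop sw addKn leq_addr.
have s3 : size w3 = m2 by rewrite !size_drop sw addKn addKn.
have ew : w = w1 ++ w2 ++ w3 by rewrite !cat_take_drop.
rewrite {1}ew /l -s1 -s3 tensw_insert // tder2_word // dw_insert s1 s3.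
rewrite /= -/w1 -/w2 -/w3 tmul1r !addn0 oddb !map_id (take_oversize (s := w3)) ?s3 //.
by rewrite tmul_word /= tmul_word.
Qed.

Definition qcms n (q : qterm C n) : seq ({a : nat & C a} * bool) :=
  nseq (qpos q).-1 (o, false) ++ (existT (fun a => C a : Type) (qar'' q) (qins q), isodd (qdeg'' q)) ::
  nseq (qar' q - qpos q) (o, false).

Lemma isodd_pred i : isodd (i - 1) = ~~ isodd i.
Proof. by rewrite isoddD addbT. Qed.

(** In C[eps; tau] Delta the term nu o 1^n vanishes, 1 o nu gives the part of weight 1, and of the
    middle terms only the quadratic ones survive. The sign is that of the odd tau passing nu'. *)
Lemma t_quadratic n i (nu : C n) ts qs (y : T A) : homog i nu -> (1 < n)%N ->
  coproduct_terms one i nu ts -> quadratic_terms one i ts qs ->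
  t (sten nu y) = sten one (word [:: component t nu y]) +
    \sum_(q <- qs) sgnz K (qdeg' q) *: sten (qtop q) (comp_circ t q (permw (labels (qsigma q)) y)).
Proof.
move=> hnu n1 [hts hD] [hqs hS].
pose Phi (u : CC C n) := smap (C := C) true (tder2 eps (tau t)) (ccev u y).
have lP : linear Phi by exact: (lin_comp (smap_lin (C := C) true tet) (ccev_linl pA y)).
have k1 : k one = one by rewrite (ksign_pure true (one_pure hone)) scale1r.
have E1 : Phi (cten nu (nseq n o) 1%g) = 0.
  rewrite /Phi (ccev_ones (one_pure hone)) // smap_sten // tder2_tensm0 ?sten0r //.
    by rewrite all_nseq orbT.
  by rewrite count_nseq.
have E2 : Phi (cten one [:: existT _ n nu] 1%g) = sten one (word [:: component t nu y]).
  by rewrite /Phi (ccev_top one pA y (hom_pure (C_parited C n) hnu)) smap_sten // k1 tder2_word //= tmul0r addr0.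
(* Terms whose number of inner factors of arity above 1 differs from one vanish by
   [tder2_tensm0]. *)
have E3 : \sum_(q <- ts) Phi (term_val q) =
    \sum_(q <- ts | count (fun a => (1 < a)%N) (arities q) == 1%N) Phi (term_val q).
  elim: hts {hD hS} => [|q l [hq [_ sq sn /andP[ha _] hs]] _ IH]; first by rewrite !big_nil.
  rewrite !big_cons IH; case: ifP => // /negbT cnt.
  rewrite /Phi (ccev_term pA y hq) // smap_sten // tder2_tensm0 ?sten0r ?add0r //.
    rewrite all_map; move: ha; rewrite /arities all_map; apply: sub_all => p /=.
    by case/andP.
  by move: cnt; rewrite /arities !count_map.
rewrite (t_formula om) (Delta_sten pA) hD -[LHS]/(Phi _) !(linD lP) (lin_sum lP) E1 add0r E2 E3.
congr (_ + _); rewrite -(lin_sum lP) hS (lin_sum lP).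
elim: hqs {hS} => [|q l [[h1 h2 h3] [_ _ hn /andP[p0 p1] hs]] _ IH]; first by rewrite !big_nil.
rewrite !big_cons IH; congr (_ + _).
have hl : List.Forall (fun p => pure p.2 (tagged p.1)) (qcms q).
  apply/List.Forall_app; split; first by apply: Forall_nseq; exact: one_pure hone.
  constructor; first exact: (hom_pure (C_parited C _) h2).
  by apply: Forall_nseq; exact: one_pure hone.
have sl : size (qcms q) = qar' q by rewrite size_cat /= !size_nseq; lia.
have sn : sumn [seq tag p.1 | p <- qcms q] = n.
  rewrite /qcms map_cat sumn_cat /= !map_nseq /= !sumn_nseq !mul1n; lia.
have eq : qterm_val one q = cten (qtop q) (unzip1 (qcms q)) (qsigma q).
  by rewrite /qterm_val /qcms /unzip1 map_cat /= !map_nseq.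
rewrite /Phi eq (@ccev_cten _ _ _ A pA n _ (qtop q) _ (qsigma q) y sl sn hs hl) smap_sten //.
rewrite tder2_insert /comp_circ isodd_pred (ksign_pure true (hom_pure (C_parited C _) h1)).
by rewrite stenZl.
Qed.

(** F' and H' satisfy the same recursion V = P + V tH; the pair (P, phi) will be (F, f) or (H, h).
    The term P drops out as eps P = phi eps and n > 1. *)
Lemma series_component (X : chain K) (P : schur C A -> schur C X) (phi : A -> X)
    (hh : {linear T A -> T A}) n i (nu : C n) ts qs (x : T A) :
  linear P -> linear phi -> (forall z, eps (P z) = phi (eps z)) -> thickmap sym hh ->
  let V y := \sum_(m \in [set: nat]) P (iter m (t \o smap (C := C) true hh) y) in
  homog i nu -> (1 < n)%N -> coproduct_terms one i nu ts -> quadratic_terms one i ts qs ->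
  eps (V (sten nu x)) = sgnz K i *: phi (component t nu (hh x)) +
    \sum_(q <- qs) sgnz K (qdeg'' q) *:
      eps (V (sten (qtop q) (comp_circ t q (permw (labels (qsigma q)) (hh x))))).
Proof.
move=> lP lphi eP th V hnu n1 hts hqs.
set N := t \o smap (C := C) true hh.
have lH := smap_lin (C := C) true th.
have lN : linear N by exact: (lin_comp (linearP t) lH).
have Hw m y : wlt m y -> wlt m (smap (C := C) true hh y).
  by move=> w m' l; rewrite -(smap_swt _ th) w // (lin0 lH).
have low m y : wlt m.+1 y -> wlt m (N y) by move=> w; apply: (t_low om); apply: Hw.
have lV : linear V := ser_lin lP lN low.
have Vrec y : V y = P y + V (N y) := ser_rec lP lN low y.
have leX := eps_lin (C := C) (chain_parited X).
have Vone z : eps (V (sten one z)) = phi (letter z).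
  have [_ h1 _] := hone.
  rewrite Vrec /N /= (t_wt1 hone om) ?(lin0 lV) ?addr0; last by apply: Hw; apply: wlt_sten.
  by rewrite eP eps1 // h1 scale1r.
rewrite Vrec (linD leX) eP (eps_other pA) ?(lin0 lphi) ?add0r; last by rewrite neq_ltn n1 orbT.
rewrite {1}/N /= smap_sten // (ksign_pure true (hom_pure (C_parited C n) hnu)) stenZl linearZ /=.
rewrite (t_quadratic _ hnu n1 hts hqs) (linZ lV) (linZ leX) (linD lV) (linD leX) Vone letter_word.
rewrite scalerDr; congr (_ + _); rewrite (lin_sum lV) (lin_sum leX) scaler_sumr.
case: hqs => hqs _; elim: hqs => [|q l [[_ _ h3] _] _ IH]; first by rewrite !big_nil.
rewrite !big_cons IH; congr (_ + _); rewrite (linZ lV) (linZ leX) scalerA; congr (_ *: _).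
(* H passing nu gives (-1)^|nu| and tau passing nu' gives (-1)^|nu'|; since |nu| = |nu'| + |nu''|,
   the product is (-1)^|nu''|. *)
rewrite /sgnz /= -signr_addb -h3 isoddD.
by case: (isodd (qdeg' q)); case: (isodd (qdeg'' q)).
Qed.
End QuadraticFormulas.

(** The first two formulas are f and h applied to one expansion, [tau_trG]; the last two are
    instances of [series_component]. *)
Theorem components_and_independence (K : comPzRingType) (sym : bool) (C : cooperad K sym) (one : C 1%N)
    (A B : chain K) (f : {linear A -> B}) (g : {linear B -> A}) (h : {linear A -> A})
    (t : {linear schur C A -> schur C A}) (hh : {linear T A -> T A}) :
  connected one -> contraction f g h -> omega_algebra t ->
  thick_homotopy sym f g h hh ->
  forall (n : nat) (i : int) (nu : C n) (ts : seq (term C n)) (qs : seq (qterm C n)),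
  (2 <= n)%N -> homog i nu ->
  coproduct_terms one i nu ts -> quadratic_terms one i ts qs ->
  [/\ forall x : T B,
        component (trt f g t hh) nu x =
        f (component t nu (tmap g x)) +
        \sum_(q <- ts) f (component t (ttop q)
          (comp_ins (trG g t hh) (tins q) (permw (labels (tsigma q)) x))),
      forall x : T B,
        component (trG g t hh) nu x =
        h (component t nu (tmap g x)) +
        \sum_(q <- ts) h (component t (ttop q)
          (comp_ins (trG g t hh) (tins q) (permw (labels (tsigma q)) x))),
      forall x : T A,
        component (trF f t hh) nu x =
        sgnz K i *: f (component t nu (hh x)) +
        \sum_(q <- qs) sgnz K (qdeg'' q) *:
          component (trF f t hh) (qtop q)
            (comp_circ t q (permw (labels (qsigma q)) (hh x))) &
      forall x : T A,
        component (trH t hh) nu x =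
        sgnz K i *: h (component t nu (hh x)) +
        \sum_(q <- qs) sgnz K (qdeg'' q) *:
          component (trH t hh) (qtop q)
            (comp_circ t q (permw (labels (qsigma q)) (hh x)))].
Proof.
move=> hone hc om ht n i nu ts qs n1 hnu hts hqs.
have pA := chain_parited A; have pB := chain_parited B.
have lf : linear f := linearP f; have lh : linear h := linearP h.
have tf := thickmap_tmap sym pA pB lf (f_par hc).
have eF z : scounit (counit C) (smap (C := C) false (tmap f) z) = f (scounit (counit C) z).
  by apply: (eps_smap _ _ pA pB tf lf) => x; rewrite tmap_word.
split=> x.
- rewrite /component (trt_trG hc om ht) eF -[scounit _ (t _)]/(tau t _).
  by rewrite (tau_trG hone hc om ht x hnu n1 hts) (linD lf) (lin_sum lf).
- rewrite /component (kap_rec hc om ht) (eps_other pB) ?(lin0 (linearP g)) ?add0r; last by rewrite neq_ltn n1 orbT.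
  by rewrite (tau_trG hone hc om ht x hnu n1 hts) (linD lh) (lin_sum lh).
- exact: (series_component hone om x (F_lin hc) lf eF (hh_thick ht) hnu n1 hts hqs).
- exact: (series_component hone om x (H_lin ht) lh (eps_H ht) (hh_thick ht) hnu n1 hts hqs).
Qed.

(** * Weighted pseudo-derivations *)

Definition mklin (K : pzRingType) (U V : lmodType K) (f : U -> V) (lf : linear f) : {linear U -> V} :=
  HB.pack f (GRing.isLinear.Build K U V *:%R f lf).

Lemma part_map (K : comPzRingType) (A B : gmod K) (f : A -> B) b (x : A) : linear f -> parmap false f ->
  part b (f x) = f (part b x).
Proof. by move=> lf ef; rewrite /part; case: b; rewrite ef /part /= ?(linB lf). Qed.

Lemma homog_word1 (K : comPzRingType) (A : gmod K) i (x : A) : homog i x -> homog i (word [:: x] : T A).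
Proof.
move=> hx; apply: span_gen; exists [:: (i, x)]; split=> //; last by rewrite big_seq1.
by constructor.
Qed.

Lemma homog_tmul (K : comPzRingType) (A : gmod K) i j (x y : T A) :
  homog i x -> homog j y -> homog (i + j) (tmul x y).
Proof.
move=> hx hy; apply: (span_image (tmul_linl y) _ hx) => _ [u [hu <- ->]].
apply: (span_image (tmul_linr _) _ hy) => _ [v [hv <- ->]].
apply: span_gen; exists (u ++ v); split.
- by apply/List.Forall_app.
- by rewrite big_cat.
- by rewrite tmul_word map_cat.
Qed.

(** * Tensors graded by the weights of their letters *)

Section ColouredWords.
Variables (K : comPzRingType) (A : gmod K) (pA : parited A).
Variables (I : finType) (i0 : I) (p : I -> A -> A) (om : I -> nat).
Hypotheses (p_lin : forall i, linear (p i)) (p_par : forall i, parmap false (p i)).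
Hypothesis p_sum : forall x, \sum_i p i x = x.
Hypothesis p_orth : forall i j x, p i (p j x) = if j == i then p j x else 0.

Local Notation cwt cs := (sumn (map om cs)).

(** The total weight of the colours, unrelated to the tensor length selected by [wt]. A colouring is
    a list of indices such that each letter is fixed by the projection of its own colour. *)
Definition homW n : T A -> Prop := span (fun x => exists cs w,
  [/\ size cs = size w, partw p cs w = w, cwt cs = n & x = word w]).

Lemma homW_word cs w : size cs = size w -> partw p cs w = w -> homW (cwt cs) (word w).
Proof. by move=> s e; apply: span_gen; exists cs, w. Qed.

Lemma homW_word1 i x : p i x = x -> homW (om i) (word [:: x]).
Proof. by move=> e; have := @homW_word [:: i] [:: x]; rewrite /partw /= addn0 e; apply. Qed.

Lemma homW_tmul a b x y : homW a x -> homW b y -> homW (a + b) (tmul x y).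
Proof.
move=> hx hy; apply: (span_image (tmul_linl y) _ hx) => _ [cs [u [su eu <- ->]]].
apply: (span_image (tmul_linr _) _ hy) => _ [ds [v [sv ev <- ->]]].
rewrite tmul_word -sumn_cat -map_cat; apply: homW_word; first by rewrite !size_cat su sv.
by rewrite /partw zip_cat // map_cat; congr (_ ++ _).
Qed.

Lemma coloured_exists (w : seq A) : (forall x, x \in w -> exists i, p i x = x) ->
  exists cs, size cs = size w /\ partw p cs w = w.
Proof.
elim: w => [|x w IH] h; first by exists [::].
have [i ei] := h x (mem_head _ _).
have [|cs [s e]] := IH; first by move=> y hy; apply: h; rewrite inE hy orbT.
by exists (i :: cs); rewrite /= s; split=> //; rewrite /partw /= ei; congr (_ :: _).
Qed.

Lemma T_colour_ext (M : lmodType K) (f g : T A -> M) : linear f -> linear g ->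
  (forall cs w, size cs = size w -> partw p cs w = w -> f (word w) = g (word w)) -> f =1 g.
Proof.
move=> lf lg e; apply: (@T_letters_ext _ A M f g (fun x => exists i, p i x = x)) => // [a|w hw].
  rewrite -(p_sum a); elim/big_rec: _ => [|i x _ hx]; first exact: span0.
  by apply: span_add => //; apply: span_gen; exists i; rewrite p_orth eqxx.
by have [cs [s ec]] := coloured_exists hw; apply: e s ec.
Qed.

Lemma T_homW_ext (M : lmodType K) (f g : T A -> M) : linear f -> linear g ->
  (forall n x, homW n x -> f x = g x) -> f =1 g.
Proof. by move=> lf lg e; apply: T_colour_ext => // cs w s ec; apply: e (homW_word s ec). Qed.

Lemma partw_coloured cs (w : seq A) : size cs = size w -> partw p cs w = w ->
  colored p (fun j => nth i0 cs j) w.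
Proof.
move=> s e j i; case: (ltnP j (size w)) => l; last first.
  by rewrite nth_default // (lin0 (p_lin i)); case: ifP.
by rewrite -e /partw (nth_map (i0, 0)) ?size_zip ?s ?minnn // nth_zip //= p_orth.
Qed.

Lemma homW_tder2 be n x : linear be -> (forall i x, be (p i x) = p i (be x)) ->
  homW n x -> homW n (tder2 id be x).
Proof.
move=> lb cb; have ld := tder2_lin pA (@lin_id _ _) lb.
apply: (span_image ld) => _ [cs [w [s e <- ->]]]; rewrite tder2_word //.
rewrite -/(homW _ _); elim: w cs s e => [|y w IH] [|c cs] // s; first by move=> _; apply: span0.
rewrite {1}/partw /= => -[ey ew]; case: s => s; have {}IH := IH cs s ew.
apply: span_add.
  rewrite word_cons map_id; apply: homW_tmul; last exact: homW_word.
  by apply: homW_word1; rewrite -cb ey.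
apply: homW_tmul => //; apply: homW_word1.
by rewrite -[in RHS]ey /ksign (linB (p_lin _)) !mulr2n (linD (p_lin _)) -p_par ey.
Qed.

Lemma homW_ksign n x : homW n x -> homW n (ksign true x).
Proof.
apply: (span_image (ksign_lin (T_parited pA) true)) => _ [cs [w [s e <- ->]]].
rewrite ksign_word //; apply: homW_word; first by rewrite size_map.
rewrite -[in RHS]e /partw; apply: (@eq_from_nth _ 0); rewrite !size_map !size_zip ?size_map s ?size_map minnn //.
move=> j l; have la : (j < size cs)%N by rewrite s.
rewrite !(nth_map (i0, 0)) ?size_zip ?size_map ?s ?minnn //.
rewrite (nth_map 0) ?size_map ?size_zip ?s ?minnn // (nth_map (i0, 0)) ?size_zip ?s ?minnn //.
rewrite !nth_zip ?size_map //= (nth_map 0) //.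
by rewrite /ksign (linB (p_lin _)) !mulr2n (linD (p_lin _)) p_par.
Qed.

Lemma homW_wt m n x : homW n x -> homW n (wt m x).
Proof.
apply: (span_image (@wt_lin _ A m)) => _ [cs [w [s e <- ->]]].
by rewrite wt_word; case: ifP => _; [apply: homW_word|apply: span0].
Qed.

Lemma homW_permw m L n x : perm_eq L (iota 0 m) -> homW n x -> homW n (permw L x).
Proof.
move=> pL; apply: (span_image (permw_lin pA L)) => _ [cs [w [s e <- ->]]].
rewrite permw_word // /permphi; case: ifP => [pw|_]; last exact: span0.
have memL j : j \in L -> (j < size w)%N by rewrite (perm_mem pw) mem_iota add0n.
rewrite /tsum; elim/big_rec: _ => [|bs x' _ hx]; first exact: span0.
apply: span_add => //; apply: span_scale.
have -> : cwt cs = cwt [seq nth i0 cs j | j <- L].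
  rewrite !sumnE !big_map (perm_big _ pw) -{1}(mkseq_nth i0 cs) /mkseq big_map s.
  by [].
apply: homW_word; first by rewrite !size_map.
rewrite /partw; elim: (L) memL => //= j L' IH h.
rewrite IH => [|i hi]; last by apply: h; rewrite inE hi orbT.
congr (_ :: _); rewrite -(part_map _ _ (p_lin _) (p_par _)) //.
by rewrite (partw_coloured s e) eqxx.
Qed.
End ColouredWords.

Section WeightedHomotopy.
Variables (A B : chain rat) (f : {linear A -> B}) (g : {linear B -> A}) (h : {linear A -> A}).
Hypothesis hc : contraction f g h.
Variables (I : finType) (i0 : I) (p : I -> A -> A) (om : I -> nat).
Hypotheses (p_lin : forall i, linear (p i)) (p_hom : forall i j x, homog j x -> homog j (p i x)).
Hypothesis p_sum : forall x, \sum_i p i x = x.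
Hypothesis p_orth : forall i j x, p i (p j x) = if j == i then p j x else 0.
Hypothesis p_d : forall i x, diff A (p i x) = p i (diff A x).
Hypothesis p_h : forall i x, h (p i x) = p i (h x).
Hypothesis p_gf : forall x, p i0 x = g (f x).
Hypothesis om_eq0 : forall i, (om i == 0%N) = (i == i0).

Local Notation cwt cs := (sumn (map om cs)).
Local Notation hom := (homW p om).

Let pA := chain_parited A.
Let pB := chain_parited B.
Let pTA := T_parited pA.
Let lh : linear h := linearP h.
Let ld : linear (diff A) := linearP (diff A).
Let lf : linear f := linearP f.
Let lg : linear g := linearP g.
Let p_par i : parmap false (p i).
Proof. by apply: (hom0_par pA pA) => // j x; apply: p_hom. Qed.

Definition wh (x : A) : A := \sum_i (om i)%:R *: h (p i x).

Lemma wh_lin : linear wh.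
Proof. by apply: lin_bigsum => i; apply: lin_scale; apply: lin_comp. Qed.

Lemma p_wh i x : wh (p i x) = (om i)%:R *: h (p i x).
Proof.
rewrite /wh (bigD1 i) //= p_orth eqxx big1 ?addr0 // => j ne.
by rewrite p_orth eq_sym (negbTE ne) (lin0 lh) scaler0.
Qed.

Lemma wh_p i x : wh (p i x) = p i (wh x).
Proof.
rewrite p_wh /wh (lin_sum (p_lin i)) (bigD1 i) //= big1 ?addr0 => [|j ne].
  by rewrite (linZ (p_lin i)) -p_h p_orth eqxx.
by rewrite (linZ (p_lin i)) -p_h p_orth (negbTE ne) (lin0 lh) scaler0.
Qed.

Lemma hom_scale i a (x : A) : homog i x -> homog i (a *: x).
Proof.
move=> hx; have [h0 hl _ _ _ _] := chain_graded A.
by rewrite -[_ *: _]addr0; apply: hl.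
Qed.

Lemma wh_hom i x : homog i x -> homog (i + 1) (wh x).
Proof.
move=> hx; have [h0 hl _ _ _ _] := chain_graded A.
rewrite /wh; elim/big_rec: _ => [|j y _ hy]; first exact: h0.
by apply: hl => //; apply: (ctr_h_hom hc); apply: p_hom.
Qed.

Lemma wh_par : parmap true wh.
Proof. exact: (@parmap_homog _ _ _ 1 _ pA pA wh_lin wh_hom). Qed.

Definition wder : T A -> T A := tder2 id wh.
Definition dder : T A -> T A := tder2 id (diff A).

Lemma wder_lin : linear wder. Proof. exact: (tder2_lin pA (@lin_id _ _) wh_lin). Qed.
Lemma dder_lin : linear dder. Proof. exact: (tder2_lin pA (@lin_id _ _) ld). Qed.

Lemma wder_hom n x : hom n x -> hom n (wder x).
Proof. by apply: homW_tder2 => //; [exact: wh_lin|exact: wh_p]. Qed.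

Lemma der_tmul be x y : linear be ->
  tder2 id be (tmul x y) = tmul (tder2 id be x) y + tmul (ksign true x) (tder2 id be y) :> T A.
Proof. by move=> lb; rewrite (tder2_tmul _ _ pA pA (@lin_id _ _) lb (@id_par _ A)) !tmap_id. Qed.

Lemma ksign_der be x : linear be -> parmap true be ->
  ksign true (tder2 id be x : T A) = - tder2 id be (ksign true x).
Proof. by move=> lb ob; apply: (ksign_tder2 x pA pA) => //. Qed.

(** The anticommutator of two odd derivations is an even derivation, so its eigenvalues add up on
    products. *)
Lemma anticomm_tmul be ga a b x y : linear be -> linear ga -> parmap true be -> parmap true ga ->
  tder2 id be (tder2 id ga x) + tder2 id ga (tder2 id be x) = a *: x :> T A ->
  tder2 id be (tder2 id ga y) + tder2 id ga (tder2 id be y) = b *: y :> T A ->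
  tder2 id be (tder2 id ga (tmul x y)) + tder2 id ga (tder2 id be (tmul x y)) = (a + b) *: tmul x y :> T A.
Proof.
move=> lb lg' ob og e1 e2.
have lB : linear (tder2 id be : T A -> T A) by exact: tder2_lin.
have lG : linear (tder2 id ga : T A -> T A) by exact: tder2_lin.
rewrite !der_tmul // (linD lB) (linD lG) !der_tmul // !(ksignK pTA true) !ksign_der // !tmulNl.
rewrite scalerDl -tmulZl -tmulZr -e1 -e2 tmulDl tmulDr; abel.
Qed.

Lemma wh_col c x : p c x = x -> wh x = (om c)%:R *: h x.
Proof. by move=> e; rewrite -e p_wh e. Qed.

(** Off the summand [i0] the map gf vanishes and dh + hd = -1; on [i0] the weight is 0. *)
Lemma d_wh c x : p c x = x -> diff A (wh x) + wh (diff A x) = - (om c)%:R *: x.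
Proof.
move=> e; rewrite (wh_col e) (@wh_col c) -?p_d ?e // (linZ ld) -scalerDr (ctr_h_diff hc) -p_gf.
rewrite -{1}e p_orth scaleNr -scalerN; case: eqP => [e0|_]; last by rewrite sub0r.
by have := om_eq0 c; rewrite e0 eqxx => /eqP ->; rewrite !scale0r.
Qed.

Lemma der1 be y : linear be -> tder2 id be (word [:: y] : T A) = word [:: be y].
Proof. by move=> lb; rewrite tder2_word //= tmul0r addr0. Qed.

Lemma anticomm be ga (a : I -> rat) : linear be -> linear ga -> parmap true be -> parmap true ga ->
  (forall c x, p c x = x -> be (ga x) + ga (be x) = a c *: x) ->
  forall cs w, size cs = size w -> partw p cs w = w ->
  tder2 id be (tder2 id ga (word w)) + tder2 id ga (tder2 id be (word w)) =
  (\sum_(c <- cs) a c) *: word w :> T A.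
Proof.
move=> lb lg' ob og e cs w; elim: w cs => [|x w IH] [|c cs] // s ec.
  have lB : linear (tder2 id be : T A -> T A) by exact: tder2_lin.
  have lG : linear (tder2 id ga : T A -> T A) by exact: tder2_lin.
  by rewrite !tder2_word //= ?(lin0 lB) ?(lin0 lG) addr0 big_nil scale0r.
move: ec; rewrite {1}/partw /= => -[ex ew]; case: s => s; have {}IH := IH cs s ew.
rewrite word_cons big_cons; apply: anticomm_tmul => //.
have l1 := @word1_lin _ A.
by rewrite !der1 // -(linD l1) -(linZ l1) (e c).
Qed.

Lemma dder_wder n x : hom n x -> dder (wder x) + wder (dder x) = - n%:R *: x.
Proof.
move: x; apply: span_ext => [||_ [cs [w [s e <- ->]]]].
- by apply: lin_add; [exact: (lin_comp dder_lin wder_lin)|exact: (lin_comp wder_lin dder_lin)].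
- exact: lin_scale (@lin_id _ _).
have := anticomm ld wh_lin (@diff_par _ A) wh_par d_wh s e; rewrite /dder /wder => ->; congr (_ *: _).
by rewrite sumnE big_map natr_sum -sumrN.
Qed.

Lemma half0 (V : lmodType rat) (v : V) : v + v = 0 -> v = 0.
Proof.
move=> e; have : (2%:R^-1 : rat) *: (v + v) = 0 by rewrite e scaler0.
by rewrite -mulr2n -scaler_nat scalerA mulVf ?scale1r.
Qed.

(** Twice the square is an anticommutator, hence a derivation; it vanishes on letters since h
    commutes with the projections and hh = 0. *)
Lemma wder_wder x : wder (wder x) = 0.
Proof.
move: x; apply: (T_homW_ext p_sum p_orth (om := om)) => [||n].
- exact: (lin_comp wder_lin wder_lin).
- exact: lin_zero.
apply: span_ext => [||_ [cs [w [s e _ ->]]]]; [exact: (lin_comp wder_lin wder_lin)|exact: lin_zero|].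
apply: half0; have := anticomm (a := fun=> 0) wh_lin wh_lin wh_par wh_par _ s e.
rewrite /wder big1 // scale0r; apply=> c x ex; rewrite scale0r (wh_col ex) (linZ wh_lin).
rewrite (@wh_col c) -?p_h ?ex // (ctr_hh hc) !scaler0 addr0 //.
Qed.

Lemma ksign_wder x : ksign true (wder x) = - wder (ksign true x).
Proof. exact: (ksign_der x wh_lin wh_par). Qed.

Lemma wder_tmul x y : wder (tmul x y) = tmul (wder x) y + tmul (ksign true x) (wder y).
Proof. exact: (der_tmul x y wh_lin). Qed.

Lemma hom0_letters cs w : size cs = size w -> partw p cs w = w -> cwt cs = 0%N ->
  forall x, x \in w -> p i0 x = x.
Proof.
elim: w cs => [|y w IH] [|c cs] // [s]; rewrite {1}/partw /= => -[ey ew] /eqP.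
rewrite addn_eq0 om_eq0 => /andP[/eqP ec /eqP e0] x; rewrite inE => /predU1P[->|hx].
  by rewrite -ec.
exact: (IH cs).
Qed.

Lemma homn_letter cs w : size cs = size w -> partw p cs w = w -> cwt cs != 0%N ->
  exists2 x, x \in w & p i0 x = 0.
Proof.
elim: w cs => [|y w IH] [|c cs] // [s]; rewrite {1}/partw /= => -[ey ew].
rewrite addn_eq0 om_eq0; case: eqP => [_|ne] /= => [n|_].
  by have [x hx ex] := IH cs s ew n; exists x; rewrite // inE hx orbT.
by exists y; rewrite ?mem_head // -ey p_orth; case: eqP.
Qed.

(** Weight 0 forces all letters into the summand [i0], where the rescaled homotopy is 0. *)
Lemma wder_hom0 x : hom 0 x -> wder x = 0.
Proof.
move: x; apply: span_ext => [||_ [cs [w [s e n ->]]]]; [exact: wder_lin|exact: lin_zero|].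
rewrite /wder tder2_word //; last exact: wh_lin.
apply: dw_zero => x /(hom0_letters s e n) ex; rewrite (wh_col ex).
by have := om_eq0 i0; rewrite eqxx => /eqP ->; rewrite scale0r.
Qed.

(** gf projects to the summand [i0], and a word of positive weight has a letter in another
    summand. *)
Lemma gf_hom n x : hom n x -> tmap g (tmap f x) = if n == 0%N then x else 0.
Proof.
move: x; apply: span_ext => [||_ [cs [w [s e <- ->]]]].
- exact: (lin_comp (tmap_lin lg) (tmap_lin lf)).
- by case: (n == 0%N); [exact: lin_id|exact: lin_zero].
rewrite !tmap_word // -map_comp; case: eqP => [en|/eqP en].
  by congr word; apply: map_id_in => x /(hom0_letters s e en); rewrite p_gf.
have [x hx] := homn_letter s e en; rewrite p_gf => x0.
by apply: (ml0 (@word_multilinear _ A)); apply/mapP; exists x.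
Qed.

(** The letters are split into coloured components because the divisor depends on the colouring. In
    weight 0 the divisor is 0, whose inverse is 0 in [rat]; this realises the choice of the zero map
    there. *)
Definition hwphi (w : seq A) : T A :=
  tsum (size w) predT (fun cs => (cwt cs)%:R^-1 *: wder (word (partw p cs w))).

Lemma hwphi_ml : multilinear hwphi.
Proof.
move=> l r a x y; rewrite /hwphi !size_cat /=; move: a x y; apply: tsum_lin => cs s; apply: lin_scale => a x y.
rewrite !(partw_cat i0) // p_lin word_multilinear; exact: wder_lin.
Qed.

Definition hw : {linear T A -> T A} := mklin (lift_lin hwphi_ml).

Lemma hw_hom n x : hom n x -> hw x = n%:R^-1 *: wder x.
Proof.
move: x; apply: span_ext => [||_ [cs [w [s e <- ->]]]]; [exact: linearP|exact: (lin_scale _ wder_lin)|].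
rewrite /= lift_word /hwphi; last exact: hwphi_ml.
have cw := partw_coloured i0 p_lin p_orth s e.
have ecs : cs = map (fun j => nth i0 cs j) (iota 0 (size w)) by rewrite -s -{1}(mkseq_nth i0 cs).
rewrite (@tsum_pure _ _ _ _ _ _ cs) //; first by rewrite e.
move=> bs sb nb; rewrite (ml0 (lin_word wder_lin)) ?scaler0 //.
by apply: (partw_neq i0 cw) => //; rewrite -ecs.
Qed.

Lemma T_hom_ext (M : lmodType rat) (u v : T A -> M) : linear u -> linear v ->
  (forall n x, hom n x -> u x = v x) -> u =1 v.
Proof. exact: (T_homW_ext p_sum p_orth). Qed.

Lemma hw_wt m x : wt m (hw x) = hw (wt m x).
Proof.
move: x; apply: T_hom_ext => [||n x hx]; first exact: (lin_comp (@wt_lin _ A m) (linearP hw)).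
  exact: (lin_comp (linearP hw) (@wt_lin _ A m)).
rewrite (hw_hom hx) (hw_hom (homW_wt m hx)) (linZ (@wt_lin _ A m)) /wder wt_tder2 //; exact: wh_lin.
Qed.

Lemma hw_permw n (s : 'S_n) x : hw (permw (labels s) x) = permw (labels s) (hw x).
Proof.
have lp := permw_lin pA (labels s).
move: x; apply: T_hom_ext => [||m x hx]; first exact: (lin_comp (linearP hw) lp).
  exact: (lin_comp lp (linearP hw)).
have pl := perm_labels s.
rewrite (hw_hom hx) (hw_hom (homW_permw pA i0 p_lin p_par p_orth pl hx)) (linZ lp) /wder.
by rewrite -(permw_tder2 pA pA (@lin_id _ _) wh_lin (@id_par _ A) wh_par x pl).
Qed.

Lemma ttens_lins (phi psi : T A -> T A) m n b b' : linear phi -> linear psi ->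
  lins [:: (m, phi, b); (n, psi, b')].
Proof. by move=> lp ls [[m1 f1] b1] /= [[_ <- _]|[[_ <- _]|[]]]. Qed.

Lemma ttens_lin (phi psi : T A -> T A) m n b b' : linear phi -> linear psi ->
  linear (ttens m n phi b psi b').
Proof. by move=> lp ls; apply: (tensm_lin pA); apply: ttens_lins. Qed.

Lemma ttens_wt (phi psi : T A -> T A) m n b b' x : linear phi -> linear psi ->
  ttens m n phi b psi b' (wt (m + n) x) = ttens m n phi b psi b' x.
Proof.
by move=> lp ls; apply: (tensm_wt pA); [exact: ttens_lins|rewrite /= addn0].
Qed.

Lemma ttens_tmul (phi psi : T A -> T A) m n b b' (x y : T A) : linear phi -> linear psi ->
  wt m x = x -> wt n y = y ->
  ttens m n phi b psi b' (tmul x y) = tmul (phi (ksign b' x)) (psi y).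
Proof.
move=> lp ls <- <-; have lt := ttens_lin m n b b' lp ls; have lk := ksign_lin pTA b'.
have lw k := @wt_lin _ A k.
move: x y; apply: T_ext2 => [y|y|x|x|u v].
- exact: (lin_comp lt (lin_comp (tmul_linl _) (lw m))).
- exact: (lin_comp (tmul_linl _) (lin_comp lp (lin_comp lk (lw m)))).
- exact: (lin_comp lt (lin_comp (tmul_linr _) (lw n))).
- exact: (lin_comp (tmul_linr _) (lin_comp ls (lw n))).
rewrite !wt_word; case: eqP => [su|_]; last by rewrite tmul0l (lin0 lt) (lin0 lk) (lin0 lp) tmul0l.
case: eqP => [sv|_]; last by rewrite tmul0r (lin0 lt) (lin0 ls) tmul0r.
by rewrite tmul_word ttens_word.
Qed.

Lemma wt_wder m x : wt m x = x -> wt m (wder x) = wder x.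
Proof. by move=> e; rewrite /wder wt_tder2 ?e //; exact: wh_lin. Qed.

Lemma wt_ksign m (x : T A) : wt m x = x -> wt m (ksign true x) = ksign true x.
Proof.
move=> {2}<-; have lk := ksign_lin pTA true.
move: x; apply: T_ext => [||w]; [exact: (lin_comp (@wt_lin _ A m) lk)|exact: (lin_comp lk (@wt_lin _ A m))|].
by rewrite wt_word ksign_word // wt_word size_map; case: ifP => _; rewrite ?ksign_word // (lin0 lk).
Qed.

(** Write W for [wder]. As WW = 0, both identities reduce to multiples of W(kx) W(y), with
    coefficient 1/(ab) for the tensor product and (1/a + 1/b)/(a + b) for the other side. *)
Lemma pder_tmul m n a b (x y : T A) : hom a x -> hom b y -> wt m x = x -> wt n y = y ->
  (ttens m n hw true id false (hw (tmul x y)) - ttens m n id false hw true (hw (tmul x y)) =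
     ttens m n hw true hw true (tmul x y)) /\
  (hw (ttens m n hw true id false (tmul x y) - ttens m n id false hw true (tmul x y)) =
     - ttens m n hw true hw true (tmul x y)).
Proof.
move=> hx hy wx wy; have lw : linear hw := linearP hw.
have kx : hom a (ksign true x) by exact: (homW_ksign pA i0 p_lin p_par hx).
have ttE phi psi b1 b2 := @ttens_tmul phi psi m n b1 b2.
have li := @lin_id _ (T A).
have wkx := wt_ksign wx; have wEx := wt_wder wx; have wEy := wt_wder wy.
have Exy : wder (tmul (wder x) y) = - tmul (wder (ksign true x)) (wder y).
  by rewrite wder_tmul wder_wder tmul0l add0r ksign_wder tmulNl.
have Exy' : wder (tmul (ksign true x) (wder y)) = tmul (wder (ksign true x)) (wder y).
  by rewrite wder_tmul wder_wder tmul0r addr0.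
(* If a or b is 0, the factor W(kx) or W(y) vanishes by [wder_hom0]; otherwise the coefficients
   agree as fractions. *)
have R : a%:R^-1 * b%:R^-1 *: tmul (wder (ksign true x)) (wder y) =
    (a + b)%:R^-1 * (a%:R^-1 + b%:R^-1) *: tmul (wder (ksign true x)) (wder y).
  case: (altP (a =P 0%N)) => [a0|an]; first by rewrite (wder_hom0 (x := ksign true x)) -?a0 // tmul0l !scaler0.
  case: (altP (b =P 0%N)) => [b0|bn]; first by rewrite (wder_hom0 (x := y)) -?b0 // tmul0r !scaler0.
  congr (_ *: _); rewrite natrD.
  have a1 : (a%:R : rat) != 0 by rewrite Num.Theory.pnatr_eq0.
  have b1 : (b%:R : rat) != 0 by rewrite Num.Theory.pnatr_eq0.
  have ab : (a%:R + b%:R : rat) != 0 by rewrite -natrD Num.Theory.pnatr_eq0 addn_eq0 negb_and an.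
  by field; rewrite a1 b1 ab.
split.
  rewrite (hw_hom (homW_tmul hx hy)) !(linZ (ttens_lin _ _ _ _ _ _)) // wder_tmul.
  rewrite !(linD (ttens_lin _ _ _ _ _ _)) // !ttE //.
  rewrite (hw_hom (wder_hom hx)) (hw_hom kx) (hw_hom (wder_hom hy)) (hw_hom hy).
  rewrite !wder_wder !(scaler0, tmul0l, tmul0r, add0r, addr0) ksign_wder.
  rewrite !(tmulZl, tmulZr, tmulNl, scalerN, opprK, scalerA) R -scalerDl mulrDr //.
rewrite !ttE // (hw_hom hx) (hw_hom kx) (hw_hom hy).
have hz : hom (a + b) (tmul (a%:R^-1 *: wder x) y - tmul (ksign true x) (b%:R^-1 *: wder y)).
  rewrite -scaleN1r -tmulZl; apply: span_add; apply: homW_tmul => //.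
  - by apply: span_scale; apply: wder_hom.
  - exact: span_scale.
  - by apply: span_scale; apply: wder_hom.
rewrite (hw_hom hz) (linB wder_lin) !(tmulZl, tmulZr) !(linZ wder_lin) Exy Exy'.
rewrite scalerA R mulrDr scalerBr !(scalerN, scalerA) -opprD -scalerDl //.
Qed.

Lemma hw_pder : pseudo_derivation hw.
Proof.
move=> m n x; have lw : linear hw := linearP hw; have li := @lin_id _ (T A).
have t1 := ttens_lin m n true false lw li; have t2 := ttens_lin m n false true li lw.
have t3 := ttens_lin m n true true lw lw.
have e1 := lin_sub (lin_comp t1 lw) (lin_comp t2 lw).
have e2 := lin_comp lw (lin_sub t1 t2).
suff H cs w : size cs = size w -> partw p cs w = w -> let y := word w in
  (ttens m n hw true id false (hw y) - ttens m n id false hw true (hw y) = ttens m n hw true hw true y) /\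
  (hw (ttens m n hw true id false y - ttens m n id false hw true y) = - ttens m n hw true hw true y).
  split; move: x; apply: (T_colour_ext p_sum p_orth) => //; try exact: lin_opp.
    by move=> cs w s e; exact: (H cs w s e).1.
  by move=> cs w s e; exact: (H cs w s e).2.
move=> s e y; rewrite {}/y; case: (altP (size w =P (m + n)%N)) => [sw|nw]; last first.
  rewrite -(ttens_wt m n true false (hw (word w))) // -(ttens_wt m n false true (hw (word w))) // hw_wt.
  rewrite -!(ttens_wt m n _ _ (word w)) // wt_word (negbTE nw).
  by rewrite (lin0 lw) !(lin0 t1) !(lin0 t2) !(lin0 t3) subr0 oppr0 (lin0 lw).
have sm : (m <= size w)%N by rewrite sw leq_addr.
have su : size (take m cs) = size (take m w) by rewrite !size_take s.
have sv : size (drop m cs) = size (drop m w) by rewrite !size_drop s.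
have := e; rewrite -{1}(cat_take_drop m cs) -{1 2}(cat_take_drop m w) /partw zip_cat // map_cat => /eqP.
rewrite eqseq_cat ?size_map ?size_zip ?su ?minnn // => /andP[/eqP eu /eqP ev].
rewrite -(cat_take_drop m w) -tmul_word; apply: pder_tmul.
- exact: homW_word su eu.
- exact: homW_word sv ev.
- by rewrite wt_word size_takel // eqxx.
- by rewrite wt_word size_drop sw addKn eqxx.
Qed.

Lemma hw_homog i (x : T A) : homog i x -> homog (i + 1) (hw x).
Proof.
apply: (span_image (linearP hw)) => _ [w [hw' <- ->]]; rewrite /= lift_word /hwphi; last exact: hwphi_ml.
rewrite /tsum; apply: (big_rec (span _)) => [|cs y _ hy]; first exact: span0.
apply: span_add => //; apply: span_scale; rewrite /wder tder2_word //; last exact: wh_lin.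
have := size_tuple cs; move: (tval cs) => {hy y}{}cs; rewrite size_map.
elim: w cs hw' => [|[j z] w IH] [|c cs] //= hw' s; first exact: span0.
have /= hx := List.Forall_inv hw'; have {}hw' := List.Forall_inv_tail hw'.
case: s => s; have {}IH := IH cs hw' s.
have hp : homog j (p c z) by apply: p_hom.
have hq : homog (\sum_(q <- w) q.1) (word (partw p cs [seq q.2 | q <- w]) : T A).
  elim: (w) (cs) hw' s {IH} => [|[j' x'] w' IH] [|c' cs'] //= hw' s.
    by apply: span_gen; exists [::]; rewrite big_nil.
  rewrite big_cons /partw /= word_cons; apply: homog_tmul.
    by apply: homog_word1; apply: p_hom; exact: (List.Forall_inv hw').
  by apply: IH; [exact: (List.Forall_inv_tail hw')|case: s].
rewrite big_cons /partw /= map_id word_cons; apply: span_add.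
  by rewrite addrAC; apply: homog_tmul => //; apply: homog_word1; exact: wh_hom.
rewrite -addrA; apply: homog_tmul => //; apply: homog_word1.
by rewrite (ksign_pure true (hom_pure pA hp)); exact: hom_scale.
Qed.

(** On a letter the weight cancels against the divisor. The summand [i0] gives 0 on both sides
    because hg = 0. *)
Lemma hw_1 x : hw (word [:: x]) = word [:: h x].
Proof.
have l1 := @word1_lin _ A.
rewrite -{1}(p_sum x) (lin_sum l1) linear_sum -[in RHS](p_sum x) !linear_sum (lin_sum l1).
apply: eq_bigr => c _; have ex : p c (p c x) = p c x by rewrite p_orth eqxx.
rewrite (hw_hom (homW_word1 om ex)) /wder der1; last exact: wh_lin.
rewrite -(linZ l1) p_wh scalerA; have := om_eq0 c; case: eqP => [->|/eqP nz _]; last first.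
  by rewrite mulVf ?scale1r // Num.Theory.pnatr_eq0.
move=> /esym/eqP ->; rewrite mulr0 scale0r p_gf (ctr_hg hc) //.
Qed.

(** By [dder_wder] the anticommutator with d is -n in weight n, which the division turns into -1. In
    weight 0 both sides vanish, gf being the identity there. *)
Lemma hw_diff x : tder (diff A) (hw x) + hw (tder (diff A) x) = tmap g (tmap f x) - x.
Proof.
rewrite !(tder_tder2 pA ld) -!/(dder _); have lw : linear hw := linearP hw.
have lgf := lin_comp (tmap_lin lg) (tmap_lin lf).
move: x; apply: T_hom_ext => [||n x hx].
- by apply: lin_add; [exact: (lin_comp dder_lin lw)|exact: (lin_comp lw dder_lin)].
- exact: (lin_sub lgf (@lin_id _ _)).
have hD : hom n (dder x) by apply: homW_tder2.
rewrite (hw_hom hx) (hw_hom hD) (linZ dder_lin) -scalerDr (dder_wder hx) scalerA mulrN scaleNr (gf_hom hx).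
case: eqP => [->|/eqP n0]; first by rewrite mulr0 scale0r oppr0 subrr.
by rewrite mulVf ?scale1r ?sub0r // Num.Theory.pnatr_eq0.
Qed.

Lemma weighted_homotopy (sym : bool) : thick_homotopy sym f g h hw.
Proof.
have lw : linear hw := linearP hw; have lE := wder_lin.
have fk x : f (wh x) = 0.
  rewrite /wh linear_sum big1 // => i _; rewrite linearZ; have := ctr_fh hc (p i x) => /= ->.
  exact: scaler0.
split.
- by move=> n x; rewrite hw_wt.
- by move=> _ n s x; exact: hw_permw.
- exact: hw_homog.
- exact: hw_pder.
- exact: hw_1.
- exact: hw_diff.
- apply: T_hom_ext => [||n x hx]; [exact: (lin_comp (tmap_lin lf) lw)|exact: lin_zero|].
  rewrite (hw_hom hx) (linZ (tmap_lin lf)) /wder (tmap_tder2 x pA pB (@lin_id _ _) wh_lin lf (f_par hc)).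
  suff -> : tder2 (fun a => f a) (fun a => f (wh a)) x = 0 by rewrite scaler0.
  have lfk := lin_comp lf wh_lin.
  move: x {hx}; apply: T_ext => [||w]; [exact: tder2_lin|exact: lin_zero|].
  by rewrite tder2_word //; apply: dw_zero.
- apply: T_ext => [||w]; [exact: (lin_comp lw (tmap_lin lg))|exact: lin_zero|].
  have e y : p i0 (g y) = g y by rewrite p_gf (ctr_fg hc).
  have {}hw0 : hom 0 (word (map g w)).
    elim: w => [|y w IH]; first by apply: span_gen; exists [::], [::].
    rewrite word_cons; have := homW_tmul (homW_word1 om (e y)) IH.
    by have := om_eq0 i0; rewrite eqxx => /eqP ->.
  by rewrite tmap_word // (hw_hom hw0) wder_hom0 // scaler0.
apply: T_hom_ext => [||n x hx]; [exact: (lin_comp lw lw)|exact: lin_zero|].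
by rewrite (hw_hom hx) (linZ lw) (hw_hom (wder_hom hx)) wder_wder !scaler0.
Qed.
End WeightedHomotopy.

(** * The cooperad with trivial decompositions *)

Section TwoDegrees.
Variables (K : comPzRingType) (V : lmodType K) (e : V -> V).
Hypotheses (e_lin : linear e) (e_idem : forall x, e (e x) = e x).

(* [e] projects onto the component of degree -1 along the one of degree 0. *)
Definition two_degrees : gmod K :=
  GMod e (fun i x => if i == -1 then e x = x else if i == 0 then e x = 0 else x = 0).

Let proj (i : int) (x : V) : V := if i == -1 then e x else if i == 0 then x - e x else 0.

Let proj_lin i : linear (proj i).
Proof.
rewrite /proj; case: (i == -1) => //; case: (i == 0); last exact: lin_zero.
exact: (lin_sub (@lin_id _ _) e_lin).
Qed.

Let proj_homog i j (x : two_degrees) : homog j x -> proj i x = if i == j then x else 0.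
Proof.
rewrite /homog /= /proj; case: (altP (j =P -1)) => [->|nj] => [ex|].
  by rewrite ex subrr; case: (i == -1) => //; case: ifP.
case: (altP (j =P 0)) => [->|nj'] => [ex|->].
  by rewrite ex subr0; case: (altP (i =P -1)) => // ->.
by rewrite (lin0 e_lin) subr0; do !case: ifP.
Qed.

Lemma two_degrees_graded : graded two_degrees.
Proof.
split=> [i|i a x y|x|s xs us hx z i si||i x] //=.
- by rewrite (lin0 e_lin); do 2?case: ifP.
- rewrite e_lin; do 2?case: ifP => _; move=> -> ->; rewrite ?scaler0 ?addr0 //.
- exists [:: -1; 0], (fun i => proj i x); split=> [i|].
    rewrite /proj; case: (i == -1) => //; case: (i == 0) => //.
    by rewrite (linB e_lin) e_idem subrr.
  by rewrite big_cons big_seq1 /proj /= addrC subrK.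
- have := congr1 (proj i) z; rewrite (lin_sum (proj_lin i)) (lin0 (proj_lin i)) => <-.
  rewrite (bigD1_seq i) //= (proj_homog i (hx i)) eqxx big1 ?addr0 // => j ne.
  by rewrite (proj_homog i (hx j)) eq_sym (negbTE ne).
case: (altP (i =P -1)) => [->|ni] //; case: (altP (i =P 0)) => [->|ni'] //.
by move=> ->; rewrite (lin0 e_lin) if_same.
Qed.

Variable d : {linear V -> V}.
Hypotheses (d_im : forall x, e (d x) = d x) (d_ker : forall x, d (e x) = 0).

Lemma two_degrees_diff i (x : two_degrees) : homog i x -> @homog K two_degrees (i - 1) (d x).
Proof.
rewrite /homog /=; case: (altP (i =P -1)) => [-> ex|ni]; first by have := d_ker x; rewrite ex.
case: (altP (i =P 0)) => [-> _|ni' ->]; first exact: d_im.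
by rewrite linear0 (lin0 e_lin); do 2?case: ifP.
Qed.

Lemma two_degrees_diff2 (x : two_degrees) : d (d x : two_degrees) = 0.
Proof. by rewrite -[X in d X]d_im d_ker. Qed.

Definition two_degrees_chain : chain K :=
  @Chain K two_degrees d two_degrees_graded two_degrees_diff two_degrees_diff2.
End TwoDegrees.

Section TrivialCooperad.
Variables (K : comPzRingType) (sym : bool).

(** Row vectors of length 0 or 1: this is 0 for n = 0 and the ground ring in degree 0 for n > 0. *)
Definition triv_chain n : chain K :=
  @two_degrees_chain K 'rV[K]_((0 < n)%N) (fun=> 0) (@lin_zero _ _ _) (fun=> erefl)
    (mklin (@lin_zero _ _ _)) (fun=> erefl) (fun=> erefl).

Definition triv_sseq : sseq K sym.
Proof.
by apply: (@SSeq K sym triv_chain (fun n c _ => c)).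
Defined.
Local Notation C := triv_sseq.

(** The coordinate of c, as a sum over at most one index so that it makes sense for every n. *)
Definition csum n (c : C n) : K^o := \sum_j (c : 'rV[K]_((0 < n)%N)) 0 j.

Lemma csum_lin n : linear (@csum n).
Proof. by move=> a c c'; rewrite /csum scaler_sumr -big_split; apply: eq_bigr => j _; rewrite !mxE. Qed.

Definition tone : C 1%N := const_mx 1 : 'rV[K]_1.

Lemma triv0 (c : C 0%N) : c = 0.
Proof. by apply/matrixP => i []. Qed.

Lemma triv1 (c : C 1%N) : c = csum c *: tone.
Proof. by apply/matrixP => i j; rewrite /csum big_ord1 !mxE mulr1 ord1 [j]ord1. Qed.

Lemma csum_tone : csum tone = 1.
Proof. by rewrite /csum big_ord1 mxE. Qed.

Local Notation o := (@existT nat (fun a => C a : Type) 1%N tone).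
Local Notation ex c := (@existT nat (fun a => C a : Type) _ c).

(** For n = 1 the terms nu o 1 and 1 o nu coincide and are counted once. *)
Definition tdelta n (c : C n) : CC C n :=
  cten c (nseq n o) 1%g + (if n == 1%N then 0 else cten tone [:: ex c] 1%g).

Lemma cten_linl n r (l : seq {a : nat & C a}) (s : 'S_n) : linear (fun c : C r => cten c l s).
Proof. by move=> a c c'; apply: (co_linl (gen_composable C n)). Qed.

Lemma cten_top_lin n : linear (fun c : C n => cten tone [:: ex c] (1%g : 'S_n)).
Proof.
move=> a c c'; exact: (co_linr (gen_composable C n) (ex tone) [::] [::] a c c').
Qed.

Lemma tdelta_lin n : linear (@tdelta n).
Proof.
apply: lin_add; first exact: cten_linl.
by case: (n == 1%N); [exact: lin_zero|exact: cten_top_lin].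
Qed.

Definition tdl n : {linear C n -> CC C n} := mklin (@tdelta_lin n).
Definition tcu : {linear C 1%N -> K^o} := mklin (@csum_lin 1).

Lemma triv_hom n i (c : C n) : homog i c -> i == 0 \/ c = 0.
Proof.
rewrite /homog /=; case: (altP (i =P -1)) => [-> <-|_]; first by right.
by case: (i == 0) => [_|->]; [left|right].
Qed.

Lemma triv_hom0 n (c : C n) : homog 0 c.
Proof. by []. Qed.

Lemma tdelta_homog n i (c : C n) : homog i c -> cchomog i (tdl n c).
Proof.
case/triv_hom => [/eqP ->|->]; last by rewrite linear0; apply: span0.
apply: span_add.
  apply: span_gen; exists n, c, 0, [seq (0 : int, b) | b <- zip (nseq n o) (reshape (nseq n 1%N) (labels (1%g : 'S_n)))].
  split=> //.
  - by elim: (zip _ _) => [|b s IH]; constructor.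
  - by rewrite big_map big1 ?addr0.
  by rewrite /unzip2 -map_comp map_id /cten map_nseq.
case: ifP => _; first exact: span0.
apply: span_gen; exists 1%N, tone, 0, [:: (0 : int, (ex c, labels (1%g : 'S_n)))].
split=> //; first by constructor.
  by rewrite big_seq1.
rewrite /cten /=; congr (gen _ (_, [:: (_, _)])).
by rewrite take_oversize // size_labels.
Qed.

Lemma tdelta_diff n (c : C n) : tdl n (diff (C n) c) = ccdiff (tdl n c).
Proof.
rewrite linear0 /ccdiff /lift /comb big1 // => [[a [[r c'] bl]]] _ /=.
have gc := gen_composable C n.
have l1 : linear (fun c : C r => gen (composable (C:=C) n) (ex c, bl)) by move=> k x y; exact: (co_linl gc k x y bl).
rewrite (lin0 l1) add0r big1 ?scaler0 // => i _.
have l2 g l r' m (L : seq nat) : linear (fun c : C m => gen (composable (C:=C) n) (g, l ++ (ex c, L) :: r')).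
  by move=> k x y; exact: (co_linr gc).
exact: (lin0 (l2 _ _ _ _ _)).
Qed.

Lemma labels_blocks n (L : seq nat) : size L = n ->
  zip (nseq n o) (reshape (nseq n 1%N) L) = [seq (o, [:: j]) | j <- L].
Proof. by elim: n L => [|n IH] [|j L] //= [s]; rewrite drop0 take0 IH. Qed.

Lemma koszul_even (L : seq nat) : koszul (nth false [::]) L = 0%N.
Proof. by elim: L => //= j L ->; rewrite nth_nil mul0n. Qed.

(** The action on C is trivial, but the two terms still have to be moved: nu o 1^n by permuting its
    blocks of size one ([co_actl]), 1 o nu by permuting inside its only block ([co_actr]). *)
Lemma tdelta_act : sym -> forall n (c : C n) (s : 'S_n), tdl n (act c s) = ccact (tdl n c) s.
Proof.
move=> hs n c s; have gc := gen_composable C n.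
have vl (L : seq nat) : perm_eq L (iota 0 n) -> cosym_valid (sym := sym) n (ex c, [seq (o, [:: j]) | j <- L]).
  move=> pL; rewrite valid_sym //= size_map (perm_size pL) size_iota eqxx.
  rewrite -map_comp /= (_ : flatten _ = L) ?pL ?andbT; last by elim: (L) => //= j L' ->.
  by elim: (L).
have pl := perm_labels s; have sl := size_labels s.
rewrite /= /tdelta (linD (ccact_lin s)); congr (_ + _).
  rewrite /cten map_nseq !labels_blocks ?size_labels // ccact_gen /ccactphi vl ?perm_labels //=.
  rewrite labels1 -map_comp -{1}[c]/(act c s).
  rewrite (co_actl gc hs _ s (bs := [::])) ?size_map ?size_iota //; last first.
    by move=> j; rewrite nth_nil.
  rewrite koszul_even expr0 scale1r; congr (gen _ (_, _)).
  have mapn T (F : nat -> T) x0 : [seq nth x0 [seq F i | i <- iota 0 n] j | j <- labels s] = [seq F j | j <- labels s].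
    apply/eq_in_map => j; rewrite (perm_mem pl) mem_iota add0n => /= lj.
    by rewrite (nth_map 0%N) ?size_iota // nth_iota.
  by rewrite mapn -[in LHS](mkseq_nth 0%N (labels s)) /mkseq sl -map_comp; apply: eq_map.
case: (n == 1%N); first by rewrite (lin0 (ccact_lin s)).
have vt (L : seq nat) : perm_eq L (iota 0 n) -> cosym_valid (sym := sym) n (ex tone, [:: (ex c, L)]).
  by move=> pL; rewrite valid_sym //= cats0 pL (perm_size pL) size_iota eqxx.
have ce (u : 'S_n) : cten tone [:: ex c] u = gen (composable n) (ex tone, [:: (ex c, labels u)]).
  by rewrite /cten /= take_oversize // size_labels.
rewrite !ce ccact_gen /ccactphi vt ?perm_labels //= /relab /= labels1.
have := co_actr gc hs (ex tone) [::] [::] c s (L := iota 0 n); rewrite size_iota /= => -> //.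
congr (gen _ (_, [:: (_, _)])); rewrite (map_nth_iota pl) -[LHS](mkseq_nth 0%N) /mkseq sl //.
Qed.

Lemma tone_pure : pure false tone.
Proof. by []. Qed.

Section OneModule.
Variable A : gmod K.
Hypothesis pA : parited A.
Local Notation Delta := (@sdelta _ _ C tdl _).
Local Notation eps := (@scounit _ _ C tcu _).

(** The inclusion of X as the weight 1 part, a section of the counit. *)
Definition s1 (X : gmod K) (x : X) : schur C X := sten tone (word [:: x]).

Lemma s1_lin (X : gmod K) : linear (@s1 X).
Proof. exact: (lin_comp (@sten_linr _ _ C X _ _) (@word1_lin _ X)). Qed.

Lemma s1_par : parmap false (@s1 A).
Proof.
apply: (parmap_intro pA (S_parited C pA) (@s1_lin A)) => b x hx.
rewrite /s1; apply: (pure_sten pA tone_pure).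
have := pure_word pA (b := fun j => if j == 0%N then b else false) (w := [:: x]).
rewrite /wpar /= big_seq1 eqxx; apply; case=> [|j] //=; rewrite nth_nil; exact: pure0.
Qed.

Lemma tDelta_lin : linear (Delta : schur C A -> _).
Proof. exact: (sdelta_lin pA tdelta_act). Qed.

Lemma tDelta_sten n (c : C n) (w : seq A) : size w = n ->
  Delta (sten c (word w)) = sten c (word (map (@s1 A) w)) + (if n == 1%N then 0 else s1 (sten c (word w) : schur C A)).
Proof.
move=> sw; rewrite (sdelta_sten pA tdelta_act) /= /tdelta (linD (ccev_linl pA _)).
rewrite (ccev_ones tone_pure pA) // (tensm_word pA); last exact: cms_lins.
rewrite cms_arity sumn_tags sw eqxx tensw_ones //; congr (_ + _).
case: (n == 1%N); first by rewrite (lin0 (ccev_linl (C := C) (n := n) pA (word w))).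
by rewrite (ccev_top tone pA (ii := false)).
Qed.

Lemma eps_s1 (x : A) : eps (s1 x) = x.
Proof. by rewrite /s1 (scounit1 pA) letter_word /= csum_tone scale1r. Qed.

Lemma teps_lin : linear (eps : schur C A -> A).
Proof. exact: scounit_lin. Qed.

Lemma tcu_odd c : tcu (goddp c) = 0.
Proof. exact: linear0. Qed.

Lemma teps_thick : thickmap sym (tmap (eps : schur C A -> A)).
Proof.
apply: (thickmap_tmap sym (S_parited C pA) pA teps_lin); exact: scounit_par tcu_odd.
Qed.

Lemma sten_s1 (c : C 1%N) (x : A) : sten c (word [:: x]) = csum c *: s1 x.
Proof. by rewrite [c in LHS]triv1 stenZl. Qed.

Lemma tcounit_delta (y : schur C A) : scounit tcu (Delta y) = y.
Proof.
have pS := S_parited C pA.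
have ls := scounit_lin pS tcu.
move: y; apply: S_ext => [||n c w sw]; [exact: (lin_comp ls tDelta_lin)|exact: lin_id|].
rewrite tDelta_sten // (linD ls); case: (altP (n =P 1%N)) => [e|n1]; last first.
  by rewrite (scounit_other pS) // add0r /s1 (scounit1 pS) letter_word /= csum_tone scale1r.
move: c sw; rewrite e => c; case: w => [|x [|x' w]] // _.
by rewrite (lin0 ls) addr0 (scounit1 pS) letter_word /= sten_s1.
Qed.

Lemma tdelta_counit (y : schur C A) : smap false (tmap eps) (Delta y) = y.
Proof.
have tk := teps_thick; have ls := smap_lin (C := C) false tk.
move: y; apply: S_ext => [||n c w sw]; [exact: (lin_comp ls tDelta_lin)|exact: lin_id|].
have e1 : eps \o @s1 A =1 id by move=> x; exact: eps_s1.
rewrite tDelta_sten // (linD ls) (smap_sten _ tk) tmap_word; last exact: teps_lin.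
rewrite -map_comp (eq_map e1) map_id -[RHS]addr0; congr (_ + _).
case: (altP (n =P 1%N)) => [_|n1]; first exact: (lin0 ls).
rewrite (smap_sten _ tk) tmap_word; last exact: teps_lin.
by rewrite map_cons (scounit_other pA) // (lin0 (@word1_lin _ A)) sten0r.
Qed.
End OneModule.

Lemma tDelta_s1 (A : gmod K) (x : A) : parited A -> sdelta tdl (s1 x) = s1 (s1 x).
Proof. by move=> pA; rewrite /s1 (tDelta_sten pA) //= addr0. Qed.

Lemma swt_par (A : gmod K) m : parited A -> parmap false (@swt K sym C A m).
Proof.
move=> pA; have pS := S_parited C pA; apply: (parmap_intro pS pS (@swt_lin _ _ C A m)) => b.
have H y : goddp (swt m y : schur C A) = swt m (goddp y : schur C A).
  move: y; apply: (S_pure_ext pA) => [||n b1 c b2 x hc hx].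
  - exact: (lin_comp (par_lin pS) (@swt_lin _ _ C A m)).
  - exact: (lin_comp (@swt_lin _ _ C A m) (par_lin pS)).
  rewrite (pure_sten pA hc hx) swt_sten; case: (b1 (+) b2) (pure_sten pA hc hx) => hp; rewrite ?swt_sten;
    rewrite ?(lin0 (@swt_lin _ _ C A m)); case: ifP => _ //; exact: (lin0 (par_lin pS)).
move=> y hy; rewrite /pure H hy; case: b hy => //= _; exact: (lin0 (@swt_lin _ _ C A m)).
Qed.

(** A closed form by maps of known parity. The parity of the coproduct is needed to prove
    coassociativity, hence before [Delta_par], which assumes a cooperad, can be applied. *)
Lemma tDeltaE (A : gmod K) (y : schur C A) : parited A ->
  sdelta tdl y = smap false (tmap (@s1 A)) y + s1 (y - swt 1 y).
Proof.
move=> pA; have tk := thickmap_tmap sym pA (S_parited C pA) (@s1_lin A) (s1_par pA).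
move: y; apply: S_ext => [||n c w sw]; first exact: tDelta_lin.
  apply: lin_add; first exact: smap_lin.
  apply: (lin_comp (@s1_lin _)); exact: (lin_sub (@lin_id _ _) (@swt_lin _ _ C A 1)).
rewrite tDelta_sten // (smap_sten _ tk) tmap_word; last exact: s1_lin.
congr (_ + _); rewrite swt_sten; case: ifP => _; first by rewrite subrr (lin0 (@s1_lin _)).
by rewrite subr0.
Qed.

Lemma tDelta_par (A : gmod K) : parited A -> parmap false (@sdelta _ _ C tdl A).
Proof.
move=> pA y; have pS := S_parited C pA; have pSS := S_parited C pS.
have tk := thickmap_tmap sym pA pS (@s1_lin A) (s1_par pA).
rewrite !tDeltaE // (linD (par_lin pSS)); congr (_ + _).
  apply: (smap_par (C := C) tk pA pS); apply: tmap_par => //; [exact: s1_lin|exact: s1_par].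
rewrite (s1_par pS); congr (s1 _); rewrite [LHS](linB (par_lin pS)); congr (_ - _).
exact: (swt_par 1 pA).
Qed.

Lemma tdelta_coassoc (A : gmod K) (y : schur C A) : parited A ->
  smap false (tmap (@sdelta _ _ C tdl A)) (sdelta tdl y) = sdelta tdl (sdelta tdl y).
Proof.
move=> pA; have pS := S_parited C pA; have pSS := S_parited C pS.
have tk := thickmap_tmap sym pS pSS (tDelta_lin pA) (tDelta_par pA).
have ls := smap_lin (C := C) false tk; have ld := tDelta_lin pS.
move: y; apply: S_ext => [||n c w sw].
- exact: (lin_comp ls (tDelta_lin pA)).
- exact: (lin_comp ld (tDelta_lin pA)).
rewrite tDelta_sten // (linD ls) (linD ld) (smap_sten _ tk) tmap_word; last exact: tDelta_lin.
rewrite (tDelta_sten pS) ?size_map // -addrA; congr (_ + _).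
  by rewrite -!map_comp; congr (sten _ (word _)); apply: eq_map => x /=; rewrite tDelta_s1.
case: ifP => e; first by rewrite (lin0 ls) (lin0 ld) addr0.
rewrite (smap_sten _ tk) tmap_word /=; last exact: tDelta_lin.
rewrite tDelta_sten // e tDelta_s1 // /s1 (linD (@word1_lin _ _)) (linD (@sten_linr _ _ C _ _ _)) //.
Qed.

Lemma tcounit_homog i (c : C 1%N) : homog i c -> i != 0 -> tcu c = 0.
Proof. by case/triv_hom => [->//|->] _; exact: linear0. Qed.

Lemma tcounit_diff (c : C 1%N) : tcu (diff (C 1%N) c) = 0.
Proof. exact: linear0. Qed.

Definition trivial_cooperad : cooperad K sym :=
  Cooperad tdelta_homog tdelta_diff tdelta_act tcounit_homog tcounit_diff
    (fun A gA => tcounit_delta (graded_parited gA))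
    (fun A gA => tdelta_counit (graded_parited gA))
    (fun A gA y => tdelta_coassoc y (graded_parited gA)).

Lemma trivial_connected : @connected K sym trivial_cooperad tone.
Proof. split; [exact: triv0|exact: csum_tone|exact: triv1]. Qed.
End TrivialCooperad.

(** * The example *)

(* The basis is b, u1, v1, u2, v2, with b, u1, u2 in degree -1, v1, v2 in degree
   0, and d v_i = u_i. *)
Definition exV : lmodType rat := (rat^o * rat^o * rat^o * rat^o * rat^o)%type.

Definition exe (x : exV) : exV := let '(b, u1, v1, u2, v2) := x in (b, u1, 0, u2, 0).
Definition exd (x : exV) : exV := let '(b, u1, v1, u2, v2) := x in (0, v1, 0, v2, 0).
Definition exh (x : exV) : exV := let '(b, u1, v1, u2, v2) := x in (0, 0, - u1, 0, - u2).
Definition exf (x : exV) : rat^o := let '(b, u1, v1, u2, v2) := x in b.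
Definition exg (b : rat^o) : exV := (b, 0, 0, 0, 0).
(** The projections to the summands spanned by b, by u1 and v1, and by u2 and v2; the first one is
    gf. *)
Definition exq (i : 'I_3) (x : exV) : exV :=
  let '(b, u1, v1, u2, v2) := x in
  match val i with
  | 0%N => (b, 0, 0, 0, 0)
  | 1%N => (0, u1, v1, 0, 0)
  | _ => (0, 0, 0, u2, v2)
  end.
(** The functional l from which the product l(x) l(y) (b + u1) is built. It vanishes in degree -1,
    hence on boundaries. So the product has degree -1, is symmetric without signs, and vanishes
    after inserting d. *)
Definition exl (x : exV) : rat^o := let '(b, u1, v1, u2, v2) := x in v1 + v2.

Lemma exV_ext (x y : exV) : x.1.1.1.1 = y.1.1.1.1 -> x.1.1.1.2 = y.1.1.1.2 ->
  x.1.1.2 = y.1.1.2 -> x.1.2 = y.1.2 -> x.2 = y.2 -> x = y.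
Proof. by case: x y => [[[[? ?] ?] ?] ?] [[[[? ?] ?] ?] ?] /= -> -> -> -> ->. Qed.

Lemma exe_lin : linear exe.
Proof.
move=> a [[[[b u1] v1] u2] v2] [[[[b' u1'] v1'] u2'] v2'] /=.
by apply: exV_ext => /=; rewrite ?scaler0 ?addr0.
Qed.

Lemma exd_lin : linear exd.
Proof.
move=> a [[[[b u1] v1] u2] v2] [[[[b' u1'] v1'] u2'] v2'] /=.
by apply: exV_ext => /=; rewrite ?scaler0 ?addr0.
Qed.

Lemma exh_lin : linear exh.
Proof.
move=> a [[[[b u1] v1] u2] v2] [[[[b' u1'] v1'] u2'] v2'] /=.
by apply: exV_ext => /=; rewrite ?opprD ?scalerN ?scaler0 ?addr0.
Qed.

Lemma exf_lin : linear exf.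
Proof. by move=> a [[[[b u1] v1] u2] v2] [[[[b' u1'] v1'] u2'] v2']. Qed.

Lemma exg_lin : linear exg.
Proof. by move=> a b b'; apply: exV_ext => /=; rewrite ?scaler0 ?addr0. Qed.

Lemma exq_lin i : linear (exq i).
Proof.
move=> a [[[[b u1] v1] u2] v2] [[[[b' u1'] v1'] u2'] v2'].
by case: i => [[|[|i]] hi]; apply: exV_ext => /=; rewrite ?scaler0 ?addr0.
Qed.

Lemma exl_lin : linear exl.
Proof.
move=> a [[[[b u1] v1] u2] v2] [[[[b' u1'] v1'] u2'] v2'] /=.
by rewrite /exl /= scalerDr addrACA.
Qed.

Definition exA : chain rat.
refine (@two_degrees_chain rat exV exe exe_lin _ (mklin exd_lin) _ _);
  by case=> [[[[b u1] v1] u2] v2].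
Defined.

Definition exB : chain rat :=
  @two_degrees_chain rat rat^o id (@lin_id _ _) (fun=> erefl) (mklin (@lin_zero _ _ _))
    (fun=> erefl) (fun=> erefl).

Definition exF : {linear exA -> exB} := mklin exf_lin.
Definition exG : {linear exB -> exA} := mklin exg_lin.
Definition exH : {linear exA -> exA} := mklin exh_lin.

Lemma ex_contraction : contraction exF exG exH.
Proof.
split=> [i x|i x|i x|x|x|x|x|x|x|x].
- rewrite /homog /=; case: x => [[[[b u1] v1] u2] v2]; case: (i == -1) => //.
  by case: (i == 0) => -[-> _ _].
- rewrite /homog /=; case: (i == -1) => //.
  by case: (i == 0) => [->|->].
- have eh y : exe (exh y) = 0 by case: y => [[[[b u1] v1] u2] v2].
  have he y : exh (exe y) = exh y by case: y => [[[[b u1] v1] u2] v2].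
  rewrite /homog /=; case: (altP (i =P -1)) => [-> _|n]; first exact: eh.
  case: (altP (i =P 0)) => [-> e0|n' ->]; first by rewrite -he e0 (lin0 exh_lin).
  by rewrite (lin0 exh_lin) (lin0 exe_lin); do 2?case: ifP.
- by case: x => [[[[b u1] v1] u2] v2].
- by [].
- case: x => [[[[b u1] v1] u2] v2]; rewrite /=.
  by apply: exV_ext => /=; ring.
- by [].
- by case: x => [[[[b u1] v1] u2] v2].
- by case: x => [[[[b u1] v1] u2] v2] /=; rewrite oppr0.
by rewrite /= /exh oppr0.
Qed.

Lemma exq_homog i j (x : exA) : homog j x -> @homog _ exA j (exq i x).
Proof.
have ep y : exe (exq i y) = exq i (exe y) by case: i => [[|[|i]] hi]; case: y => [[[[b u1] v1] u2] v2].
rewrite /homog /=; case: (j == -1) => [e|]; first by rewrite ep e.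
by case: (j == 0) => [e|->]; rewrite ?ep ?e (lin0 (exq_lin i)).
Qed.

Lemma exq_sum (x : exA) : \sum_i exq i x = x.
Proof.
rewrite !big_ord_recl big_ord0; case: x => [[[[b u1] v1] u2] v2].
by apply: exV_ext => /=; ring.
Qed.

Lemma exq_orth i j (x : exA) : exq i (exq j x) = if j == i then exq j x else 0.
Proof.
case: x => [[[[b u1] v1] u2] v2].
by case: i => [[|[|[|i]]] hi]; case: j => [[|[|[|j]]] hj].
Qed.

Definition exhh (om : 'I_3 -> nat) : {linear T exA -> T exA} :=
  @hw exA exH _ ord0 exq om exq_lin.

Lemma ex_homotopy om sym : (forall i, (om i == 0%N) = (i == ord0)) ->
  thick_homotopy sym exF exG exH (exhh om).
Proof.
move=> om0; apply: (weighted_homotopy ex_contraction) => //.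
- exact: exq_homog.
- exact: exq_sum.
- exact: exq_orth.
- by move=> i; case=> [[[[b u1] v1] u2] v2]; case: i => [[|[|i]] hi].
- by move=> i; case=> [[[[b u1] v1] u2] v2]; case: i => [[|[|i]] hi]; apply: exV_ext => /=; rewrite ?oppr0.
- by case=> [[[[b u1] v1] u2] v2].
Qed.

(** b + u1 is a cycle of degree -1. Its summand b is visible to f, and u1 is visible to h. *)
Definition exbu : exA := ((1, 1, 0, 0, 0) : exV).

Definition extau2 (x : T exA) : exA :=
  lift (fun w : seq exA => if size w == 2 then (\prod_(y <- w) exl y : rat) *: exbu else 0) x.

Lemma extau2_ml :
  multilinear (fun w : seq exA => if size w == 2 then (\prod_(y <- w) exl y : rat) *: exbu else 0).
Proof.
move=> l r a x y; rewrite !size_cat /=; case: ifP => _; last by rewrite scaler0 addr0.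
have E : exl (a *: x + y) = a * exl x + exl y :> rat by exact: exl_lin.
rewrite !big_cat !big_cons E scalerA -scalerDl /=; congr (_ *: _).
move: (exl x : rat) (exl y : rat) (\prod_(z <- l) _) (\prod_(z <- r) _) => p q s u; ring.
Qed.

Lemma extau2_word w : extau2 (word w) = if size w == 2 then (\prod_(y <- w) exl y : rat) *: exbu else 0.
Proof. exact: lift_word extau2_ml. Qed.

Lemma extau2_lin : linear extau2.
Proof. exact: lift_lin extau2_ml. Qed.

Lemma exA_parited : parited exA.
Proof. exact: chain_parited. Qed.

Lemma exl_odd (x : exA) : pure true x -> exl x = 0.
Proof. by move=> <-; case: x => [[[[b u1] v1] u2] v2] /=; rewrite /exl addr0. Qed.

(** l vanishes on odd letters, so no Koszul sign meets a nonzero value; the same example serves the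
    symmetric and the non-symmetric case. *)
Lemma extau2_permw n L x : perm_eq L (iota 0 n) -> extau2 (permw L x) = extau2 (wt n x).
Proof.
move=> pL; move: x; apply: (T_pure_ext exA_parited) => [||b w hw].
- exact: (lin_comp extau2_lin (permw_lin exA_parited L)).
- exact: (lin_comp extau2_lin (@wt_lin _ exA n)).
rewrite (permw_pure exA_parited L hw) wt_word (perm_iota_eq _ pL); case: ifP => [/eqP sw|_] //.
rewrite (linZ extau2_lin) !extau2_word size_map (perm_size pL) size_iota sw; case: ifP => _; last exact: scaler0.
have -> : \prod_(y <- [seq nth 0 w j | j <- L]) exl y = \prod_(y <- w) exl y :> rat.
  by rewrite big_map (perm_big _ pL) -[in RHS](mkseq_nth 0 w) big_map sw.
case: (altP (\prod_(y <- w) exl y =P 0 :> rat)) => [->|nz]; first by rewrite !scale0r scaler0.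
rewrite (_ : koszul b L = 0%N) ?expr0 ?scale1r //.
rewrite -[RHS](koszul_even L); apply: koszul_ext => j jL; rewrite nth_nil; apply: contraNF nz => bj.
have lj : (j < size w)%N by move: jL; rewrite (perm_mem pL) mem_iota sw.
rewrite prodf_seq_eq0; apply/hasP; exists (nth 0 w j); first exact: mem_nth.
by have := hw j; rewrite bj => /exl_odd ->.
Qed.

(** * The differential of C[A] *)

Section Sdiff.
Variables (K : comPzRingType) (sym : bool) (C : sseq K sym) (A : chain K).
Let pA := chain_parited A.

Lemma sdiff_bal : sbal (fun n (c : C n) (x : T A) =>
  sten (diff (C n) c) x + sten (ksign true c) (tder (diff A) x) : schur C A).
Proof.
have ld : linear (diff A) := linearP (diff A).
have -> : tder (diff A) = tder2 id (diff A) by apply: funext; exact: tder_tder2.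
have lt := tder2_lin pA (@lin_id _ _) ld.
have lk n := ksign_lin (C_parited C n) true.
apply: sbal_intro => [n x|n c|n c x|h n c s x].
- apply: lin_add; first exact: (lin_comp (@sten_linl _ _ C A n x) (linearP (diff (C n)))).
  exact: (lin_comp (@sten_linl _ _ C A n _) (lk n)).
- apply: lin_add; first exact: sten_linr.
  exact: (lin_comp (@sten_linr _ _ C A n _) lt).
- by rewrite sten_wt -(wt_tder2 pA (@lin_id _ _) ld) sten_wt.
rewrite -act_diff sten_act // ksign_act sten_act //.
by rewrite (permw_tder2 pA pA (@lin_id _ _) ld (@id_par _ A) (@diff_par _ A) x (perm_labels s)).
Qed.

Lemma sdiff_lin : linear (sdiff (diff A) : schur C A -> schur C A).
Proof. exact: slift_lin sdiff_bal. Qed.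

Lemma sdiff_sten n (c : C n) x : sdiff (diff A) (sten c x : schur C A) =
  sten (diff (C n) c) x + sten (ksign true c) (tder (diff A) x).
Proof. exact: (slift_sten sdiff_bal). Qed.
End Sdiff.

Lemma wt_idem (K : comPzRingType) (A : gmod K) n (x : T A) : wt n (wt n x) = wt n x.
Proof.
have lw := @wt_lin _ A n; move: x; apply: T_ext => [||w] //; first exact: (lin_comp lw lw).
by rewrite wt_word; case: ifP => e; rewrite ?wt_word ?e // (lin0 lw).
Qed.

Lemma tder2_word1 (K : comPzRingType) (A : gmod K) (be : A -> A) x : parited A -> linear be ->
  tder2 id be (word [:: x]) = word [:: be x] :> T A.
Proof. by move=> pX lb; rewrite tder2_word //= tmul0r addr0. Qed.

Lemma tder2_word2 (K : comPzRingType) (A : gmod K) (be : A -> A) x y : parited A -> linear be ->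
  tder2 id be (word [:: x; y]) = word [:: be x; y] + word [:: ksign true x; be y] :> T A.
Proof. by move=> pX lb; rewrite tder2_word //= tmul0r addr0 tmul_word. Qed.

(** * The structure t of the example and two pseudo-derivations for it *)

Section Example.
Variable sym : bool.
Local Notation C := (trivial_cooperad rat sym).
Local Notation S1 := (@s1 rat sym _).

Lemma extau_bal : sbal (fun n (c : C n) x => csum c *: extau2 (wt n x) : exA).
Proof.
have lw n := @wt_lin _ exA n.
apply: sbal_intro => [n x a c c'|n c|n c x|h n c s x].
- by rewrite csum_lin scalerDl -scalerA.
- exact: (lin_scale _ (lin_comp extau2_lin (lw n))).
- by rewrite wt_idem.
by congr (_ *: _); rewrite (wt_permw exA_parited _ _ (perm_labels s)) (extau2_permw _ (perm_labels s)) wt_idem.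
Qed.

Definition extau : schur C exA -> exA := slift (fun n (c : C n) x => csum c *: extau2 (wt n x)).

Lemma extau_lin : linear extau.
Proof. exact: slift_lin extau_bal. Qed.

Lemma extau_sten n (c : C n) x : extau (sten c x) = csum c *: extau2 (wt n x).
Proof. exact: (slift_sten extau_bal). Qed.

(** As the coproduct has no middle terms and [extau] kills weight 1, the coderivation with
    corestriction [extau] takes values in weight 1 only. *)
Definition exT : {linear schur C exA -> schur C exA} :=
  mklin (lin_comp (@s1_lin rat sym exA) extau_lin).

Lemma extau_other n (c : C n) x : n != 2 -> extau (sten c x) = 0.
Proof.
move=> n2; rewrite extau_sten; suff -> : extau2 (wt n x) = 0 by rewrite scaler0.
move: x; apply: T_ext => [||w]; [exact: (lin_comp extau2_lin (@wt_lin _ exA n))|exact: lin_zero|].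
rewrite wt_word; case: eqP => [sw|_]; last exact: (lin0 extau2_lin).
by rewrite extau2_word sw (negbTE n2).
Qed.

Lemma exT_s1 (x : exA) : exT (S1 x) = 0.
Proof. by rewrite /= extau_other // (lin0 (@s1_lin _ _ _)). Qed.

Lemma triv_ksign n (c : C n) b : ksign b c = c.
Proof. by case: b => //; rewrite /ksign /= mul0rn subr0. Qed.

Lemma exl_d (x : exA) : exl (diff exA x : exA) = 0.
Proof. by case: x => [[[[b u1] v1] u2] v2] /=; rewrite addr0. Qed.

Lemma extau2_wt x : extau2 (wt 2 x) = extau2 x.
Proof.
move: x; apply: T_ext => [||w]; [exact: (lin_comp extau2_lin (@wt_lin _ exA 2))|exact: extau2_lin|].
by rewrite wt_word extau2_word; case: ifP => e; rewrite ?(lin0 extau2_lin) // extau2_word e.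
Qed.

Lemma extau2_d x : extau2 (tder (diff exA) x) = 0.
Proof.
have ld : linear (diff exA) := linearP (diff exA).
have lt := tder2_lin exA_parited (@lin_id _ _) ld.
rewrite (tder_tder2 exA_parited ld) -extau2_wt (wt_tder2 exA_parited (@lin_id _ _) ld).
move: x; apply: T_ext => [||w].
- exact: (lin_comp extau2_lin (lin_comp lt (@wt_lin _ exA 2))).
- exact: lin_zero.
rewrite wt_word; case: eqP => [|_]; last by rewrite (lin0 lt) (lin0 extau2_lin).
case: w => [|x [|y [|z w]]] // _; rewrite (tder2_word2 x y exA_parited ld) (linD extau2_lin).
have e z : exl (diff exA z : exA) = 0 by exact: exl_d.
by rewrite !extau2_word !big_cons !big_nil !e !(mul0r, mulr0) !scale0r addr0.
Qed.

Lemma exd_tau2 x : diff exA (extau2 x) = 0.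
Proof.
move: x; apply: T_ext => [||w]; [exact: (lin_comp (linearP (diff exA)) extau2_lin)|exact: lin_zero|].
rewrite extau2_word; case: ifP => _; last exact: linear0.
rewrite (linZ (linearP (diff exA))) (_ : diff exA exbu = 0) ?scaler0 //.
Qed.

Lemma exl_hom i (x : exA) : homog i x -> i != 0 -> exl x = 0.
Proof.
rewrite /homog /=; case: (i == -1) => [e|] i0; first by apply: exl_odd.
by move: i0; case: (i == 0) => // -> _; exact: (lin0 exl_lin).
Qed.

Lemma extau2_hom i x : homog i x -> homog (i - 1) (extau2 x).
Proof.
have gA := chain_graded exA; have [h0 hl _ _ _ _] := gA.
elim=> [|a y z [w [hw <- ->]] _ hz]; first by rewrite (lin0 extau2_lin).
rewrite extau2_lin; apply: hl => // {hz z}.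
rewrite extau2_word size_map; case: eqP => [|_]; last exact: h0.
case: w hw => [|[i1 x1] [|[i2 x2] [|w]]] hw // _.
have h1 := List.Forall_inv hw; have h2 := List.Forall_inv (List.Forall_inv_tail hw).
rewrite !map_cons !big_cons !big_nil.
case: (altP (i1 =P 0)) => [i10|n1]; last by rewrite (exl_hom h1 n1) mul0r scale0r; exact: h0.
case: (altP (i2 =P 0)) => [i20|n2]; last by rewrite (exl_hom h2 n2) mul0r mulr0 scale0r; exact: h0.
rewrite -[_ *: _]addr0; apply: (hom_lin gA); last exact: h0.
by rewrite [(i1, _).1]i10 [(i2, _).1]i20.
Qed.

Lemma homog_wt (K : comPzRingType) (A : gmod K) i n (x : T A) : homog i x -> homog i (wt n x).
Proof.
apply: (span_image (@wt_lin _ A n)) => _ [w [hw <- ->]]; rewrite wt_word.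
by case: ifP => _; [apply: span_gen; exists w|apply: span0].
Qed.

Lemma homog_s1 i (x : exA) : homog i x -> homog i (S1 x).
Proof.
move=> hx; rewrite -[i]add0r; apply: hom_sten; [exact: triv_hom0|exact: homog_word1].
Qed.

Lemma exT_hom i (y : schur C exA) : homog i y -> homog (i - 1) (exT y).
Proof.
have lt : linear exT := linearP exT.
apply: (span_image lt) => _ [n [c [x [p [q [hp hq <- ->]]]]]].
case/triv_hom: hp => [/eqP ->|->]; last by rewrite sten0l linear0; apply: span0.
rewrite add0r -[exT _]/(S1 (extau (sten c x))) extau_sten (linZ (@s1_lin _ _ _)).
by apply: span_scale; apply: homog_s1; apply: extau2_hom; apply: homog_wt.
Qed.

(** In the last condition t d, d t and t t vanish separately: l kills boundaries, b + u1 is a cycle,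
    and t kills weight 1. *)
Lemma ex_omega : omega_algebra exT.
Proof.
have pS := S_parited C exA_parited; have lS := @s1_lin rat sym exA.
have lt : linear exT := linearP exT; have ld : linear (diff exA) := linearP (diff exA).
split.
- exact: exT_hom.
- move=> m n y nm; have lws k := @swt_lin _ _ C exA k.
  move: y; apply: S_ext => [||k c w sw].
  + exact: (lin_comp (lws m) (lin_comp lt (lws n))).
  + exact: lin_zero.
  rewrite swt_sten; case: eqP => [ek|_]; last by rewrite (lin0 lt) (lin0 (lws m)).
  rewrite /=; case: (altP (k =P 2)) => [k2|k2]; last by rewrite extau_other // (lin0 lS) (lin0 (lws m)).
  by rewrite /s1 swt_sten; case: eqP => // m1; exfalso; lia.
- have lD := tDelta_lin (sym := sym) exA_parited; have lD' := tDelta_lin (sym := sym) pS.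
  have tk : thickmap sym (tder (exT : schur C exA -> schur C exA)).
    have -> : tder (exT : schur C exA -> schur C exA) = tder2 id exT by apply: funext; exact: tder_tder2.
    apply: thickmap_tder2 => //.
    exact: (@parmap_homog _ _ _ (-1) _ pS pS lt exT_hom).
  apply: S_ext => [||k c w sw].
  + exact: (lin_comp lD lt).
  + exact: (lin_comp (smap_lin (C := C) true tk) lD).
  rewrite -[RHS]/(smap (C := C) true (tder exT) (sdelta (tdl rat sym) (sten c (word w)))).
  rewrite -[LHS]/(sdelta (tdl rat sym) (S1 (extau (sten c (word w))))) (tDelta_s1 _ _ exA_parited).
  rewrite (tDelta_sten exA_parited c sw) (linD (smap_lin (C := C) true tk)).
  (* The inner factors of nu o 1^n have weight 1 and are killed by t, so only 1 o nu contributes. *)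
  rewrite (smap_sten _ tk) (tder_tder2 pS lt) tder2_word // dw_zero ?sten0r ?add0r; last first.
    by move=> _ /mapP[x _ ->]; exact: exT_s1.
  case: ifP => [/eqP k1|k1].
    by rewrite (lin0 (smap_lin (C := C) true tk)) extau_other ?k1 // !(lin0 (@s1_lin _ _ _)).
  by rewrite -[RHS]/(smap (C := C) true (tder exT) (sten (tone rat sym) (word [:: (sten c (word w) : schur C exA)]))) (smap_sten _ tk) (tder_tder2 pS lt) (tder2_word1 _ pS lt) triv_ksign.
- move=> y; rewrite exT_s1 addr0.
  have lsd := @sdiff_lin rat sym C exA.
  move: y; apply: S_ext => [||k c w sw].
  + apply: lin_add; [exact: (lin_comp lsd lt)|exact: (lin_comp lt lsd)].
  + exact: lin_zero.
  rewrite sdiff_sten (_ : diff (C k) c = 0) // sten0l add0r triv_ksign.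
  have e0 (x : T exA) : exT (sten c (tder (diff exA) x)) = 0.
    rewrite -[LHS]/(S1 (extau (sten c (tder (diff exA) x)))) extau_sten.
    rewrite (tder_tder2 exA_parited ld) (wt_tder2 exA_parited (@lin_id _ _) ld) -(tder_tder2 exA_parited ld) extau2_d scaler0.
    exact: lin0 lS.
  rewrite e0 addr0 -[exT _]/(sten (tone rat sym) (word [:: extau (sten c (word w))])) sdiff_sten.
  rewrite (_ : diff (C 1%N) _ = 0) // sten0l add0r triv_ksign (tder_tder2 exA_parited ld) (tder2_word1 _ exA_parited ld).
  rewrite extau_sten (linZ ld) exd_tau2 scaler0; exact: lin0 lS.
Qed.

(** Weight 0 on the image of g, weights k and 1 on the two acyclic summands; k = 1 and k = 2 will be
    compared. *)
Definition exw (k : nat) (i : 'I_3) : nat := match val i with 0 => 0 | 1 => k | _ => 1 end.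

Lemma exw_eq0 k i : (exw k.+1 i == 0%N) = (i == ord0).
Proof. by case: i => [[|[|[|i]]] hi]. Qed.

Definition exu1 : exA := ((0, 1, 0, 0, 0) : exV).
Definition exv2 : exA := ((0, 0, 0, 0, 1) : exV).

(** The word u1 v2 has total weight k + 2. As h v2 = 0, the derivation gives (k + 1) h(u1) v2 = -(k
    + 1) v1 v2, and l is 1 on v1 and v2. *)
Lemma exhh_value k : extau2 (exhh (exw k.+1) (word [:: exu1; exv2])) =
  - (k.+1%:R / k.+2%:R) *: exbu.
Proof.
have i1 : (1 < 3)%N by []. have i2 : (2 < 3)%N by [].
have hu : @homW rat exA _ exq (exw k.+1) k.+1 (word [:: exu1]) by apply: (@homW_word1 rat exA _ exq (exw k.+1) (Ordinal i1)).
have hv : @homW rat exA _ exq (exw k.+1) 1 (word [:: exv2]) by apply: (@homW_word1 rat exA _ exq (exw k.+1) (Ordinal i2)).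
have hx := homW_tmul hu hv; rewrite tmul_word /= addn1 in hx.
rewrite /exhh (@hw_hom exA exH _ ord0 exq (exw k.+1) exq_lin exq_orth _ _ hx) (linZ extau2_lin).
have ex2 (x y : exA) : extau2 (word [:: x; y]) = (exl x * exl y : rat) *: exbu.
  by rewrite extau2_word !big_cons big_nil mulr1.
have lw := @wh_lin exA exH _ exq (exw k.+1) exq_lin.
rewrite /wder (tder2_word2 _ _ exA_parited lw) (linD extau2_lin) !ex2.
have p1 : exq (Ordinal i1) exu1 = exu1 by [].
have p2 : exq (Ordinal i2) exv2 = exv2 by [].
have h2 : exH exv2 = 0 by apply: exV_ext; rewrite /= ?oppr0.
have eu : @wh exA exH _ exq (exw k.+1) exu1 = k.+1%:R *: exH exu1.
  exact: (@wh_col exA exH _ exq (exw k.+1) exq_orth _ _ p1).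
have ev : @wh exA exH _ exq (exw k.+1) exv2 = 0.
  by rewrite (@wh_col exA exH _ exq (exw k.+1) exq_orth _ _ p2) h2 scaler0.
have l0 : exl (0 : exA) = 0 :> rat by exact: (lin0 exl_lin).
rewrite eu ev l0.
have x1 : exl (exH exu1) = -1 :> rat by rewrite /exl /= oppr0 addr0.
have -> : exl (k.+1%:R *: exH exu1) = - k.+1%:R :> rat by rewrite (linZ exl_lin) x1; exact: mulrN1.
have -> : exl exv2 = 1 :> rat by rewrite /exl /= add0r.
rewrite mulr0 scale0r addr0 mulr1 scalerA; congr (_ *: _).
by rewrite mulrN mulrC.
Qed.

Definition exnu : C 2 := const_mx 1 : 'rV[rat]_1.

Lemma component_exT x : component exT exnu x = extau2 x.
Proof.
have e : csum exnu = 1 by rewrite /csum big_ord1 mxE.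
rewrite /component -[exT _]/(S1 (extau (sten exnu x))) -[scounit _ _]/(scounit (tcu rat sym) _).
rewrite eps_s1; last exact: exA_parited.
rewrite (extau_sten exnu x) e scale1r; exact: extau2_wt.
Qed.

(** Both lists of terms are empty, so the formulas reduce to f t^nu h_2 and h t^nu h_2. *)
Lemma ex_components k (x : T exA) :
  component (trF exF exT (exhh (exw k.+1))) exnu x = exF (extau2 (exhh (exw k.+1) x)) /\
  component (trH exT (exhh (exw k.+1))) exnu x = exH (extau2 (exhh (exw k.+1) x)).
Proof.
have ht := ex_homotopy sym (exw_eq0 k).
have hn : homog 0 exnu by apply: triv_hom0.
have hts : coproduct_terms (C := C) (tone rat sym) 0 exnu [::].
  by split; [constructor|rewrite big_nil addr0].
have hqs : quadratic_terms (C := C) (tone rat sym) 0 [::] [::].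
  by split; [constructor|rewrite !big_nil].
have [_ _ eF eH] := components_and_independence (trivial_connected rat sym) ex_contraction
  ex_omega ht (leqnn 2) hn hts (hqs 2).
by rewrite eF eH !big_nil !addr0 component_exT /sgnz expr0 !scale1r.
Qed.

(** f reads the coefficient of b and l h, up to sign, that of u1. Up to sign both values are (k +
    1)/(k + 2), that is 1/2 and 2/3 for the two choices. *)
Lemma exhh_dependence :
  trF exF exT (exhh (exw 1)) <> trF exF exT (exhh (exw 2)) /\
  trH exT (exhh (exw 1)) <> trH exT (exhh (exw 2)).
Proof.
have ne : (2%:R / 3%:R : rat) != 1%:R / 2%:R by [].
have EF k : component (trF exF exT (exhh (exw k.+1))) exnu (word [:: exu1; exv2]) =
    - (k.+1%:R / k.+2%:R) :> rat.
  by rewrite (ex_components k _).1 exhh_value (linZ (linearP exF)); exact: mulr1.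
have EH k : exl (component (trH exT (exhh (exw k.+1))) exnu (word [:: exu1; exv2])) =
    k.+1%:R / k.+2%:R :> rat.
  rewrite (ex_components k _).2 exhh_value (linZ (linearP exH)) (linZ exl_lin).
  have -> : exl (exH exbu) = -1 :> rat by rewrite /exl /= oppr0 addr0.
  by rewrite -[LHS]/(_ * _) mulrN1 opprK.
split=> e; move/eqP: ne; apply; last by rewrite -(EH 0%N) -(EH 1%N) e.
by apply: oppr_inj; rewrite -(EF 0%N) -(EF 1%N) e.
Qed.

End Example.

Theorem theorem1p7 :
  (* the formulas for the components *)
  (forall (K : comPzRingType) (sym : bool) (C : cooperad K sym) (one : C 1%N)
      (A B : chain K) (f : {linear A -> B}) (g : {linear B -> A}) (h : {linear A -> A})
      (t : {linear schur C A -> schur C A}) (hh : {linear T A -> T A}),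
    connected one -> contraction f g h -> omega_algebra t ->
    thick_homotopy sym f g h hh ->
    forall (n : nat) (i : int) (nu : C n) (ts : seq (term C n)) (qs : seq (qterm C n)),
    (2 <= n)%N -> homog i nu ->
    coproduct_terms one i nu ts -> quadratic_terms one i ts qs ->
    [/\ forall x : T B,
          component (trt f g t hh) nu x =
          f (component t nu (tmap g x)) +
          \sum_(q <- ts) f (component t (ttop q)
            (comp_ins (trG g t hh) (tins q) (permw (labels (tsigma q)) x))),
        forall x : T B,
          component (trG g t hh) nu x =
          h (component t nu (tmap g x)) +
          \sum_(q <- ts) h (component t (ttop q)
            (comp_ins (trG g t hh) (tins q) (permw (labels (tsigma q)) x))),
        forall x : T A,
          component (trF f t hh) nu x =
          sgnz K i *: f (component t nu (hh x)) +
          \sum_(q <- qs) sgnz K (qdeg'' q) *: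
            component (trF f t hh) (qtop q)
              (comp_circ t q (permw (labels (qsigma q)) (hh x))) &
        forall x : T A,
          component (trH t hh) nu x =
          sgnz K i *: h (component t nu (hh x)) +
          \sum_(q <- qs) sgnz K (qdeg'' q) *:
            component (trH t hh) (qtop q)
              (comp_circ t q (permw (labels (qsigma q)) (hh x)))]) /\
  (* t' and G' do not depend on the pseudo-derivation extending h *)
  (forall (K : comPzRingType) (sym : bool) (C : cooperad K sym) (one : C 1%N)
      (A B : chain K) (f : {linear A -> B}) (g : {linear B -> A}) (h : {linear A -> A})
      (t : {linear schur C A -> schur C A}) (hh hh' : {linear T A -> T A}),
    connected one -> contraction f g h -> omega_algebra t ->
    thick_homotopy sym f g h hh -> thick_homotopy sym f g h hh' ->
    trt f g t hh = trt f g t hh' /\ trG g t hh = trG g t hh') /\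
  (* F' and H' do depend on it, in the symmetric and in the non-symmetric case *)
  (forall sym : bool,
    exists (K : comPzRingType) (C : cooperad K sym) (one : C 1%N)
      (A B : chain K) (f : {linear A -> B}) (g : {linear B -> A}) (h : {linear A -> A})
      (t : {linear schur C A -> schur C A}) (hh hh' : {linear T A -> T A}),
    [/\ connected one, contraction f g h, omega_algebra t,
        thick_homotopy sym f g h hh & thick_homotopy sym f g h hh'] /\
    (trF f t hh <> trF f t hh' /\ trH t hh <> trH t hh')).
Proof.
split; first exact: components_and_independence.
split=> [K sym C one A B f g h t hh hh' hone hc om ht ht'|sym].
  split; apply: funext => y; last exact: (trG_indep hone hc om ht ht').
  by rewrite (trt_trG hc om ht) (trt_trG hc om ht') (trG_indep hone hc om ht ht').
exists rat, (trivial_cooperad rat sym), (tone rat sym), exA, exB, exF, exG, exH, (exT sym).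
exists (exhh (exw 1)), (exhh (exw 2)); split; last exact: exhh_dependence.
split; [exact: trivial_connected|exact: ex_contraction|exact: ex_omega| |];
  exact: (ex_homotopy sym (exw_eq0 _)).
Qed.
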